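(* Let $p\ge 2$ and let $\mathscr{X}=\lambda\, u_1\otimes\cdots\otimes u_p+\mathscr{E}$, where $\lambda\ge 0$, the $u_k\in\mathbb{R}^d$ are unit vectors, and $\mathscr{E}\in \mathbb{R}^{d\times\cdots\times d}$ is a $p$th order random tensor whose entries are independent copies of a random variable $E$ with mean zero, variance one, and $\mathbb{E}|E|^\alpha<\infty$ for some $\alpha\ge 2$. Then there exist a numerical constant $C>0$ and another constant $C_p$ depending on $p$ only such that if $\lambda \ge C\lambda_{\rm crit}(d;\alpha)$, then $$\max_{1\le k\le p}\sin\angle(\hat{u}_k^{\rm SVD}, u_k)\le C_p\frac{\sqrt{d}}{\lambda},$$ with probability tending to one as $d$ increases.
   Context: The quantities $\lambda$ and $u_k$ may depend on $d$. The tensor SVD estimates are $(\hat{u}_k^{\rm SVD}: 1\le k\le p)=\arg\max_{a_1,\dots,a_p\in \mathbb{S}^{d-1}}\langle \mathscr{X}, a_1\otimes\cdots\otimes a_p\rangle$, where $\mathbb{S}^{d-1}$ is the Euclidean unit sphere in $\mathbb{R}^d$. The angle $\angle(a,b)$ between two nonzero vectors is taken in $[0,\pi/2]$ (so $\cos\angle(a,b)=|\langle a,b\rangle|/(\|a\|\|b\|)$). The critical signal strength is $$\lambda_{\rm crit}(d;\alpha):=\begin{cases}d^{1/2}(\log d)^{1/2}& \text{if }\alpha>4(p-1),\\ d^{\frac{p-1}{\alpha}+\frac{1}{4}}(\log d)^{3/2}& \text{if }4\le \alpha\le 4(p-1),\\ d^{\frac{p-1}{\alpha}+\frac{1}{2}}(\log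 d)^{3/2}& \text{if }2\le\alpha<4.\end{cases}$$ *)

(* Defs.v *)
From HB Require Import structures.
From mathcomp Require Import all_boot all_order all_algebra.
From mathcomp Require Import all_classical all_reals all_analysis.

Set Implicit Arguments.
Unset Strict Implicit.
Unset Printing Implicit Defensive.

Import Order.TTheory GRing.Theory Num.Theory.
Import numFieldNormedType.Exports.

Local Open Scope classical_set_scope.
Local Open Scope ring_scope.

Definition dotv (R : realType) (d : nat) (a b : 'rV[R]_d) : R :=
  \sum_(i < d) a 0 i * b 0 i.

(* The library norm on matrices is the sup norm, hence a separate definition. *)
Definition enorm (R : realType) (d : nat) (a : 'rV[R]_d) : R :=
  Num.sqrt (dotv a a).

Definition unit_sphere (R : realType) (d : nat) : set 'rV[R]_d :=
  [set a | enorm a = 1].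
Arguments unit_sphere : clear implicits.

(* The angle between two nonzero vectors up to sign, with values in [0, pi/2]. *)
Definition angle (R : realType) (d : nat) (a b : 'rV[R]_d) : R :=
  acos (`|dotv a b| / (enorm a * enorm b)).

(* R^(d x ... x d), p factors; entries are indexed by (i_1, ..., i_p). *)
Definition tensor (R : realType) (p d : nat) : Type :=
  {ffun 'I_p -> 'I_d} -> R.

Definition tensor_inner (R : realType) (p d : nat) (X Y : tensor R p d) : R :=
  \sum_(i : {ffun 'I_p -> 'I_d}) X i * Y i.

(* a_1 (x) ... (x) a_p *)
Definition rank_one (R : realType) (p d : nat) (a : 'I_p -> 'rV[R]_d) :
    tensor R p d :=
  fun i => \prod_(k < p) a k 0 (i k).

(* a is one of the maximizers: for p >= 2 they are not unique, as flipping signs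
   of two factors leaves the objective unchanged. *)
Definition is_tensor_svd (R : realType) (p d : nat) (X : tensor R p d)
    (a : 'I_p -> 'rV[R]_d) : Prop :=
  (forall k, unit_sphere R d (a k)) /\
  forall b : 'I_p -> 'rV[R]_d, (forall k, unit_sphere R d (b k)) ->
    tensor_inner X (rank_one b) <= tensor_inner X (rank_one a).

(* Only meant for 2 <= alpha. *)
Definition lambda_crit (R : realType) (p d : nat) (alpha : R) : R :=
  if 4 * (p%:R - 1) < alpha then
    d%:R `^ (1 / 2) * (ln d%:R) `^ (1 / 2)
  else if 4 <= alpha then
    d%:R `^ ((p%:R - 1) / alpha + 1 / 4) * (ln d%:R) `^ (3 / 2)
  else
    d%:R `^ ((p%:R - 1) / alpha + 1 / 2) * (ln d%:R) `^ (3 / 2).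

(* Mutual independence of a finite family; the sub-families are covered by
   taking some of the B i to be the whole line. *)
Definition independent_RVs (R : realType) (disp : measure_display)
    (T : measurableType disp) (P : probability T R) (I : finType)
    (X : I -> {RV P >-> R}) : Prop :=
  forall B : I -> set R, (forall i, measurable (B i)) ->
    P [set w | forall i, B i (X i w)] = (\prod_(i : I) P (X i @^-1` B i))%E.

Definition same_distribution (R : realType)
    (disp : measure_display) (T : measurableType disp) (P : probability T R)
    (disp' : measure_display) (T' : measurableType disp')
    (P' : probability T' R)
    (X : {RV P >-> R}) (Y : {RV P' >-> R}) : Prop :=
  forall B : set R, measurable B -> P (X @^-1` B) = P' (Y @^-1` B).

Definition independent_copies (R : realType)
    (disp : measure_display) (T : measurableType disp) (P : probability T R)
    (disp' : measure_display) (T' : measurableType disp')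
    (P' : probability T' R)
    (I : finType) (X : I -> {RV P >-> R}) (Y : {RV P' >-> R}) : Prop :=
  independent_RVs X /\ forall i, same_distribution (X i) Y.

(* A d holds with probability tending to one; stated with inner probability so
   that it is meaningful for A d not known to be measurable.  If every A d is
   measurable, it is equivalent to P d (A d) --> 1. *)
Definition with_high_probability (R : realType) (disp : nat -> measure_display)
    (T : forall d, measurableType (disp d))
    (P : forall d, probability (T d) R) (A : forall d, set (T d)) : Prop :=
  exists B : forall d, set (T d),
    [/\ forall d, measurable (B d), forall d, B d `<=` A d
      & (fun d => P d (B d)) @ \oo --> 1%E].

(* Main.v *)
Require Import Defs.
From HB Require Import structures.
From mathcomp Require Import all_boot all_order all_algebra.
From mathcomp Require Import all_classical all_reals all_analysis.
From mathcomp Require Import measurable_realfun.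
From mathcomp Require Import zify ring lra.

Set Implicit Arguments.
Unset Strict Implicit.
Unset Printing Implicit Defensive.

Import Order.TTheory GRing.Theory Num.Theory.
Import numFieldNormedType.Exports.

Local Open Scope classical_set_scope.
Local Open Scope ring_scope.

(** Why the theorem holds.  Write E for the noise tensor, and view a tensor as
    the multilinear form a |-> <E, a_1 (x) ... (x) a_p> ([mform]).

    Perturbation.  At a maximizer of the form of lambda u + E, the contraction
    with all factors but the k-th is a multiple of the k-th factor.  Testing
    this against the component w of that factor orthogonal to u_k removes the
    signal, so that lambda * |w| is at most about |E(u_1, ..., w/|w|, ..., u_p)|
    plus the norm of E times the sum of the distances from the other estimates
    to the u_l.  If the norm of E is at most lambda / (4 p), the last term is
    absorbed on the left, and the error is at most 3 S / lambda, where S bounds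
    the forms E(u_1, ..., b, ..., u_p) with one free unit vector b
    ([svd_perturbation]).  It remains to see that, with high probability, S is of
    order d^(1/2) with a universal constant, and that the norm of E is
    negligible compared with lambda_crit.

    Size of the norm.  In its three ranges lambda_crit is at least
    d^r (ln d)^(1/2) with r = max (1/2, p/alpha) ([lambda_crit_ge]), so a bound
    O(d^r (ln d)^(1/4)) on the norm suffices.  No entry exceeds
    B = d^r (ln d)^(1/4), by the union bound.  Entries larger than
    tau = d^(r - delta) are so rare that, for a small delta, no slice contains
    two of them; a tensor with this sparsity has norm at most its largest entry
    ([mform_sparse_le]).  The means of the truncated entries form a constant
    tensor, of small norm by the moment hypothesis.

    Truncated centred entries are bounded by a negative power of d times B,
    which leaves room for finitely many size classes of the coordinates, with
    thresholds d^(-j eta).  For a given tuple of classes, the vectors are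
    rounded to lattice points, linearity making the rounding exact up to a
    factor two per mode ([round_modes], [card_net]).  If two modes are nearly
    flat, Bernstein's inequality beats a net of exp(O(d)) points in every mode
    ([outside_net_all]).  Otherwise let the flattest mode be free and take nets
    only in the other modes ([outside_net_flat]): for fixed arguments there, the
    supremum over flat vectors is at most a sum, over the coordinates of the
    contraction, of a quadratic function capped by a linear one; its exponential
    moment is that of a sum of independent variables, and it is controlled
    through hyperbolic cosines ([mgf_contraction_le], [outside_flat]).

    Contractions with the planted factors.  The same estimate with no net at all
    bounds the contribution of the entries up to d^(1/4), and the larger ones
    contribute little because their variance tends to zero
    ([outside_planted]). *)

(** * Multilinear forms *)

Section MultilinearForm.
Variables (R : realType) (p d : nat).
Implicit Types (X : tensor R p d) (a : 'I_p -> 'I_d -> R) (v w : 'I_d -> R).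

Definition mform X a : R := \sum_i X i * \prod_(k < p) a k (i k).

Definition upd a k v : 'I_p -> 'I_d -> R := fun l => if l == k then v else a l.

(** The gradient of the form in mode k. *)
Definition mcontract X a k (j : 'I_d) : R :=
  \sum_(i : {ffun 'I_p -> 'I_d} | i k == j) X i * \prod_(l < p | l != k) a l (i l).

Definition sqn v : R := \sum_j v j ^+ 2.

Definition dotf v w : R := \sum_j v j * w j.

Lemma sqn_ge0 v : 0 <= sqn v.
Proof. by apply: sumr_ge0 => j _; exact: sqr_ge0. Qed.

Lemma sqnZ c v : sqn (fun j => c * v j) = c ^+ 2 * sqn v.
Proof. by rewrite /sqn mulr_sumr; apply: eq_bigr => j _; rewrite exprMn. Qed.

Lemma sqn_eq0 v : sqn v = 0 -> v = fun=> 0.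
Proof.
move=> /eqP; rewrite psumr_eq0; last by move=> j _; exact: sqr_ge0.
move=> /allP v0; apply/funext => j; apply/eqP; rewrite -sqrf_eq0.
by have := v0 j (mem_index_enum _).
Qed.

Lemma entry_le1 v j : sqn v <= 1 -> `|v j| <= 1.
Proof.
move=> v1; rewrite -(@expr_le1 _ 2)// real_normK ?num_real//; apply: le_trans v1.
by rewrite /sqn (bigD1 j)//= lerDl sumr_ge0// => i _; exact: sqr_ge0.
Qed.

Definition basisf (j : 'I_d) : 'I_d -> R := fun m => if m == j then 1 else 0.

Lemma sqn_basisf j : sqn (basisf j) = 1.
Proof.
rewrite /sqn (bigD1 j)//= /basisf eqxx expr1n big1 ?addr0// => m /negbTE ->.
by rewrite expr0n.
Qed.

Lemma dotf_basisf j v : dotf (basisf j) v = v j.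
Proof.
rewrite /dotf (bigD1 j)//= /basisf eqxx mul1r big1 ?addr0// => m /negbTE ->.
by rewrite mul0r.
Qed.

Lemma mform_upd X a k v : mform X (upd a k v) = dotf v (mcontract X a k).
Proof.
rewrite /mform /dotf (partition_big (fun i : {ffun 'I_p -> 'I_d} => i k) predT) //=.
apply: eq_bigr => j _; rewrite /mcontract mulr_sumr; apply: eq_bigr => i /eqP ikj.
rewrite (bigD1 k) //= {1}/upd eqxx ikj mulrCA; congr (_ * (_ * _)).
by apply: eq_bigr => l /negbTE lk; rewrite /upd lk.
Qed.

Lemma upd_id a k : upd a k (a k) = a.
Proof. by apply/funext => l; rewrite /upd; case: eqP => [->|]. Qed.

Lemma mform_mcontract X a k : mform X a = dotf (a k) (mcontract X a k).
Proof. by rewrite -mform_upd upd_id. Qed.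

Lemma dotfBl v1 v2 w : dotf (fun j => v1 j - v2 j) w = dotf v1 w - dotf v2 w.
Proof. by rewrite /dotf -sumrB; apply: eq_bigr => j _; rewrite mulrBl. Qed.

Lemma dotfZl c v w : dotf (fun j => c * v j) w = c * dotf v w.
Proof. by rewrite /dotf mulr_sumr; apply: eq_bigr => j _; rewrite mulrA. Qed.

Lemma dotfC v w : dotf v w = dotf w v.
Proof. by apply: eq_bigr => j _; rewrite mulrC. Qed.

Lemma dotfvv v : dotf v v = sqn v.
Proof. by apply: eq_bigr => j _; rewrite expr2. Qed.

Lemma sqnB v w : sqn (fun j => v j - w j) = sqn v - 2 * dotf v w + sqn w.
Proof.
rewrite /sqn /dotf mulr_sumr -sumrB -big_split; apply: eq_bigr => j _ /=.
by ring.
Qed.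

Lemma sqnD v w : sqn (fun j => v j + w j) = sqn v + 2 * dotf v w + sqn w.
Proof.
rewrite /sqn /dotf mulr_sumr -!big_split; apply: eq_bigr => j _ /=.
by ring.
Qed.

Lemma mformZ X (s : 'I_p -> R) a :
  mform X (fun l j => s l * a l j) = (\prod_l s l) * mform X a.
Proof.
rewrite /mform mulr_sumr; apply: eq_bigr => i _.
by rewrite big_split mulrCA.
Qed.

Lemma mformDl X1 X2 a :
  mform (fun i => X1 i + X2 i) a = mform X1 a + mform X2 a.
Proof. by rewrite /mform -big_split; apply: eq_bigr => i _; rewrite mulrDl. Qed.

Lemma mformZl c X a : mform (fun i => c * X i) a = c * mform X a.
Proof. by rewrite /mform mulr_sumr; apply: eq_bigr => i _; rewrite mulrA. Qed.

Lemma mform_prod (u a : 'I_p -> 'I_d -> R) :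
  mform (fun i => \prod_k u k (i k)) a = \prod_k dotf (u k) (a k).
Proof.
rewrite /mform /dotf bigA_distr_bigA; apply: eq_bigr => i _.
by rewrite -big_split.
Qed.

Lemma dotf_le1 v w : sqn v = 1 -> sqn w = 1 -> `|dotf v w| <= 1.
Proof.
move=> v1 w1; have := sqn_ge0 (fun j => v j - w j).
have := sqn_ge0 (fun j => v j + w j); rewrite sqnB sqnD v1 w1 => h1 h2.
by rewrite ler_norml; apply/andP; split; lra.
Qed.

(** A bound on the unit balls extends by homogeneity. *)
Lemma mform_homogeneous X N : 0 <= N ->
  (forall a, (forall k, sqn (a k) <= 1) -> `|mform X a| <= N) ->
  forall a, `|mform X a| <= N * \prod_k Num.sqrt (sqn (a k)).
Proof.
move=> N0 XN a; have [[k ak0]|/forallNP an0] := pselect (exists k, sqn (a k) = 0).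
  rewrite (mform_mcontract X a k) (sqn_eq0 ak0) /dotf big1 ?normr0; last first.
    by move=> j _; rewrite mul0r.
  by rewrite mulr_ge0// prodr_ge0// => l _; exact: sqrtr_ge0.
have sgt0 k : 0 < Num.sqrt (sqn (a k)).
  by rewrite sqrtr_gt0 lt_neqAle sqn_ge0 andbT eq_sym; apply/eqP/an0.
pose b : 'I_p -> 'I_d -> R := fun k j => (Num.sqrt (sqn (a k)))^-1 * a k j.
have -> : a = fun l j => Num.sqrt (sqn (a l)) * b l j.
  by apply/funext => l; apply/funext => j; rewrite /b mulrA mulfV ?mul1r ?gt_eqF.
rewrite mformZ normrM mulrC ler_pM//.
  apply: XN => k; rewrite /b sqnZ exprVn sqr_sqrtr ?sqn_ge0// mulVf//.
  exact/eqP/an0.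
rewrite ger0_norm; last by apply: prodr_ge0 => l _; exact: sqrtr_ge0.
apply: ler_prod => l _; rewrite sqrtr_ge0/=.
rewrite -/(b l) sqnZ sqrtrM ?sqr_ge0// sqrtr_sqr ger0_norm ?sqrtr_ge0//.
suff -> : Num.sqrt (sqn (b l)) = 1 by rewrite mulr1.
by rewrite /b sqnZ exprVn sqr_sqrtr ?sqn_ge0// mulVf ?sqrtr1//; exact/eqP/an0.
Qed.

(** Replacing the arguments one after the other costs the norm of the tensor
    times the length of each displacement. *)
Lemma mform_telescope X N (a b : 'I_p -> 'I_d -> R) k w : 0 <= N ->
  (forall a, (forall k, sqn (a k) <= 1) -> `|mform X a| <= N) ->
  (forall l, sqn (a l) <= 1) -> (forall l, sqn (b l) <= 1) ->
  `|mform X (upd a k w) - mform X (upd b k w)| <=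
    N * Num.sqrt (sqn w) * \sum_l Num.sqrt (sqn (fun j => a l j - b l j)).
Proof.
move=> N0 XN a1 b1.
pose h n : 'I_p -> 'I_d -> R :=
  upd (fun l => if (l < n)%N then b l else a l) k w.
have -> : upd a k w = h 0%N by [].
have -> : upd b k w = h p by congr upd; apply/funext => l; rewrite ltn_ord.
rewrite distrC -(telescope_sumr (fun n => mform X (h n))) //.
rewrite big_mkord (le_trans (ler_norm_sum _ _ _))// mulr_sumr ler_sum// => l _.
have [->|lk] := eqVneq l k.
  have -> : h k.+1 = h k.
    rewrite /h; apply/funext => m; rewrite /upd; case: eqP => // /eqP mk.
    by rewrite ltnS leq_eqVlt (inj_eq val_inj) (negbTE mk).
  rewrite subrr normr0 !mulr_ge0// ?sqrtr_ge0//.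
have -> : h l.+1 = upd (h l) l (b l).
  rewrite /h; apply/funext => m; rewrite /upd; have [->|mk] := eqVneq m k.
    by rewrite eq_sym (negbTE lk).
  have [->|ml] := eqVneq m l; first by rewrite ltnSn.
  by rewrite ltnS leq_eqVlt (inj_eq val_inj) (negbTE ml).
have -> : h l = upd (h l) l (a l).
  have hl : h l l = a l by rewrite /h /upd (negbTE lk) ltnn.
  by rewrite -hl upd_id.
have -> : upd (upd (h l) l (a l)) l (b l) = upd (h l) l (b l).
  by apply/funext => m; rewrite /upd; case: eqP.
rewrite distrC 2!mform_upd -dotfBl -mform_upd.
apply: le_trans (mform_homogeneous N0 XN _) _.
rewrite -mulrA ler_wpM2l// (bigD1 l)//= /upd eqxx mulrC.
have kl : (k == l) = false by rewrite eq_sym (negbTE lk).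
rewrite ler_wpM2r ?sqrtr_ge0// (bigD1 k) ?kl//= {1}/h /upd eqxx.
rewrite -[leRHS]mulr1 ler_wpM2l ?sqrtr_ge0// prodr_ile1// => m /andP[ml mk].
rewrite sqrtr_ge0/= (negbTE ml) /h /upd (negbTE mk).
by rewrite -[leRHS]sqrtr1 ler_wsqrtr//; case: ifP.
Qed.

End MultilinearForm.
(** * Perturbation of the maximizer *)

Section Perturbation.
Variables (R : realType) (p d : nat).
Implicit Types (X : tensor R p d) (a u : 'I_p -> 'I_d -> R) (v w : 'I_d -> R).

(** At a maximizer over the spheres each partial contraction is a multiple of
    the corresponding factor: it has norm at most the maximum, which is also its
    inner product with that unit vector. *)
Lemma maximizer_mcontract X a :
  (forall k, sqn (a k) = 1) ->
  (forall b : 'I_p -> 'I_d -> R, (forall k, sqn (b k) = 1) -> mform X b <= mform X a) ->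
  0 <= mform X a ->
  forall k, mcontract X a k = fun j => mform X a * a k j.
Proof.
move=> a1 maxa V0 k; set V := mform X a; set x := mcontract X a k.
have axV : dotf (a k) x = V by rewrite /x -mform_mcontract.
have xV : sqn x <= V ^+ 2.
  have [x0|x0] := eqVneq (sqn x) 0; first by rewrite x0 sqr_ge0.
  have sx : 0 < Num.sqrt (sqn x) by rewrite sqrtr_gt0 lt_def x0 sqn_ge0.
  pose b := upd a k (fun j => (Num.sqrt (sqn x))^-1 * x j).
  have b1 l : sqn (b l) = 1.
    rewrite /b /upd; case: ifP => // _.
    by rewrite sqnZ exprVn sqr_sqrtr ?sqn_ge0// mulVf.
  have := maxa _ b1; rewrite /b mform_upd -/x dotfZl dotfvv.
  rewrite -{2}(sqr_sqrtr (sqn_ge0 x)) expr2 mulrA mulVf ?gt_eqF// mul1r => sV.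
  by rewrite -(sqr_sqrtr (sqn_ge0 x)) lerXn2r ?nnegrE ?sqrtr_ge0.
have : sqn (fun j => x j - V * a k j) = 0.
  apply/eqP; rewrite eq_le sqn_ge0 andbT sqnB sqnZ a1 mulr1.
  by rewrite dotfC dotfZl axV; lra.
move=> /sqn_eq0 xe; apply/funext => j.
by have /(congr1 (fun f => f j))/eqP := xe; rewrite subr_eq0 => /eqP.
Qed.

Lemma svd_perturbation u a (X : tensor R p d) (lam N S : R) :
  (2 <= p)%N -> 0 < lam -> 0 <= N -> 4 * p%:R * N <= lam ->
  (forall k, sqn (u k) = 1) -> (forall k, sqn (a k) = 1) ->
  (forall b : 'I_p -> 'I_d -> R, (forall k, sqn (b k) = 1) ->
     mform (fun i => lam * (\prod_k u k (i k)) + X i) b <=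
     mform (fun i => lam * (\prod_k u k (i k)) + X i) a) ->
  (forall b, (forall k, sqn (b k) <= 1) -> `|mform X b| <= N) ->
  (forall k v, sqn v <= 1 -> `|mform X (upd u k v)| <= S) ->
  forall k, Num.sqrt (1 - dotf (a k) (u k) ^+ 2) <= 3 * S / lam.
Proof.
move=> p2 lam0 N0 Nlam u1 a1.
set Y := fun i => _; move=> maxa XN XS.
have YE b : mform Y b = lam * (\prod_k dotf (u k) (b k)) + mform X b.
  by rewrite mformDl mformZl mform_prod.
pose g k := dotf (a k) (u k).
pose s k := Num.sqrt (1 - g k ^+ 2).
have g1 k : `|g k| <= 1 by exact: dotf_le1.
have g21 k : 0 <= 1 - g k ^+ 2.
  by rewrite subr_ge0 -(real_normK (num_real _)) expr_le1.
have s0 k : 0 <= s k by exact: sqrtr_ge0.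
have le1 v : sqn v = 1 -> sqn v <= 1 by move=> ->.
have k0 : 'I_p by exact: (Ordinal (ltnW p2)).
pose m := [arg max_(i > k0) s i]%O.
have sm k : s k <= s m.
  by rewrite /m; case: (@Order.TotalTheory.arg_maxP _ _ _ k0 predT s) => // i _; exact.
suff sS : s m <= 3 * S / lam by move=> k; exact: le_trans (sm k) sS.
pose V := mform Y a.
have p4 : 8 * N <= lam.
  apply: le_trans Nlam; rewrite ler_wpM2r//.
  have : 2 <= p%:R :> R by rewrite (ler_nat _ 2 p).
  lra.
have VN : lam - N <= V.
  apply: le_trans (maxa u u1); rewrite YE big1; last by move=> k _; rewrite dotfvv.
  rewrite mulr1 lerD2l; have := XN u (fun k => le1 _ (u1 k)).
  by rewrite ler_norml => /andP[].
have V0 : 0 <= V by apply: le_trans VN; lra.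
have cE := maximizer_mcontract a1 maxa V0 m.
(* The component of the estimate orthogonal to the planted factor: it sees
   only the noise. *)
pose w j := a m j - g m * u m j.
have wu : dotf (u m) w = 0.
  by rewrite dotfC dotfBl dotfZl dotfvv u1 mulr1 subrr.
have wa : dotf w (a m) = 1 - g m ^+ 2.
  by rewrite dotfBl dotfZl dotfvv a1 dotfC dotfC (dotfC (u m)) -/(g m) expr2.
have ww : sqn w = 1 - g m ^+ 2.
  by rewrite sqnB sqnZ a1 u1 dotfC dotfZl dotfC -/(g m); ring.
have sw : Num.sqrt (sqn w) = s m by rewrite ww.
have VX : V * (s m) ^+ 2 = mform X (upd a m w).
  have : mform Y (upd a m w) = V * (s m) ^+ 2.
    rewrite mform_upd cE dotfC -/V dotfZl dotfC wa.
    by rewrite sqr_sqrtr.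
  move=> <-; rewrite YE (bigD1 m)//= /upd eqxx.
  by rewrite -/(upd a m w) wu mul0r mulr0 add0r.
(* The sign of each planted factor is chosen so that it points towards the
   estimate. *)
pose e l : R := if 0 <= g l then 1 else -1.
have eg l : e l * g l = `|g l|.
  by rewrite /e; case: ger0P => _; rewrite ?mul1r ?mulN1r.
have e2 l : e l ^+ 2 = 1 by rewrite /e; case: ifP => _; rewrite ?sqrrN expr1n.
pose b l j := e l * u l j.
have b1 l : sqn (b l) <= 1 by rewrite /b sqnZ e2 u1 mulr1.
have ab l : Num.sqrt (sqn (fun j => a l j - b l j)) <= 2 * s m.
  apply: le_trans (_ : 2 * s l <= _); last by rewrite ler_wpM2l.
  have -> : 2 * s l = Num.sqrt (4 * (1 - g l ^+ 2)).
    rewrite sqrtrM; last by lra.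
    by have -> : 4 = 2 ^+ 2 :> R; [ring|rewrite sqrtr_sqr ger0_norm].
  apply: ler_wsqrtr; rewrite sqnB a1 /b sqnZ e2 u1 dotfC dotfZl dotfC -/(g l) eg.
  rewrite -(real_normK (num_real (g l))).
  have := g1 l; have := normr_ge0 (g l); set t := `|g l|; nra.
have bw : `|mform X (upd b m w)| <= S * s m.
  have -> : upd b m w = fun l j => (if l == m then 1 else e l) * upd u m w l j.
    apply/funext => l; apply/funext => j; rewrite /upd /b.
    by case: ifP => _; rewrite ?mul1r.
  rewrite mformZ normrM normr_prod big1 ?mul1r; last first.
    move=> l _; rewrite /e; case: ifP => _; first by rewrite normr1.
    by case: ifP => _; rewrite ?normrN1 ?normr1.
  have [s00|s00] := eqVneq (s m) 0.
    rewrite mform_upd (_ : w = fun=> 0); last first.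
      by apply: sqn_eq0; rewrite -(sqr_sqrtr (sqn_ge0 w)) sw s00 expr0n.
    by rewrite s00 mulr0 /dotf big1 ?normr0// => j _; rewrite mul0r.
  have := @XS m (fun j => (s m)^-1 * w j).
  rewrite sqnZ exprVn -(sqr_sqrtr (sqn_ge0 w)) sw mulVf ?expf_neq0// => /(_ (lexx _)).
  rewrite !mform_upd dotfZl normrM ger0_norm ?invr_ge0// => h.
  have sm0 : 0 < s m by rewrite lt_def s00 s0.
  by rewrite -ler_pdivrMr// mulrC.
have tele := mform_telescope m w N0 XN (fun l => le1 _ (a1 l)) b1.
rewrite sw in tele.
have sumb : \sum_l Num.sqrt (sqn (fun j => a l j - b l j)) <= p%:R * (2 * s m).
  apply: le_trans (ler_sum _ (fun l _ => ab l)) _.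
  by rewrite sumr_const card_ord -[leLHS]mulr_natl.
have main : V * s m ^+ 2 <= S * s m + N * s m * (p%:R * (2 * s m)).
  rewrite VX (le_trans (ler_norm _))//.
  rewrite -[X in `|X|](subrK (mform X (upd b m w))) (le_trans (ler_normD _ _))//.
  rewrite addrC lerD// (le_trans tele)// ler_wpM2l// mulr_ge0//.
have S0 : 0 <= S.
  apply: le_trans (normr_ge0 _) (XS m (fun=> 0) _).
  by rewrite /sqn big1// => j _; rewrite expr0n.
have [s00|s00] := eqVneq (s m) 0.
  by rewrite s00 divr_ge0 ?mulr_ge0// ltW.
have sm0 : 0 < s m by rewrite lt_def s00 s0.
rewrite ler_pdivlMr//.
have : V * s m <= S + 2 * (p%:R * N) * s m.
  rewrite -(ler_pM2r sm0) mulrDl; move: main; rewrite expr2.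
  by rewrite (_ : N * s m * (p%:R * (2 * s m)) = 2 * (p%:R * N) * s m * s m) ?mulrA//; ring.
have h1 : (lam - N) * s m <= V * s m by rewrite ler_pM2r.
have h2 : 4 * (p%:R * N) * s m <= lam * s m by rewrite ler_pM2r// mulrA.
have h3 : 8 * N * s m <= lam * s m by rewrite ler_pM2r.
by nra.
Qed.

End Perturbation.
(** * Bounded random variables *)

Section BoundedMeasurable.
Variables (R : realType) (disp : measure_display) (T : measurableType disp).
Implicit Types (f g : T -> R).

Definition bounded_meas f : Prop :=
  measurable_fun setT f /\ exists M, forall x, `|f x| <= M.

Lemma bmeas_cst c : bounded_meas (fun=> c).
Proof. by split; [exact: measurable_cst|exists `|c|]. Qed.

Lemma bmeasD f g : bounded_meas f -> bounded_meas g ->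
  bounded_meas (fun x => f x + g x).
Proof.
move=> [mf [M fM]] [mg [N gN]]; split; first exact: measurable_funD.
by exists (M + N) => x; rewrite (le_trans (ler_normD _ _))// lerD.
Qed.

Lemma bmeasM f g : bounded_meas f -> bounded_meas g ->
  bounded_meas (fun x => f x * g x).
Proof.
move=> [mf [M fM]] [mg [N gN]]; split; first exact: measurable_funM.
by exists (M * N) => x; rewrite normrM ler_pM.
Qed.

Lemma bmeasZ c f : bounded_meas f -> bounded_meas (fun x => c * f x).
Proof. by move=> bf; apply: bmeasM => //; exact: bmeas_cst. Qed.

Lemma bmeasB f g : bounded_meas f -> bounded_meas g ->
  bounded_meas (fun x => f x - g x).
Proof.
move=> bf bg; under [X in bounded_meas X]eq_fun do rewrite -mulN1r.
by apply: bmeasD => //; exact: bmeasZ.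
Qed.

Lemma bmeasX f n : bounded_meas f -> bounded_meas (fun x => f x ^+ n).
Proof.
move=> bf; elim: n => [|n IH]; first exact: bmeas_cst.
by under [X in bounded_meas X]eq_fun do rewrite exprS; exact: bmeasM.
Qed.

Lemma bmeas_sum (I : Type) (s : seq I) (P : pred I) (h : I -> T -> R) :
  (forall i, bounded_meas (h i)) ->
  bounded_meas (fun x => \sum_(i <- s | P i) h i x).
Proof.
move=> bh; elim: s => [|i s IH].
  by under [X in bounded_meas X]eq_fun do rewrite big_nil; exact: bmeas_cst.
under [X in bounded_meas X]eq_fun do rewrite big_cons.
by case: (P i) => //; exact: bmeasD.
Qed.

Lemma bmeas_prod (I : Type) (s : seq I) (P : pred I) (h : I -> T -> R) :
  (forall i, bounded_meas (h i)) ->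
  bounded_meas (fun x => \prod_(i <- s | P i) h i x).
Proof.
move=> bh; elim: s => [|i s IH].
  by under [X in bounded_meas X]eq_fun do rewrite big_nil; exact: bmeas_cst.
under [X in bounded_meas X]eq_fun do rewrite big_cons.
by case: (P i) => //; exact: bmeasM.
Qed.

Lemma bmeas_exp f : bounded_meas f -> bounded_meas (fun x => expR (f x)).
Proof.
move=> [mf [M fM]]; split; first exact: measurableT_comp.
exists (expR M) => x; rewrite ger0_norm ?expR_ge0// ler_expR.
by rewrite (le_trans (ler_norm _)).
Qed.

Lemma bmeas_norm f : bounded_meas f -> bounded_meas (fun x => `|f x|).
Proof.
move=> [mf [M fM]]; split; first exact: measurableT_comp.
by exists M => x; rewrite normr_id.
Qed.

Lemma bmeas_min f g : bounded_meas f -> bounded_meas g ->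
  bounded_meas (fun x => Num.min (f x) (g x)).
Proof.
move=> [mf [M fM]] [mg [N gN]]; split; first exact: measurable_minr.
exists (M + N) => x; have := fM x; have := gN x.
have := normr_ge0 (f x); have := normr_ge0 (g x).
by rewrite minEle; case: ifP => _; lra.
Qed.

Lemma bmeas_indic (A : set T) : measurable A -> bounded_meas \1_A.
Proof.
move=> mA; split; first exact: measurable_indic.
by exists 1 => x; rewrite indicE; case: (x \in A); rewrite ?normr1 ?normr0.
Qed.

Lemma bmeas_comp (g : R -> R) (X : T -> R) :
  measurable_fun setT g -> (exists M, forall x, `|g x| <= M) ->
  measurable_fun setT X -> bounded_meas (fun x => g (X x)).
Proof.
move=> mg [M gM] mX; split; first exact: (measurableT_comp mg mX).
by exists M.
Qed.

Lemma measurable_gt_fun f c : measurable_fun setT f -> measurable [set x | c < f x].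
Proof.
move=> mf; rewrite (_ : [set _ | _] = f @^-1` `]c, +oo[%classic); last first.
  by apply/seteqP; split => x /=; rewrite in_itv/= andbT.
by rewrite -[X in measurable X]setTI; exact: mf.
Qed.

End BoundedMeasurable.

Section RealExpectation.
Variables (R : realType) (disp : measure_display) (T : measurableType disp).
Variable P : probability T R.
Implicit Types (f g : T -> R).

(** A real number rather than an extended one: expanding products of hyperbolic
    cosines produces terms of both signs. *)
Definition rexp f : R := \int[P]_x f x.

Lemma bmeas_integrable f : bounded_meas f -> P.-integrable setT (EFin \o f).
Proof.
move=> [mf [M fM]]; apply: measurable_bounded_integrable => //.
  by rewrite (le_lt_trans (probability_le1 _ _))// ltry.
exists M; split; first exact: num_real.
by move=> y My x _ /=; apply: le_trans (fM x) _; exact: ltW.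
Qed.

Lemma rexpD f g : bounded_meas f -> bounded_meas g ->
  rexp (fun x => f x + g x) = rexp f + rexp g.
Proof.
by move=> bf bg; rewrite /rexp RintegralD//; exact: bmeas_integrable.
Qed.

Lemma rexpZ c f : bounded_meas f -> rexp (fun x => c * f x) = c * rexp f.
Proof. by move=> bf; rewrite /rexp RintegralZl//; exact: bmeas_integrable. Qed.

Lemma rexpB f g : bounded_meas f -> bounded_meas g ->
  rexp (fun x => f x - g x) = rexp f - rexp g.
Proof.
move=> bf bg; under eq_fun do rewrite -mulN1r.
by rewrite rexpD ?rexpZ ?mulN1r//; exact: bmeasZ.
Qed.

Lemma rexp_cst c : rexp (fun=> c) = c.
Proof.
rewrite /rexp Rintegral_cst// [X in fine X](_ : _ = 1%E) ?mulr1//.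
exact: probability_setT. Qed.

Lemma rexp_sum (I : Type) (s : seq I) (Q : pred I) (h : I -> T -> R) :
  (forall i, bounded_meas (h i)) ->
  rexp (fun x => \sum_(i <- s | Q i) h i x) = \sum_(i <- s | Q i) rexp (h i).
Proof.
move=> bh; elim: s => [|i s IH].
  by under eq_fun do rewrite big_nil; rewrite rexp_cst big_nil.
under eq_fun do rewrite big_cons; rewrite big_cons; case: (Q i) => //.
by rewrite rexpD ?IH//; exact: bmeas_sum.
Qed.

Lemma rexp_le f g : bounded_meas f -> bounded_meas g ->
  (forall x, f x <= g x) -> rexp f <= rexp g.
Proof.
by move=> bf bg fg; apply: le_Rintegral => //; exact: bmeas_integrable.
Qed.

Lemma rexp_ge0 f : (forall x, 0 <= f x) -> 0 <= rexp f.
Proof. by move=> f0; apply: Rintegral_ge0. Qed.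

Lemma rexp_indic (A : set T) : measurable A -> P A = (rexp \1_A)%:E.
Proof.
move=> mA; rewrite /rexp /Rintegral integral_indic// setIT fineK//.
exact: fin_num_measure.
Qed.

Lemma markov_rexp f (t : R) : bounded_meas f -> (forall x, 0 <= f x) -> 0 < t ->
  (P [set x | (t < f x)%R] <= (rexp f / t)%:E)%E.
Proof.
move=> bf f0 t0; have mA := @measurable_gt_fun _ _ _ f t bf.1.
rewrite (rexp_indic mA) lee_fin ler_pdivlMr// mulrC -rexpZ; last exact: bmeas_indic.
apply: rexp_le => //; first by apply: bmeasZ; exact: bmeas_indic.
move=> x; rewrite indicE; case: (boolP (x \in _)) => [|_]; last by rewrite mulr0.
by rewrite inE/= mulr1 => /ltW.
Qed.

End RealExpectation.

Section Discretization.
Variable R : realType.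

(** A staircase of N unit steps stays within one unit below the identity. *)
Lemma count_steps (N : nat) (y : R) : 0 <= y ->
  Num.min (y - 1) N%:R <= \sum_(k < N) (k.+1%:R <= y)%R%:R :> R /\
  \sum_(k < N) (k.+1%:R <= y)%R%:R <= Num.min y N%:R :> R.
Proof.
move=> y0; elim: N => [|N [IH1 IH2]].
  by rewrite big_ord0 !ge_min !le_min lexx !orbT y0.
rewrite big_ord_recr/=; move: IH1 IH2.
set S := \sum_(i < N) _ => IH1 IH2.
have [yN|yN] := leP N.+1%:R y; rewrite /= -[N.+1%:R]natr1 in yN *.
  have NS : N%:R <= S by move: IH1; rewrite (min_idPr _)// lerBrDr.
  have SN : S <= N%:R by move: IH2; rewrite (min_idPr _)// (le_trans _ yN)// lerDl.
  rewrite [S + 1 <= _]lerD2r SN; split=> //.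
  by rewrite ge_min lerD2r NS orbT.
rewrite addr0; split; last first.
  by apply: le_trans IH2 _; rewrite ge_min lexx.
move: IH1; rewrite (min_idPl _); last by rewrite lerBlDr ltW.
by move=> /(le_trans _); apply; rewrite ge_min lexx.
Qed.

End Discretization.
(** * The product rule for expectations *)

Section Independence.
Variables (R : realType) (disp : measure_display) (T : measurableType disp).
Variables (P : probability T R).
Variables (disp0 : measure_display) (T0 : measurableType disp0).
Variables (P0 : probability T0 R).

(** An identity that is linear and monotone in f passes from indicators to
    bounded functions by approximation with staircases. *)
Lemma rexp_indic_ext (X G : T -> R) (Y : T0 -> R) (c : R) (f : R -> R) :
  measurable_fun setT X -> measurable_fun setT Y ->
  bounded_meas G -> (forall w, 0 <= G w) -> 0 <= c ->
  (forall B : set R, measurable B ->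
    rexp P (fun w => \1_B (X w) * G w) = rexp P0 (fun w => \1_B (Y w)) * c) ->
  bounded_meas f -> (forall x, 0 <= f x) ->
  rexp P (fun w => f (X w) * G w) = rexp P0 (fun w => f (Y w)) * c.
Proof.
move=> mX mY bG G0 c0 ind bf f0; have [mf [M fM]] := bf.
have compX (g : R -> R) : bounded_meas g -> bounded_meas (fun w => g (X w)).
  by move=> [mg bg]; exact: bmeas_comp.
have compY (g : R -> R) : bounded_meas g -> bounded_meas (fun w => g (Y w)).
  by move=> [mg bg]; exact: bmeas_comp.
apply/eqP; rewrite -subr_eq0 -normr_eq0; apply/eqP/le_anti; rewrite normr_ge0 andbT.
apply/ler_addgt0Pr => e e0; rewrite add0r.
pose K := rexp P G + c; have K0 : 0 <= K by rewrite addr_ge0 ?rexp_ge0.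
pose n := (Num.truncn (K / e)).+1.
have n0 : 0 < n%:R :> R by rewrite ltr0n.
pose N := (Num.truncn (n%:R * M)).+1.
pose B (k : nat) : set R := [set x | k.+1%:R <= n%:R * f x].
have mB k : measurable (B k).
  rewrite (_ : B k = (fun x => n%:R * f x) @^-1` `[k.+1%:R, +oo[%classic).
    by rewrite -[X in measurable X]setTI; apply: (bmeasZ n%:R bf).1.
  by apply/seteqP; split => x /=; rewrite in_itv/= andbT.
pose st x : R := n%:R^-1 * \sum_(k < N) \1_(B k) x.
have bst : bounded_meas st.
  by apply: bmeasZ; apply: bmeas_sum => k; exact: bmeas_indic.
have stf x : f x - n%:R^-1 <= st x <= f x.
  have y0 : 0 <= n%:R * f x by rewrite mulr_ge0.
  have yN : n%:R * f x <= N%:R.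
    apply/ltW/(le_lt_trans _ (truncnS_gt _)).
    by rewrite ler_pM2l// (le_trans (ler_norm _)).
  have := @count_steps R N _ y0.
  rewrite (min_idPl yN) (min_idPl _); last first.
    by rewrite (le_trans _ yN)// lerBlDr lerDl.
  have -> : \sum_(k < N) (k.+1%:R <= n%:R * f x)%R%:R = n%:R * st x :> R.
    rewrite /st mulrA mulfV ?gt_eqF// mul1r; apply: eq_bigr => k _.
    by rewrite indicE mem_setE.
  move=> [h1 h2]; apply/andP; split; last by rewrite -(ler_pM2l n0).
  by rewrite -(ler_pM2l n0) mulrBr mulfV ?gt_eqF.
have st_eq : rexp P (fun w => st (X w) * G w) = rexp P0 (fun w => st (Y w)) * c.
  have -> : (fun w => st (X w) * G w) =
     (fun w => n%:R^-1 * \sum_(k < N) (\1_(B k) (X w) * G w)).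
    by apply/funext => w; rewrite /st -mulrA mulr_suml.
  rewrite rexpZ; last first.
    by apply: bmeas_sum => k; apply: bmeasM => //; apply: compX; exact: bmeas_indic.
  rewrite rexp_sum; last first.
    by move=> k; apply: bmeasM => //; apply: compX; exact: bmeas_indic.
  rewrite (eq_bigr _ (fun (k : 'I_N) _ => ind (B k) (mB k))) -mulr_suml mulrA.
  rewrite /st rexpZ ?rexp_sum//.
  - by move=> k; apply: compY; exact: bmeas_indic.
  - by apply: bmeas_sum => k; apply: compY; exact: bmeas_indic.
have bfG : bounded_meas (fun w => f (X w) * G w) by apply: bmeasM => //; exact: compX.
have bsG : bounded_meas (fun w => st (X w) * G w) by apply: bmeasM => //; exact: compX.
have A1 : rexp P (fun w => st (X w) * G w) <= rexp P (fun w => f (X w) * G w).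
  by apply: rexp_le => // w; rewrite ler_wpM2r//; have /andP[] := stf (X w).
have A2 : rexp P (fun w => f (X w) * G w) <=
          rexp P (fun w => st (X w) * G w) + n%:R^-1 * rexp P G.
  rewrite -rexpZ// -rexpD//; last exact: bmeasZ.
  apply: rexp_le => //; first by apply: bmeasD => //; exact: bmeasZ.
  move=> w; rewrite -mulrDl ler_wpM2r//.
  by have /andP[] := stf (X w); rewrite lerBlDr.
have B1 : rexp P0 (fun w => st (Y w)) <= rexp P0 (fun w => f (Y w)).
  apply: rexp_le; [exact: compY|exact: compY|].
  by move=> w; have /andP[] := stf (Y w).
have B2 : rexp P0 (fun w => f (Y w)) <= rexp P0 (fun w => st (Y w)) + n%:R^-1.
  rewrite -[X in _ + X](rexp_cst P0) -rexpD//; [|exact: compY|exact: bmeas_cst].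
  apply: rexp_le; [exact: compY|by apply: bmeasD; [exact: compY|exact: bmeas_cst]|].
  by move=> w; have /andP[] := stf (Y w); rewrite lerBlDr.
have C1 := ler_wpM2r c0 B1; have C2 := ler_wpM2r c0 B2; rewrite mulrDl in C2.
have nK : n%:R^-1 * rexp P G + n%:R^-1 * c <= e.
  rewrite -mulrDr -/K ler_pdivrMl// mulrC -ler_pdivrMl// mulrC.
  exact/ltW/truncnS_gt.
have g0 : 0 <= n%:R^-1 * rexp P G by rewrite mulr_ge0 ?invr_ge0 ?rexp_ge0// ltW.
have h0 : 0 <= n%:R^-1 * c by rewrite mulr_ge0 ?invr_ge0// ltW.
by rewrite st_eq in A1 A2; rewrite ler_norml; apply/andP; split; lra.
Qed.

Variables (I : finType) (X : I -> {RV P >-> R}) (Y : {RV P0 >-> R}).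
Hypothesis XY : independent_copies X Y.

(** The product rule for probabilities becomes the product rule for
    expectations by replacing one indicator at a time. *)
Lemma rexp_prod (f : I -> R -> R) :
  (forall i, bounded_meas (f i)) -> (forall i x, 0 <= f i x) ->
  rexp P (fun w => \prod_i f i (X i w)) = \prod_i rexp P0 (fun w => f i (Y w)).
Proof.
have [indX sameX] := XY.
have compX i (g : R -> R) : bounded_meas g -> bounded_meas (fun w => g (X i w)).
  by move=> [mg bg]; apply: bmeas_comp.
have compY (g : R -> R) : bounded_meas g -> bounded_meas (fun w => g (Y w)).
  by move=> [mg bg]; apply: bmeas_comp.
suff ind (s : seq I) : forall f : I -> R -> R,
    (forall i, bounded_meas (f i)) -> (forall i x, 0 <= f i x) ->
    (forall i, i \notin s -> exists B : set R, measurable B /\ f i = \1_B) ->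
    rexp P (fun w => \prod_i f i (X i w)) = \prod_i rexp P0 (fun w => f i (Y w)).
  by move=> bf f0; apply: (ind (enum I)) => // i; rewrite mem_enum.
elim: s => [|i s IH] {}f bf f0 fs.
  have /choice[B HB] : forall i, exists B : set R, measurable B /\ f i = \1_B.
    by move=> i; exact: fs.
  have -> : (fun w => \prod_i f i (X i w)) = \1_[set w | forall i, B i (X i w)].
    apply/funext => w; rewrite indicE.
    have [Bw|/existsNP[i nB]] := pselect (forall i, B i (X i w)).
      rewrite mem_set// big1// => i _.
      by rewrite (HB i).2 indicE mem_set.
    rewrite memNset; last by move=> /= /(_ i).
    by rewrite (bigD1 i)//= (HB i).2 indicE memNset// mul0r.
  have mX i : measurable (X i @^-1` B i).
    by rewrite -[X in measurable X]setTI; apply: measurable_funP => //; exact: (HB i).1.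
  have mY i : measurable (Y @^-1` B i).
    by rewrite -[X in measurable X]setTI; apply: measurable_funP => //; exact: (HB i).1.
  apply: EFin_inj; rewrite -rexp_indic; last first.
    rewrite (_ : [set w | _] = \bigcap_(i in [set: I]) (X i @^-1` B i)).
      by apply: fin_bigcap_measurable => //; exact: finite_finset.
    by apply/seteqP; split => w /= h i; [move=> _; exact: h|exact: h].
  rewrite indX; last by move=> i; exact: (HB i).1.
  rewrite -prodEFin; apply: eq_bigr => i _.
  by rewrite sameX ?(rexp_indic P0 (mY i)) ?(HB i).2//; exact: (HB i).1.
rewrite (bigD1 i)//=.
have -> : (fun w => \prod_l f l (X l w)) =
   fun w => f i (X i w) * \prod_(l | l != i) f l (X l w).
  by apply/funext => w; rewrite (bigD1 i).
apply: rexp_indic_ext => //.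
- by apply: bmeas_prod => l; exact: compX.
- by move=> w; exact: prodr_ge0.
- by apply: prodr_ge0 => l _; exact: rexp_ge0.
move=> B mB; pose h l := if l == i then \1_B else f l.
have hi : h i = \1_B by rewrite /h eqxx.
have hl l : l != i -> h l = f l by rewrite /h => /negbTE ->.
transitivity (rexp P (fun w => \prod_l h l (X l w))).
  congr rexp; apply/funext => w; rewrite [RHS](bigD1 i)//= hi.
  by congr (_ * _); apply: eq_bigr => l li; rewrite hl.
rewrite IH.
- rewrite (bigD1 i)//= hi.
  by congr (_ * _); apply: eq_bigr => l li; rewrite hl.
- by move=> l; rewrite /h; case: ifP => // _; exact: bmeas_indic.
- by move=> l x; rewrite /h; case: ifP => // _; rewrite indicE.
move=> l ls; rewrite /h; case: eqP => [_|/eqP li]; first by exists B.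
by apply: fs; rewrite inE negb_or li.
Qed.

End Independence.
(** * Events of small probability *)

Section Outside.
Variables (R : realType) (disp : measure_display) (T : measurableType disp).
Variable P : probability T R.
Implicit Types (e : R) (Q : T -> Prop).

(** Q holds off an event of probability at most e; Q itself is often an
    uncountable conjunction, whose measurability is not obvious. *)
Definition outside e Q : Prop :=
  exists G : set T, [/\ measurable G, (P (~` G) <= e%:E)%E & forall w, G w -> Q w].

Lemma outside_weaken e e' Q Q' : e <= e' -> (forall w, Q w -> Q' w) ->
  outside e Q -> outside e' Q'.
Proof.
move=> ee' QQ' [G [mG Ge GQ]]; exists G; split => //.
  by rewrite (le_trans Ge)// lee_fin.
by move=> w /GQ /QQ'.
Qed.

Lemma outside_true e Q : 0 <= e -> (forall w, Q w) -> outside e Q.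
Proof. by move=> e0 QT; exists setT; rewrite setCT measure0 lee_fin. Qed.

Lemma outside_and e1 e2 Q1 Q2 : outside e1 Q1 -> outside e2 Q2 ->
  outside (e1 + e2) (fun w => Q1 w /\ Q2 w).
Proof.
move=> [G1 [mG1 Ge1 GQ1]] [G2 [mG2 Ge2 GQ2]]; exists (G1 `&` G2); split.
- exact: measurableI.
- rewrite setCI (le_trans (measureU2 _ _ _))//; try exact: measurableC.
  by rewrite EFinD leeD.
- by move=> w [/GQ1 ? /GQ2].
Qed.

Lemma outside_seq (I : eqType) (s : seq I) (e : I -> R) (Q : I -> T -> Prop) :
  (forall i, i \in s -> outside (e i) (Q i)) ->
  outside (\sum_(i <- s) e i) (fun w => forall i, i \in s -> Q i w).
Proof.
elim: s => [|i s IH] h; first by apply: outside_true; rewrite ?big_nil.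
have hi : outside (e i) (Q i) by apply: h; rewrite mem_head.
have := outside_and hi (IH (fun j js => h j (mem_behead (s := i :: s) js))).
apply: outside_weaken; first by rewrite big_cons.
by move=> w [Qi Qs] j; rewrite inE => /orP[/eqP ->//|/Qs].
Qed.

Lemma outside_all (I : finType) (e : I -> R) (Q : I -> T -> Prop) :
  (forall i, outside (e i) (Q i)) ->
  outside (\sum_i e i) (fun w => forall i, Q i w).
Proof.
move=> h; have := outside_seq (s := index_enum I) (fun i _ => h i).
by apply: outside_weaken => // w Qw i; apply: Qw; rewrite mem_index_enum.
Qed.

Lemma outside_markov (f : T -> R) (t : R) :
  bounded_meas f -> (forall w, 0 <= f w) -> 0 < t ->
  outside (rexp P f / t) (fun w => f w <= t).
Proof.
move=> bf f0 t0; exists (~` [set w | t < f w]); split.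
- exact/measurableC/measurable_gt_fun/bf.1.
- by rewrite setCK; exact: markov_rexp.
- by move=> w /= /negP; rewrite -leNgt.
Qed.

Lemma outside_chernoff (f : T -> R) (t : R) : bounded_meas f ->
  outside (rexp P (fun w => expR (f w)) * expR (- t)) (fun w => f w <= t).
Proof.
move=> bf; rewrite expRN.
have := outside_markov (bmeas_exp bf) (fun w => expR_ge0 _) (expR_gt0 t).
by apply: outside_weaken => // w; rewrite ler_expR.
Qed.

End Outside.

(** * Exponential moments of sums of independent entries *)

Section ExpBounds.
Variable R : realType.
Implicit Types (x y : R).

Lemma expR_quad x : 4 * `|x| <= 1 -> expR x <= 1 + x + x ^+ 2.
Proof.
rewrite -(ler_pM2l (ltr0n R 4)) => x4.
have {x4} : `|x| <= 4^-1 by lra.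
rewrite ler_norml => /andP[x1 x2].
have h : 0 < 1 - x / 2 by lra.
have e1 : expR (x / 2) <= (1 - x / 2)^-1.
  rewrite -[x / 2]opprK expRN opprK lef_pV2 ?posrE ?expR_gt0//.
  by have := expR_ge1Dx (- (x / 2)).
have -> : expR x = expR (x / 2) ^+ 2.
  by rewrite -expRM_natl; congr expR; lra.
apply: le_trans (_ : (1 - x / 2)^-1 ^+ 2 <= _).
  by rewrite lerXn2r// nnegrE ?expR_ge0// invr_ge0 ltW.
rewrite exprVn -[leLHS]mul1r ler_pdivrMr ?exprn_gt0//.
have -> : (1 + x + x ^+ 2) * (1 - x / 2) ^+ 2 = 1 + x ^+ 2 * (1 - 3 * x + x ^+ 2) / 4.
  by field.
by rewrite lerDl divr_ge0// mulr_ge0// ?sqr_ge0//; have := sqr_ge0 x; lra.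
Qed.

Lemma expR_sub1_le x : expR x - 1 <= x * expR x.
Proof.
have := expR_ge1Dx (- x); rewrite expRN -(ler_pM2r (expR_gt0 x)).
by rewrite mulVf ?gt_eqF ?expR_gt0// mulrDl mulNr mul1r; lra.
Qed.

Lemma sqr_expR_le_cosh x : 0 <= x ->
  x ^+ 2 * expR x <= 8 * ((expR (2 * x) + expR (- (2 * x))) / 2 - 1).
Proof.
move=> x0; set a := expR (x / 2); set b := expR (- (3 * x / 2)).
have a1 : 1 + x / 2 <= a by exact: expR_ge1Dx.
have b1 : b <= 1 by rewrite -(expR0 R) ler_expR; lra.
have b0 : 0 <= b by exact: expR_ge0.
have -> : expR x = a ^+ 2 by rewrite -expRM_natl; congr expR; lra.
have -> : expR (2 * x) = (a ^+ 2) ^+ 2.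
  by rewrite -exprM -expRM_natl; congr expR; lra.
have -> : expR (- (2 * x)) = (a * b) ^+ 2.
  by rewrite /a /b -expRD -expRM_natl; congr expR; lra.
have ab : a ^+ 2 * (a * b) = 1.
  by rewrite mulrA -exprSr /a /b -expRM_natl -expRD -(expR0 R); congr expR; lra.
have h : x / 2 <= a - b by lra.
have : (x / 2) ^+ 2 <= (a - b) ^+ 2.
  rewrite lerXn2r// nnegrE; lra.
rewrite -(@ler_pM2l _ (4 * a ^+ 2)); last by rewrite mulr_gt0// exprn_gt0 ?expR_gt0.
have -> : 4 * a ^+ 2 * (x / 2) ^+ 2 = x ^+ 2 * a ^+ 2 by field.
move=> /le_trans; apply.
have -> : 8 * (((a ^+ 2) ^+ 2 + (a * b) ^+ 2) / 2 - 1) =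
   4 * ((a ^+ 2) ^+ 2 + (a * b) ^+ 2 - 2 * (a ^+ 2 * (a * b))).
  by rewrite ab; field.
by rewrite le_eqVlt; apply/orP; left; apply/eqP; ring.
Qed.

(** A quadratic capped by a linear function has an exponential that the
    hyperbolic cosine controls, with a constant proportional to the curvature. *)
Lemma expR_min_le_cosh (A B y : R) : 0 < A -> 0 < B ->
  expR (Num.min (A * y ^+ 2) (B * `|y|)) <=
  1 + 8 * A / B ^+ 2 * ((expR (2 * B * y) + expR (- (2 * B * y))) / 2 - 1).
Proof.
move=> A0 B0; set m := Num.min _ _.
have m0 : 0 <= m by rewrite le_min; apply/andP; split; apply: mulr_ge0; rewrite ?sqr_ge0// ltW.
have mA : m <= A * y ^+ 2 by rewrite ge_min lexx.
have mB : m <= B * `|y| by rewrite ge_min lexx orbT.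
have h1 := expR_sub1_le m.
have h2 : m * expR m <= A * y ^+ 2 * expR (B * `|y|).
  by rewrite ler_pM// ?expR_ge0// ler_expR.
have h3 := @sqr_expR_le_cosh (B * `|y|) (mulr_ge0 (ltW B0) (normr_ge0 y)).
have h4 : expR (2 * (B * `|y|)) + expR (- (2 * (B * `|y|))) =
          expR (2 * B * y) + expR (- (2 * B * y)).
  by case: ger0P => _; rewrite ?mulrN ?opprK ?mulrA// addrC.
rewrite h4 exprMn real_normK ?num_real// in h3.
rewrite -lerBlDl (le_trans h1)// (le_trans h2)//.
have -> : A * y ^+ 2 * expR (B * `|y|) =
   A / B ^+ 2 * (B ^+ 2 * y ^+ 2 * expR (B * `|y|)).
  by field; rewrite gt_eqF.
have -> : 8 * A / B ^+ 2 = A / B ^+ 2 * 8 by ring.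
by rewrite -[leRHS]mulrA ler_wpM2l// divr_ge0 ?sqr_ge0// ltW.
Qed.

End ExpBounds.
Section IndependentEntries.
Variables (R : realType) (disp : measure_display) (T : measurableType disp).
Variables (P : probability T R).
Variables (disp0 : measure_display) (T0 : measurableType disp0).
Variables (P0 : probability T0 R) (Y : {RV P0 >-> R}).
Variables (g : R -> R) (tau v : R).
Hypothesis bg : bounded_meas g.
Hypothesis g_tau : forall x, `|g x| <= tau.
Hypothesis g_mean : rexp P0 (fun w => g (Y w)) = 0.
Hypothesis g_var : rexp P0 (fun w => g (Y w) ^+ 2) <= v.

Let bgY : bounded_meas (fun w => g (Y w)).
Proof. by case: bg => mg hg; exact: bmeas_comp. Qed.

Lemma tau_ge0 : 0 <= tau. Proof. exact: le_trans (normr_ge0 _) (g_tau 0). Qed.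

Lemma mgf_ge1 c : 1 <= rexp P0 (fun w => expR (c * g (Y w))).
Proof.
rewrite -[X in X <= _](addr0 1) -(mulr0 c) -g_mean -rexpZ// -[X in X + _](rexp_cst P0).
rewrite -rexpD; [|exact: bmeas_cst|exact: bmeasZ].
apply: rexp_le; last by move=> w; exact: expR_ge1Dx.
  by apply: bmeasD; [exact: bmeas_cst|exact: bmeasZ].
by apply: bmeas_exp; exact: bmeasZ.
Qed.

Lemma mgf_le c : 4 * (`|c| * tau) <= 1 ->
  rexp P0 (fun w => expR (c * g (Y w))) <= expR (v * c ^+ 2).
Proof.
move=> c1; apply: le_trans (_ : 1 + c ^+ 2 * v <= _); last first.
  by rewrite mulrC; exact: expR_ge1Dx.
apply: (@le_trans _ _
   (rexp P0 (fun w => (1 + c * g (Y w)) + c ^+ 2 * g (Y w) ^+ 2))).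
  apply: rexp_le.
  - by apply: bmeas_exp; exact: bmeasZ.
  - apply: bmeasD; last by apply: bmeasZ; exact: bmeasX.
    by apply: bmeasD; [exact: bmeas_cst|exact: bmeasZ].
  - move=> w; rewrite -exprMn; apply: expR_quad.
    by rewrite (le_trans _ c1)// ler_pM2l// normrM ler_wpM2l.
rewrite rexpD; [|by apply: bmeasD; [exact: bmeas_cst|exact: bmeasZ]
                |by apply: bmeasZ; exact: bmeasX].
rewrite rexpD; [|exact: bmeas_cst|exact: bmeasZ].
rewrite rexp_cst rexpZ// g_mean mulr0 addr0 lerD2l rexpZ; last exact: bmeasX.
by rewrite ler_wpM2l// sqr_ge0.
Qed.

Section LinearForms.
Variables (I : finType) (X : I -> {RV P >-> R}).
Hypothesis XY : independent_copies X Y.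

Lemma mgf_linear (c : I -> R) :
  rexp P (fun w => expR (\sum_i c i * g (X i w))) =
  \prod_i rexp P0 (fun w => expR (c i * g (Y w))).
Proof.
rewrite -(rexp_prod XY (f := fun i x => expR (c i * g x))).
- by congr rexp; apply/funext => w; rewrite expR_sum.
- by move=> i; apply: bmeas_exp; exact: bmeasZ.
- by move=> i x; exact: expR_ge0.
Qed.

Lemma mgf_linear_le (c : I -> R) : (forall i, 4 * (`|c i| * tau) <= 1) ->
  rexp P (fun w => expR (\sum_i c i * g (X i w))) <= expR (v * \sum_i c i ^+ 2).
Proof.
move=> c1; rewrite mgf_linear mulr_sumr expR_sum; apply: ler_prod => i _.
by rewrite mgf_le// andbT rexp_ge0// => w; exact: expR_ge0.
Qed.

End LinearForms.

Section Tensors.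
Variables (p d : nat) (X : {ffun 'I_p -> 'I_d} -> {RV P >-> R}).
Hypothesis XY : independent_copies X Y.

Definition noise_tensor w : tensor R p d := fun i => g (X i w).

Lemma bmeas_noise i : bounded_meas (fun w => noise_tensor w i).
Proof. by case: bg => mg hg; exact: bmeas_comp. Qed.

Lemma bmeas_mform a : bounded_meas (fun w => mform (noise_tensor w) a).
Proof.
apply: bmeas_sum => i; apply: bmeasM; first exact: bmeas_noise.
exact: bmeas_cst.
Qed.

Lemma bmeas_mcontract a k j : bounded_meas (fun w => mcontract (noise_tensor w) a k j).
Proof.
apply: bmeas_sum => i; apply: bmeasM; first exact: bmeas_noise.
exact: bmeas_cst.
Qed.

Lemma sum_prod_sqr (a : 'I_p -> 'I_d -> R) :
  \sum_(i : {ffun 'I_p -> 'I_d}) (\prod_l a l (i l)) ^+ 2 = \prod_l sqn (a l).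
Proof.
rewrite /sqn bigA_distr_bigA; apply: eq_bigr => i _.
by rewrite -prodrXl.
Qed.

Lemma sum_fiber_prod_sqr (a : 'I_p -> 'I_d -> R) k j :
  \sum_(i : {ffun 'I_p -> 'I_d} | i k == j) (\prod_(l | l != k) a l (i l)) ^+ 2 =
  \prod_(l | l != k) sqn (a l).
Proof.
pose e := basisf R j.
have e1 : sqn e = 1 by exact: sqn_basisf.
have uk : upd a k e k = e by rewrite /upd eqxx.
have ul l : l != k -> upd a k e l = a l by rewrite /upd => /negbTE ->.
transitivity (\prod_(l | l != k) sqn (upd a k e l)); last first.
  by apply: eq_bigr => l lk; rewrite ul.
transitivity (\prod_l sqn (upd a k e l)); last first.
  by rewrite (bigD1 k)//= uk e1 mul1r.
rewrite -sum_prod_sqr big_mkcond/=; apply: eq_bigr => i _.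
rewrite [in RHS](bigD1 k)//= uk /e /basisf; case: eqP => _; last by rewrite mul0r expr0n.
by rewrite mul1r; congr (_ ^+ 2); apply: eq_bigr => l lk; rewrite ul.
Qed.

(** Bernstein's bound: the moment is Gaussian as long as the parameter times the
    largest product of coordinates is small compared with 1 / tau. *)
Lemma mgf_mform_le (a : 'I_p -> 'I_d -> R) (mu th : R) : 0 <= v ->
  (forall l, sqn (a l) <= 1) -> (forall i : {ffun 'I_p -> 'I_d}, `|\prod_l a l (i l)| <= th) ->
  0 <= mu -> 4 * (mu * th * tau) <= 1 ->
  rexp P (fun w => expR (mu * mform (noise_tensor w) a)) <= expR (v * mu ^+ 2).
Proof.
move=> v0 a1 ath mu0 mu1.
have -> : (fun w => expR (mu * mform (noise_tensor w) a)) =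
    fun w => expR (\sum_(i : {ffun 'I_p -> 'I_d}) (mu * \prod_l a l (i l)) * g (X i w)).
  apply/funext => w; rewrite /mform mulr_sumr; congr expR; apply: eq_bigr => i _.
  by rewrite mulrCA mulrC.
apply: le_trans (mgf_linear_le XY _) _.
  move=> i; rewrite (le_trans _ mu1)// ler_pM2l// ler_wpM2r ?tau_ge0//.
  by rewrite normrM ger0_norm// ler_wpM2l.
rewrite ler_expR ler_wpM2l//.
under eq_bigr do rewrite exprMn.
rewrite -mulr_sumr sum_prod_sqr -[leRHS]mulr1 ler_wpM2l ?sqr_ge0//.
by apply: prodr_ile1 => l _; rewrite sqn_ge0 a1.
Qed.

(* Weights and exponents of the expansion of 1 + r (cosh y - 1) into 1, exp y
   and exp (- y). *)
Let wt (r : R) (s : 'I_3) : R := if nat_of_ord s == 0%N then 1 - r else r / 2.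
Let sg (s : 'I_3) : R := if nat_of_ord s == 0%N then 0 else if nat_of_ord s == 1%N then 1 else -1.

Let sum_wt r (h : 'I_3 -> R) : \sum_s wt r s * h s =
  (1 - r) * h (inord 0) + (r / 2) * h (inord 1) + (r / 2) * h (inord 2).
Proof.
rewrite !big_ord_recl big_ord0 /wt /= addr0 addrA.
by congr (_ + _ + _); congr (_ * h _); apply/val_inj; rewrite /= inordK.
Qed.

Let sg0 : sg (inord 0) = 0. Proof. by rewrite /sg inordK. Qed.
Let sg1 : sg (inord 1) = 1. Proof. by rewrite /sg inordK. Qed.
Let sg2 : sg (inord 2) = -1. Proof. by rewrite /sg inordK. Qed.

(** The coordinates of a partial contraction depend on disjoint families of
    entries; expanding the product of hyperbolic cosines into exponentials of
    linear forms lets their independence be read off entry by entry. *)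
Lemma mgf_contraction_le (a : 'I_p -> 'I_d -> R) k (A B th : R) : v <= 1 -> 0 <= v ->
  (forall l, l != k -> sqn (a l) <= 1) ->
  (forall i : {ffun 'I_p -> 'I_d}, `|\prod_(l | l != k) a l (i l)| <= th) ->
  0 < A -> 0 < B <= 1 -> 8 * (B * th * tau) <= 1 ->
  rexp P (fun w => expR (\sum_j Num.min (A * mcontract (noise_tensor w) a k j ^+ 2)
                                       (B * `|mcontract (noise_tensor w) a k j|)))
  <= expR (32 * expR 4 * A * d%:R).
Proof.
move=> v1 v0 a1 ath A0 /andP[B0 B1] Bth.
pose r := 8 * A / B ^+ 2.
have r0 : 0 < r by rewrite divr_gt0 ?exprn_gt0// mulr_gt0.
pose Z w j := mcontract (noise_tensor w) a k j.
have bZ j : bounded_meas (fun w => Z w j) by exact: bmeas_mcontract.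
pose q (i : {ffun 'I_p -> 'I_d}) := \prod_(l < p | l != k) a l (i l).
pose M c := rexp P0 (fun w => expR (c * g (Y w))).
pose m j s := \prod_(i : {ffun 'I_p -> 'I_d} | i k == j) M (sg s * (2 * B) * q i).
apply: (@le_trans _ _ (rexp P (fun w =>
    \prod_j \sum_s wt r s * expR (sg s * (2 * B) * Z w j)))).
  apply: rexp_le.
  - apply/bmeas_exp/bmeas_sum => j; apply: bmeas_min.
      by apply: bmeasZ; apply: bmeasX; exact: bZ.
    by apply: bmeasZ; apply: bmeas_norm; exact: bZ.
  - apply: bmeas_prod => j; apply: bmeas_sum => s; apply: bmeasZ.
    by apply: bmeas_exp; exact: bmeasZ.
  - move=> w; rewrite expR_sum; apply: ler_prod => j _; rewrite expR_ge0/=.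
    rewrite sum_wt sg0 sg1 sg2 !mul0r expR0 mul1r mulN1r !mulNr.
    apply: le_trans (expR_min_le_cosh _ A0 B0) _.
    by rewrite -/r -/(Z w j) le_eqVlt; apply/orP; left; apply/eqP; field.
have -> : (fun w => \prod_j \sum_s wt r s * expR (sg s * (2 * B) * Z w j)) =
    (fun w => \sum_(f : {ffun 'I_d -> 'I_3}) (\prod_j wt r (f j)) *
      expR (\sum_(i : {ffun 'I_p -> 'I_d}) (sg (f (i k)) * (2 * B) * q i) * g (X i w))).
  apply/funext => w; rewrite bigA_distr_bigA; apply: eq_bigr => f _.
  rewrite big_split -expR_sum; congr (_ * expR _).
  rewrite [RHS](partition_big (fun i : {ffun 'I_p -> 'I_d} => i k) predT)//=.
  apply: eq_bigr => j _; rewrite /Z /mcontract mulr_sumr.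
  by apply: eq_bigr => i /eqP ->; rewrite -/(q i) [in RHS]mulrC mulrCA.
rewrite rexp_sum; last first.
  move=> f; apply/bmeasZ/bmeas_exp/bmeas_sum => i; apply: bmeasZ.
  exact: bmeas_noise.
have -> : \sum_(f : {ffun 'I_d -> 'I_3}) rexp P (fun w => (\prod_j wt r (f j)) *
      expR (\sum_(i : {ffun 'I_p -> 'I_d}) (sg (f (i k)) * (2 * B) * q i) * g (X i w))) =
   \prod_j \sum_s wt r s * m j s.
  rewrite bigA_distr_bigA; apply: eq_bigr => f _.
  rewrite rexpZ; last first.
    by apply/bmeas_exp/bmeas_sum => i; apply: bmeasZ; exact: bmeas_noise.
  rewrite big_split (mgf_linear XY); congr (_ * _).
  rewrite [LHS](partition_big (fun i : {ffun 'I_p -> 'I_d} => i k) predT)//.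
  by apply: eq_bigr => j _; apply: eq_bigr => i /eqP ->.
have mge j s : 1 <= m j s.
  rewrite /m; elim/big_rec: _ => // i x _ x1.
  by rewrite -[leLHS]mulr1 ler_pM// mgf_ge1.
have m0 j : m j (inord 0) = 1.
  rewrite /m big1// => i _; have -> : sg (inord 0) * (2 * B) * q i = 0.
    by rewrite sg0 !mul0r.
  by rewrite -[RHS](rexp_cst P0); congr rexp; apply/funext => w; rewrite mul0r expR0.
have mle j s : m j s <= expR (4 * B ^+ 2).
  have sgs : `|sg s| <= 1.
    by rewrite /sg; case: ifP => _; [|case: ifP => _]; rewrite ?normrN ?normr1 ?normr0.
  have sg1' : sg s ^+ 2 <= 1.
    by rewrite -real_normK ?num_real// expr_le1.
  apply: (@le_trans _ _ (\prod_(i : {ffun 'I_p -> 'I_d} | i k == j)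
                            expR (4 * B ^+ 2 * q i ^+ 2))).
    apply: ler_prod => i _; apply/andP; split.
      by rewrite (le_trans ler01)// mgf_ge1.
    apply: le_trans (mgf_le _) _.
    - have h1 : `|sg s * (2 * B) * q i| <= 2 * B * th.
        have BB : 0 <= 2 * B by rewrite mulr_ge0// ltW.
        rewrite normrM (normrM (sg s)) (ger0_norm BB).
        apply: ler_pM; [by rewrite mulr_ge0|by []| |exact: ath].
        by rewrite -[leRHS]mul1r ler_wpM2r.
      have := ler_wpM2r tau_ge0 h1; lra.
    rewrite ler_expR.
    have -> : (sg s * (2 * B) * q i) ^+ 2 = sg s ^+ 2 * (4 * B ^+ 2 * q i ^+ 2).
      by ring.
    have q0 : 0 <= 4 * B ^+ 2 * q i ^+ 2.
      by apply: mulr_ge0; [apply: mulr_ge0|]; rewrite ?sqr_ge0.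
    rewrite -[leRHS]mul1r; apply: ler_pM => //.
      by rewrite mulr_ge0 ?sqr_ge0.
    by rewrite -[leRHS]mul1r ler_wpM2r.
  rewrite -expR_sum ler_expR -mulr_sumr sum_fiber_prod_sqr -[leRHS]mulr1.
  apply: ler_wpM2l; first by rewrite mulr_ge0// sqr_ge0.
  by apply: prodr_ile1 => l lk; rewrite sqn_ge0 a1.
have B2 : expR (4 * B ^+ 2) - 1 <= 4 * B ^+ 2 * expR 4.
  apply: le_trans (expR_sub1_le _) _; apply: ler_wpM2l.
    by rewrite mulr_ge0// sqr_ge0.
  by rewrite ler_expR -[leRHS]mulr1 ler_wpM2l// expr_le1// ltW.
have fac j : 0 <= \sum_s wt r s * m j s <= expR (32 * expR 4 * A).
  rewrite sum_wt m0; have h1 := mge j (inord 1); have h2 := mge j (inord 2).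
  have h3 := mle j (inord 1); have h4 := mle j (inord 2).
  set m1 := m j (inord 1) in h1 h3 *; set m2 := m j (inord 2) in h2 h4 *.
  have -> : (1 - r) * 1 + r / 2 * m1 + r / 2 * m2 = 1 + r * ((m1 + m2) / 2 - 1).
    by field.
  apply/andP; split; first by rewrite addr_ge0// mulr_ge0 ?(ltW r0)//; lra.
  apply: le_trans (expR_ge1Dx _); rewrite lerD2l.
  have -> : 32 * expR 4 * A = r * (4 * B ^+ 2 * expR 4).
    by rewrite /r; field; rewrite gt_eqF.
  by rewrite ler_pM2l//; lra.
apply: (@le_trans _ _ (\prod_(j < d) expR (32 * expR 4 * A))).
  by apply: ler_prod => j _; exact: fac.
by rewrite prodr_const card_ord -expRM_natr.
Qed.

End Tensors.
End IndependentEntries.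
(** * One free mode *)

(** The supremum of a linear form over flat vectors is bounded by a capped
    quadratic function of its coefficients: each coordinate uses either Young's
    inequality or the bound on its size. *)
Lemma dotf_flat_le (R : realType) (d : nat) (b Z : 'I_d -> R) (mu beta th : R) :
  0 <= mu -> 0 < beta -> sqn b <= 1 -> (forall j, `|b j| <= th) ->
  mu * dotf b Z <=
  mu * beta + \sum_j Num.min (mu / (4 * beta) * Z j ^+ 2) (mu * th * `|Z j|).
Proof.
move=> mu0 beta0 b1 bth.
apply: (@le_trans _ _ (mu * beta * sqn b +
    \sum_j Num.min (mu / (4 * beta) * Z j ^+ 2) (mu * th * `|Z j|))); last first.
  by rewrite lerD2r -[leRHS]mulr1 ler_wpM2l// mulr_ge0// ltW.
rewrite /dotf /sqn !mulr_sumr -big_split; apply: ler_sum => j _ /=.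
rewrite -lerBlDl le_min; apply/andP; split.
  rewrite -subr_ge0.
  have -> : mu / (4 * beta) * Z j ^+ 2 - (mu * (b j * Z j) - mu * beta * b j ^+ 2) =
    mu / (4 * beta) * (Z j - 2 * beta * b j) ^+ 2 by field; rewrite gt_eqF.
  by rewrite mulr_ge0 ?sqr_ge0// divr_ge0// mulr_ge0// ltW.
apply: (@le_trans _ _ (mu * (b j * Z j))).
  by rewrite lerBlDr lerDl mulr_ge0 ?sqr_ge0// mulr_ge0// ltW.
rewrite -mulrA ler_wpM2l// (le_trans (ler_norm _))// normrM ler_wpM2r//.
Qed.

(** The price of the Chernoff bound for one free mode: the exponential moment
    contributes 8 * expR 4, the failure probability and Young's inequality one
    each. *)
Definition flat_const (R : realType) : R := 8 * expR 4 + 2.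

Section FlatMode.
Variables (R : realType) (disp : measure_display) (T : measurableType disp).
Variables (P : probability T R).
Variables (disp0 : measure_display) (T0 : measurableType disp0).
Variables (P0 : probability T0 R) (Y : {RV P0 >-> R}).
Variables (g : R -> R) (tau v : R).
Hypothesis bg : bounded_meas g.
Hypothesis g_tau : forall x, `|g x| <= tau.
Hypothesis g_mean : rexp P0 (fun w => g (Y w)) = 0.
Hypothesis g_var : rexp P0 (fun w => g (Y w) ^+ 2) <= v.
Variables (p d : nat) (X : {ffun 'I_p -> 'I_d} -> {RV P >-> R}).
Hypothesis XY : independent_copies X Y.

(** The capped quadratic bound replaces the supremum over the free mode by a
    single random variable, so that this mode needs no union bound. *)
Lemma outside_flat (a : 'I_p -> 'I_d -> R) k (mu th vt beta : R) :
  0 <= v -> v <= 1 ->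
  (forall l, l != k -> sqn (a l) <= 1) ->
  (forall i : {ffun 'I_p -> 'I_d}, `|\prod_(l | l != k) a l (i l)| <= vt) ->
  0 < mu -> 0 < th -> 0 < beta -> d%:R <= beta ^+ 2 ->
  mu * th <= 1 -> 8 * (mu * th * vt * tau) <= 1 ->
  outside P (expR (- (mu * beta))) (fun w => forall b : 'I_d -> R, sqn b <= 1 ->
    (forall j, `|b j| <= th) ->
    `|mform (noise_tensor g X w) (upd a k b)| <= flat_const R * beta).
Proof.
move=> v0 v1 a1 avt mu0 th0 beta0 dbeta B1 Bvt.
pose f w := \sum_j Num.min
  (mu / (4 * beta) * mcontract (noise_tensor g X w) a k j ^+ 2)
  (mu * th * `|mcontract (noise_tensor g X w) a k j|).
have bf : bounded_meas f.
  apply: bmeas_sum => j; apply: bmeas_min; apply: bmeasZ.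
    by apply: bmeasX; exact: bmeas_mcontract.
  by apply: bmeas_norm; exact: bmeas_mcontract.
pose t := (8 * expR 4 + 1) * (mu * beta).
have := outside_chernoff P t bf; apply: outside_weaken.
  have A0 : 0 < mu / (4 * beta) by rewrite divr_gt0// mulr_gt0.
  have B0 : 0 < mu * th <= 1 by rewrite mulr_gt0.
  have := mgf_contraction_le bg g_tau g_mean g_var XY v1 v0 a1 avt A0 B0 Bvt.
  rewrite -/(f) => h; apply: le_trans (ler_wpM2r (expR_ge0 _) h) _.
  rewrite -expRD ler_expR /t.
  have : 32 * expR 4 * (mu / (4 * beta)) * d%:R <= 8 * expR 4 * (mu * beta).
    have -> : 8 * expR 4 * (mu * beta) = 32 * expR 4 * (mu / (4 * beta)) * beta ^+ 2.
      by field; rewrite gt_eqF.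
    by rewrite ler_wpM2l// ltW// mulr_gt0// mulr_gt0// expR_gt0.
  by lra.
move=> w fw.
have main b : sqn b <= 1 -> (forall j, `|b j| <= th) ->
    mform (noise_tensor g X w) (upd a k b) <= flat_const R * beta.
  move=> b1 bth; rewrite mform_upd -(ler_pM2l mu0).
  apply: le_trans (dotf_flat_le _ (ltW mu0) beta0 b1 bth) _.
  by rewrite -/(f w) /flat_const; move: fw; rewrite /t; lra.
move=> b b1 bth; rewrite ler_norml main// andbT.
rewrite lerNl mform_upd -mulN1r -dotfZl -mform_upd main//.
  by rewrite sqnZ sqrrN expr1n mul1r.
by move=> j; rewrite mulN1r normrN.
Qed.

End FlatMode.
(** * Lattice nets *)

Section Nets.
Variables (R : realType) (d : nat).
Implicit Types (a y : 'I_d -> R) (th h : R).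

Definition net_index : finType := {ffun 'I_d -> 'I_(d.*2.+1)}.

(** The lattice of mesh h / 2: rounding to multiples of h may bring a unit
    vector to norm 2, and halving brings the rounded vectors back into the unit ball. *)
Definition lattice h (z : net_index) : 'I_d -> R :=
  fun j => h / 2 * ((z j)%:R - d%:R).

Definition in_net th h : pred net_index :=
  fun z => (sqn (lattice h z) <= 1) && [forall j, `|lattice h z j| <= th].

(** In both cases moving the nonzero entries of a vector of the unit ball by at
    most h leaves its norm at most 2: either no entry more than doubles, or the
    displacement has norm at most 1. *)
Definition roundable th h a : Prop :=
  (forall j, `|a j| <= th) /\
  ((forall j, a j = 0 \/ h <= `|a j|) \/ h ^+ 2 * d%:R <= 1).

(** Rounding up or down according to the sign of the coefficient y never
    decreases the linear form. *)
Lemma round_entry h (x y : R) : 0 < h ->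
  exists m : int, [/\ x * y <= h * m%:~R * y, `|h * m%:~R - x| <= h &
                      x = 0 -> m = 0].
Proof.
move=> h0; have e : x = h * (x / h) by field; rewrite gt_eqF.
have [y0|/ltW y0] := leP 0 y.
  exists (Num.ceil (x / h)); split.
  - rewrite ler_wpM2r// {1}e ler_pM2l//; exact: ceil_ge.
  - have h1 : x / h <= (Num.ceil (x / h))%:~R :> R by exact: ceil_ge.
    have h2 : (Num.ceil (x / h))%:~R <= x / h + 1 :> R.
      by have := ceilB1_lt (x / h); rewrite intrB => /ltW; rewrite lerBlDr.
    rewrite ler_norml; apply/andP; split.
      by rewrite lerBrDr; apply: le_trans (_ : x <= _); [lra|rewrite {1}e ler_pM2l].
    have := ler_wpM2l (ltW h0) h2; rewrite mulrDr -e mulr1; lra.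
  - by move=> ->; rewrite mul0r ceil0.
exists (Num.floor (x / h)); split.
- rewrite ler_wnM2r// {2}e ler_pM2l//; exact: floor_le.
- have h1 : (Num.floor (x / h))%:~R <= x / h :> R by exact: floor_le.
  have h2 : x / h <= (Num.floor (x / h))%:~R + 1 :> R.
    by apply/ltW; have := floorD1_gt (x / h); rewrite intrD.
  have := ler_wpM2l (ltW h0) h2; rewrite mulrDr -e mulr1 => h3.
  have := ler_wpM2l (ltW h0) h1; rewrite -e => h4.
  by rewrite ler_norml; apply/andP; split; lra.
- by move=> ->; rewrite mul0r floor0.
Qed.

Lemma roundP th h a y : 0 < h -> h <= th -> 2 <= d%:R * h ->
  sqn a <= 1 -> roundable th h a ->
  exists2 z, in_net th h z & dotf a y <= 2 * dotf (lattice h z) y.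
Proof.
move=> h0 hth dh a1 [ath ah].
have /choice[m Hm] : forall j, exists m : int,
  [/\ a j * y j <= h * m%:~R * y j, `|h * m%:~R - a j| <= h & a j = 0 -> m = 0].
  by move=> j; exact: round_entry.
have sqb : \sum_j (h * (m j)%:~R) ^+ 2 <= 4.
  have [A|B] := ah.
    apply: (@le_trans _ _ (4 * sqn a)); last by rewrite -[leRHS]mulr1 ler_pM2l.
    rewrite /sqn mulr_sumr; apply: ler_sum => j _.
    have [_ hm m0] := Hm j; have [aj0|aj] := A j.
      by rewrite m0// aj0 mulr0 expr0n mulr0.
    have -> : 4 * a j ^+ 2 = (2 * `|a j|) ^+ 2.
      by rewrite exprMn real_normK ?num_real//; ring.
    rewrite -[leLHS]real_normK ?num_real// lerXn2r ?nnegrE ?mulr_ge0//.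
    rewrite -[X in `|X|](subrK (a j)) (le_trans (ler_normD _ _))//; lra.
  apply: (@le_trans _ _ (\sum_j (2 * a j ^+ 2 + 2 * h ^+ 2))).
    apply: ler_sum => j _; have [_ hm _] := Hm j.
    have h2 : (h * (m j)%:~R - a j) ^+ 2 <= h ^+ 2.
      by rewrite -[leLHS]real_normK ?num_real// lerXn2r// nnegrE ltW.
    have := sqr_ge0 (h * (m j)%:~R - 2 * a j); nra.
  have -> : \sum_j (2 * a j ^+ 2 + 2 * h ^+ 2) = 2 * sqn a + 2 * (h ^+ 2 * d%:R).
    by rewrite big_split -mulr_sumr sumr_const card_ord mulrA mulr_natr.
  lra.
have bj j : `|h * (m j)%:~R| <= 2.
  rewrite -ler_sqr ?nnegrE// real_normK ?num_real//.
  apply: le_trans (_ : 4 <= _); last by rewrite expr2; lra.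
  apply: le_trans sqb; rewrite (bigD1 j)//= lerDl sumr_ge0// => i _.
  exact: sqr_ge0.
have mj j : `|(m j)%:~R| <= d%:R :> R.
  rewrite -(ler_pM2l h0) [leRHS]mulrC (le_trans _ dh)//.
  by have := bj j; rewrite normrM (gtr0_norm h0).
pose s j : int := m j + d%:Z.
have mz j : 0 <= s j.
  have := mj j; rewrite ler_norml => /andP[+ _].
  by rewrite -subr_ge0 opprK -(ler0z R) /s intrD.
have zlt j : (absz (s j) < d.*2.+1)%N.
  rewrite ltnS -(ler_nat R) natr_absz ger0_norm// /s intrD -addnn natrD lerD2r.
  by have := mj j; rewrite ler_norml => /andP[].
pose z : net_index := [ffun j => Ordinal (zlt j)].
have zE j : lattice h z j = (h * (m j)%:~R) / 2.
  rewrite /lattice ffunE /= natr_absz ger0_norm// /s intrD addrK.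
  by field.
exists z.
  apply/andP; split.
    rewrite /sqn; under eq_bigr do rewrite zE exprMn.
    by rewrite -mulr_suml exprVn ler_pdivrMr ?exprn_gt0// mul1r expr2; lra.
  apply/forallP => j; rewrite zE normrM [X in _ * X]ger0_norm ?invr_ge0//.
  rewrite ler_pdivrMr//; have [_ hm _] := Hm j.
  rewrite -[X in `|X|](subrK (a j)) (le_trans (ler_normD _ _))//.
  by have := ath j; lra.
rewrite /dotf mulr_sumr; apply: ler_sum => j _; rewrite zE.
have [hm _ _] := Hm j; apply: le_trans hm _.
by rewrite le_eqVlt; apply/orP; left; apply/eqP; field.
Qed.

Lemma sum_dist_expr_le (x : R) n : 0 <= x <= 2^-1 ->
  \sum_(i < n.*2.+1) x ^+ ((i - n) + (n - i)) <= 1 + 4 * x.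
Proof.
move=> /andP[x0 x2].
(* The correction makes the induction go through: each step adds a term at both
   ends. *)
suff : \sum_(i < n.*2.+1) x ^+ ((i - n) + (n - i)) <= 1 + 4 * x - 4 * x ^+ n.+1.
  by move=> /le_trans; apply; rewrite lerBlDr lerDl mulr_ge0// exprn_ge0.
elim: n => [|n IH].
  by rewrite big_ord_recl big_ord0 /= subnn expr0 expr1; lra.
rewrite doubleS big_ord_recl big_ord_recr/=.
rewrite sub0n add0n subn0 /bump leq0n add1n.
have -> : (n.*2.+2 - n.+1 + (n.+1 - n.*2.+2) = n.+1)%N by rewrite -addnn; lia.
apply: le_trans (_ : x ^+ n.+1 + (1 + 4 * x - 4 * x ^+ n.+1 + x ^+ n.+1) <= _).
  by rewrite lerD2l lerD2r.
rewrite [x ^+ n.+2]exprS; have := exprn_ge0 n.+1 x0; nra.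
Qed.

(** The number of lattice points in a ball, by Markov's inequality for the
    product of d discrete Gaussian weights of inverse temperature kappa: kappa = 1
    is the right choice for the finest mesh, kappa = ln d for the coarser ones. *)
Lemma card_net th h kappa : 0 < h -> 0 <= kappa -> expR (- kappa) <= 2^-1 ->
  #|in_net th h|%:R <= expR (4 * kappa / h ^+ 2 + 4 * d%:R * expR (- kappa)) :> R.
Proof.
move=> h0 k0 k2; set x := expR (- kappa).
have h2 : 0 < h ^+ 2 by rewrite exprn_gt0.
pose q (z : net_index) : R := \sum_j ((z j)%:R - d%:R) ^+ 2.
have qE z : sqn (lattice h z) = h ^+ 2 / 4 * q z.
  rewrite /sqn /q mulr_sumr; apply: eq_bigr => j _; rewrite /lattice.
  by field.
apply: (@le_trans _ _ (\sum_(z : net_index) expR (kappa * (4 / h ^+ 2 - q z)))).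
  rewrite -sum1_card natr_sum big_mkcond/=; apply: ler_sum => z _.
  case: ifP => [/andP[z1 _]|_]; last exact: expR_ge0.
  rewrite -[leLHS](expR0 R) ler_expR mulr_ge0// subr_ge0.
  rewrite ler_pdivlMr// mulrC; move: z1; rewrite qE; lra.
have -> : \sum_(z : net_index) expR (kappa * (4 / h ^+ 2 - q z)) =
   expR (4 * kappa / h ^+ 2) *
   \prod_(j < d) \sum_(i < d.*2.+1) expR (- kappa * (i%:R - d%:R) ^+ 2).
  rewrite bigA_distr_bigA mulr_sumr; apply: eq_bigr => z _.
  rewrite -expR_sum -expRD; congr expR; rewrite -mulr_sumr -/(q z).
  by field; rewrite gt_eqF.
rewrite expRD ler_wpM2l ?expR_ge0//.
have -> : 4 * d%:R * x = \sum_(j < d) (4 * x).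
  by rewrite sumr_const card_ord -mulr_natr; ring.
rewrite expR_sum; apply: ler_prod => j _; apply/andP; split.
  by apply: sumr_ge0 => i _; exact: expR_ge0.
apply: le_trans (expR_ge1Dx _).
apply: le_trans (sum_dist_expr_le d _); last by rewrite expR_ge0.
apply: ler_sum => i _; rewrite -expRM_natl ler_expR.
set m := (_ + _)%N.
have -> : (i%:R - d%:R) ^+ 2 = m%:R ^+ 2 :> R.
  have [id|/ltnW di] := leqP i d.
    have -> : m = (d - i)%N by rewrite /m; lia.
    by rewrite natrB//; ring.
  have -> : m = (i - d)%N by rewrite /m; lia.
  by rewrite natrB.
have : m%:R <= m%:R ^+ 2 :> R.
  by rewrite -natrX ler_nat; nia.
nra.
Qed.

End Nets.

(** Rounding one mode after the other; each step only needs linearity in that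
    mode. *)
Lemma round_modes (R : realType) (p d : nat) (X : tensor R p d)
    (th h : 'I_p -> R) (a : 'I_p -> 'I_d -> R) (s : seq 'I_p) : uniq s ->
  (forall l, l \in s -> [/\ 0 < h l, h l <= th l & 2 <= d%:R * h l]) ->
  (forall l, l \in s -> sqn (a l) <= 1 /\ roundable (th l) (h l) (a l)) ->
  exists2 z : 'I_p -> net_index d, (forall l, l \in s -> in_net (th l) (h l) (z l)) &
    mform X a <= 2 ^+ size s *
      mform X (fun l => if l \in s then lattice (h l) (z l) else a l).
Proof.
elim: s => [|l s IH] /=.
  by move=> _ _ _; exists (fun=> [ffun=> ord0]) => //; rewrite mul1r.
move=> /andP[ls us] hth ca.
have [] := IH us.
- by move=> m ms; apply: hth; rewrite inE ms orbT.
- by move=> m ms; apply: ca; rewrite inE ms orbT.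
move=> z zs az; set b := fun m => _ in az.
have [h0 hth0 dh] := hth l (mem_head _ _).
have [al1 cal] := ca l (mem_head _ _).
have bl : b l = a l by rewrite /b (negbTE ls).
have [z0 z0n az0] := roundP (mcontract X b l) h0 hth0 dh al1 cal.
exists (fun m => if m == l then z0 else z m).
  by move=> m; rewrite inE; case: eqP => [-> _|_ /=] //; exact: zs.
apply: le_trans az _; rewrite exprSr -mulrA ler_wpM2l ?exprn_ge0//.
rewrite (mform_mcontract X b l) bl (le_trans az0)// ler_wpM2l// -mform_upd.
rewrite le_eqVlt; apply/orP; left; apply/eqP; congr mform; apply/funext => m.
by rewrite /upd /b inE; case: eqP => [->|].
Qed.
(** * Uniform bounds over classes of vectors *)

Section Classes.
Variables (R : realType) (disp : measure_display) (T : measurableType disp).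
Variables (P : probability T R).
Variables (disp0 : measure_display) (T0 : measurableType disp0).
Variables (P0 : probability T0 R) (Y : {RV P0 >-> R}).
Variables (g : R -> R) (tau : R).
Hypothesis bg : bounded_meas g.
Hypothesis g_tau : forall x, `|g x| <= tau.
Hypothesis g_mean : rexp P0 (fun w => g (Y w)) = 0.
Hypothesis g_var : rexp P0 (fun w => g (Y w) ^+ 2) <= 1.
Variables (p d : nat) (X : {ffun 'I_p -> 'I_d} -> {RV P >-> R}).
Hypothesis XY : independent_copies X Y.
Variables (th h : 'I_p -> R) (L : R).
Hypothesis hth : forall l, [/\ 0 < h l, h l <= th l & 2 <= d%:R * h l].

Lemma outside_family (F : 'I_p -> pred (net_index d)) (e : R)
    (Q : {ffun 'I_p -> net_index d} -> T -> Prop) :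
  (forall l, #|F l|%:R <= expR L) -> 0 <= e ->
  (forall z, z \in family F -> outside P e (Q z)) ->
  outside P (expR (p%:R * L) * e) (fun w => forall z, z \in family F -> Q z w).
Proof.
move=> FL e0 FQ.
have := @outside_seq _ _ _ P _ (enum (family F)) (fun=> e) Q
  (fun z zF => FQ z (etrans (esym (mem_enum _ _)) zF)).
apply: outside_weaken; last by move=> w Qw z zF; apply: Qw; rewrite mem_enum.
rewrite big_const_seq count_predT -cardE iter_addr_0 -[leLHS]mulr_natl ler_wpM2r//.
rewrite card_family foldrE big_image /= natr_prod mulr_natl.
have -> : L *+ p = \sum_(l < p) L by rewrite sumr_const card_ord.
by rewrite expR_sum; apply: ler_prod => l _; rewrite ler0n FL.
Qed.

Lemma mform_opp_mode (E : tensor R p d) a k :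
  mform E (upd a k (fun j => - a k j)) = - mform E a.
Proof.
rewrite -mulN1r (mform_mcontract E a k) -dotfZl -mform_upd; congr mform.
by congr upd; apply/funext => j; rewrite mulN1r.
Qed.

Lemma roundable_opp t m (a : 'I_d -> R) : roundable t m a ->
  roundable t m (fun j => - a j).
Proof.
move=> [at_ am]; split=> [j|]; first by rewrite normrN.
case: am => [am|]; [left=> j|by right].
by rewrite normrN; have [->|] := am j; [left; rewrite oppr0|right].
Qed.

Lemma sqn_opp (a : 'I_d -> R) : sqn (fun j => - a j) = sqn a.
Proof. by apply: eq_bigr => j _; rewrite sqrrN. Qed.

(** A net in all modes but one; the supremum over the remaining mode needs no
    union bound, which is what makes the estimate work when that mode is much
    flatter than the others. *)
Lemma outside_net_flat k (mu vt beta : R) :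
  (forall l, l != k -> #|in_net (d := d) (th l) (h l)|%:R <= expR L) -> 0 <= L ->
  \prod_(l | l != k) th l <= vt ->
  0 < mu -> 0 < beta -> d%:R <= beta ^+ 2 ->
  mu * th k <= 1 -> 8 * (mu * th k * vt * tau) <= 1 ->
  outside P (expR (p%:R * L - mu * beta)) (fun w => forall a : 'I_p -> 'I_d -> R,
    (forall l, sqn (a l) <= 1) -> (forall l, roundable (th l) (h l) (a l)) ->
    `|mform (noise_tensor g X w) a| <= 2 ^+ p * (flat_const R * beta)).
Proof.
move=> cardL L0 thvt mu0 beta0 dbeta B1 Bvt.
pose z0 : net_index d := [ffun=> ord0].
(* The free mode must not contribute to the cardinality, whence a one-point
   net there. *)
pose F l : pred (net_index d) :=
  fun z => if l == k then z == z0 else in_net (th l) (h l) z.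
have FL l : #|F l|%:R <= expR L.
  have [lk|lk] := eqVneq l k.
    rewrite (@eq_card _ (F l) (pred1 z0)).
      by rewrite card1 -[leLHS](expR0 R) ler_expR.
    by move=> z; rewrite !unfold_in /F lk eqxx.
  rewrite (@eq_card _ (F l) (in_net (th l) (h l))); first exact: cardL.
  by move=> z; rewrite !unfold_in /F (negbTE lk).
pose c (z : {ffun 'I_p -> net_index d}) l := lattice (h l) (z l).
pose Q z w := forall b : 'I_d -> R, sqn b <= 1 -> (forall j, `|b j| <= th k) ->
    `|mform (noise_tensor g X w) (upd (c z) k b)| <= flat_const R * beta.
have FQ z : z \in family F -> outside P (expR (- (mu * beta))) (Q z).
  move=> /familyP zF.
  have znet l : l != k -> z l \in in_net (th l) (h l).
    by move=> lk; have := zF l; rewrite /F !unfold_in (negbTE lk).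
  have [hk0 hthk _] := hth k.
  apply: (outside_flat bg g_tau g_mean g_var XY (vt := vt)) => //.
  - by move=> l lk; have /andP[] := znet l lk.
  - move=> i; rewrite normr_prod (le_trans _ thvt)//; apply: ler_prod => l lk.
    by rewrite normr_ge0/=; have /andP[_ /forallP cth] := znet l lk; exact: cth.
  - exact: lt_le_trans hk0 hthk.
have := outside_family FL (expR_ge0 _) FQ.
apply: outside_weaken; first by rewrite -expRD.
move=> w Qw.
have main (a : 'I_p -> 'I_d -> R) : (forall l, sqn (a l) <= 1) ->
    (forall l, roundable (th l) (h l) (a l)) ->
    mform (noise_tensor g X w) a <= 2 ^+ p * (flat_const R * beta).
  move=> a1 ca; pose s := rem k (enum 'I_p).
  have us : uniq s by rewrite rem_uniq// enum_uniq.
  have sE l : (l \in s) = (l != k) by rewrite mem_rem_uniq ?enum_uniq// inE mem_enum andbT.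
  have [z zs az] := round_modes (noise_tensor g X w) us
    (fun l _ => hth l) (fun l _ => conj (a1 l) (ca l)).
  pose z' : {ffun 'I_p -> net_index d} := [ffun l => if l == k then z0 else z l].
  have z'F : z' \in family F.
    apply/familyP => l; rewrite unfold_in /z' /F ffunE; have [lk|lk] := eqVneq l k => //.
    by apply: zs; rewrite sE.
  apply: le_trans az _.
  have -> : (fun l => if l \in s then lattice (h l) (z l) else a l) = upd (c z') k (a k).
    apply/funext => l; rewrite sE /upd /c /z' ffunE; case: eqP => [->//|].
    by move=> _ /=.
  have FB0 : 0 <= flat_const R * beta.
    by rewrite mulr_ge0 ?ltW// /flat_const addr_gt0// mulr_gt0// expR_gt0.
  apply: (@le_trans _ _ (2 ^+ size s * (flat_const R * beta))).
    rewrite ler_wpM2l ?exprn_ge0// (le_trans (ler_norm _))//.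
    by apply: Qw => //; have [] := ca k.
  rewrite ler_wpM2r// ler_weXn2l ?ler1n//.
  by rewrite size_rem ?mem_enum// size_enum_ord leq_pred.
move=> a a1 ca; rewrite ler_norml main// andbT lerNl -(mform_opp_mode _ a k) main//.
  by move=> l; rewrite /upd; case: eqP => // _; rewrite sqn_opp.
by move=> l; rewrite /upd; case: eqP => [->|//]; exact: roundable_opp.
Qed.

(** Two nearly flat modes make all products of entries so small that the
    Bernstein bound beats a net in all modes. *)
Lemma outside_net_all (mu t vt : R) : (0 < p)%N ->
  (forall l, #|in_net (d := d) (th l) (h l)|%:R <= expR L) ->
  \prod_l th l <= vt -> 0 < mu -> 0 <= t -> 4 * (mu * vt * tau) <= 1 ->
  outside P (expR (p%:R * L + mu ^+ 2 - mu * t)) (fun w => forall a : 'I_p -> 'I_d -> R,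
    (forall l, sqn (a l) <= 1) -> (forall l, roundable (th l) (h l) (a l)) ->
    `|mform (noise_tensor g X w) a| <= 2 ^+ p * t).
Proof.
move=> p0 cardL thvt mu0 t0 Bvt.
pose F l := in_net (d := d) (th l) (h l).
pose c (z : {ffun 'I_p -> net_index d}) l := lattice (h l) (z l).
pose Q z w := mu * mform (noise_tensor g X w) (c z) <= mu * t.
have FQ z : z \in family F -> outside P (expR (mu ^+ 2 - mu * t)) (Q z).
  move=> /familyP zF.
  have bmu : bounded_meas (fun w => mu * mform (noise_tensor g X w) (c z)).
    by apply: bmeasZ; exact: bmeas_mform.
  have := outside_chernoff P (mu * t) bmu; apply: outside_weaken => //.
  rewrite [leRHS]expRD ler_wpM2r ?expR_ge0// -[mu ^+ 2]mul1r.
  apply: (mgf_mform_le bg g_tau g_mean g_var XY _ _ _ (ltW mu0) Bvt) => //.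
    by move=> l; have /andP[] := zF l.
  move=> i; rewrite normr_prod (le_trans _ thvt)//; apply: ler_prod => l _.
  by rewrite normr_ge0/=; have /andP[_ /forallP cth] := zF l; exact: cth.
have := outside_family cardL (expR_ge0 _) FQ.
apply: outside_weaken; first by rewrite -expRD addrA.
move=> w Qw.
have main (a : 'I_p -> 'I_d -> R) : (forall l, sqn (a l) <= 1) ->
    (forall l, roundable (th l) (h l) (a l)) ->
    mform (noise_tensor g X w) a <= 2 ^+ p * t.
  move=> a1 ca.
  have [z zs az] := round_modes (noise_tensor g X w) (enum_uniq 'I_p)
    (fun l _ => hth l) (fun l _ => conj (a1 l) (ca l)).
  pose z' : {ffun 'I_p -> net_index d} := [ffun l => z l].
  have z'F : z' \in family F.
    by apply/familyP => l; rewrite /z' /F ffunE; apply: zs; rewrite mem_enum.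
  apply: le_trans az _; rewrite size_enum_ord ler_wpM2l ?exprn_ge0//.
  have := Qw _ z'F; rewrite /Q ler_pM2l// => /(le_trans _); apply.
  rewrite le_eqVlt; apply/orP; left; apply/eqP; congr mform.
  by apply/funext => l; rewrite mem_enum /c /z' ffunE.
pose k : 'I_p := Ordinal p0.
move=> a a1 ca; rewrite ler_norml main// andbT lerNl -(mform_opp_mode _ a k) main//.
  by move=> l; rewrite /upd; case: eqP => // _; rewrite sqn_opp.
by move=> l; rewrite /upd; case: eqP => [->|//]; exact: roundable_opp.
Qed.

End Classes.
Section SizeClasses.
Variables (R : realType) (d : nat) (th : nat -> R).
Implicit Types (v : 'I_d -> R).

(** In every class but the last one the mesh th j.+1 is below all nonzero
    entries, whereas the last class gathers the entries too small for that. *)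
Definition size_class (n j : nat) v : 'I_d -> R :=
  fun i => if ((j == n) || (th j.+1 < `|v i|)) && (`|v i| <= th j) then v i else 0.

Lemma sum_size_class n v i : (forall j, th j.+1 <= th j) -> `|v i| <= th 0 ->
  \sum_(j < n.+1) size_class n j v i = v i.
Proof.
move=> thS v0; rewrite big_ord_recr /= {2}/size_class eqxx /=.
have -> : \sum_(j < n) size_class n j v i =
    \sum_(j < n) (if (th j.+1 < `|v i|) && (`|v i| <= th j) then v i else 0).
  by apply: eq_bigr => j _; rewrite /size_class ltn_eqF.
elim: n => [|n IH]; first by rewrite big_ord0 add0r v0.
rewrite big_ord_recr/= -[RHS]IH -addrA; congr (_ + _).
have [h1|h1] := leP (`|v i|) (th n.+1); last first.
  by rewrite addr0; case: ifP.
by rewrite (le_trans h1 (thS n)) add0r.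
Qed.

Lemma sqn_size_class n j v : sqn (size_class n j v) <= sqn v.
Proof.
apply: ler_sum => i _; rewrite /size_class; case: ifP => // _.
by rewrite expr0n sqr_ge0.
Qed.

Lemma size_class_le n j v i : 0 <= th j -> `|size_class n j v i| <= th j.
Proof. by move=> t0; rewrite /size_class; case: ifP => [/andP[]|]; rewrite ?normr0. Qed.

Lemma size_class_gt n j v i : (j < n)%N ->
  size_class n j v i = 0 \/ th j.+1 <= `|size_class n j v i|.
Proof.
move=> jn; rewrite /size_class ltn_eqF//=.
by case: ifP => [/andP[/ltW]|]; [right|left].
Qed.

End SizeClasses.

Lemma mform_sum_args (R : realType) (p d n : nat) (X : tensor R p d)
    (b : 'I_p -> 'I_n -> 'I_d -> R) :
  mform X (fun l i => \sum_j b l j i) =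
  \sum_(J : {ffun 'I_p -> 'I_n}) mform X (fun l => b l (J l)).
Proof.
rewrite /mform exchange_big; apply: eq_bigr => i _ /=.
by rewrite bigA_distr_bigA mulr_sumr.
Qed.

(** Below, d = exp (2 N s) and the thresholds are th j = exp (- j s), so that th N
    is d^(-1/2); the last class, with index n = N - 3, is nearly flat. *)

Section LightEntries.
Variables (R : realType) (disp : measure_display) (T : measurableType disp).
Variables (P : probability T R).
Variables (disp0 : measure_display) (T0 : measurableType disp0).
Variables (P0 : probability T0 R) (Y : {RV P0 >-> R}).
Variables (g : R -> R) (tau : R).
Hypothesis bg : bounded_meas g.
Hypothesis g_tau : forall x, `|g x| <= tau.
Hypothesis g_mean : rexp P0 (fun w => g (Y w)) = 0.
Hypothesis g_var : rexp P0 (fun w => g (Y w) ^+ 2) <= 1.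
Variables (p d : nat) (X : {ffun 'I_p -> 'I_d} -> {RV P >-> R}).
Hypothesis XY : independent_copies X Y.
Variables (n : nat) (B s ld : R).
Let N := n.+3.
Hypothesis ld_ln : ld = ln d%:R.
Hypothesis ldE : ld = 2 * N%:R * s.
Hypothesis p2 : (2 <= p)%N.
Hypothesis d4 : (4 <= d)%N.
Hypothesis ld1 : 1 <= ld.
Hypothesis B0 : 0 < B.
Hypothesis dB : d%:R <= B ^+ 2.
Hypothesis small_step : 8 * (p%:R + 1) * ld * expR (- (2 * s)) <= 1.
Hypothesis small_tau : 64 * (p%:R + 1) * ld * expR (6 * s) * tau <= B.

Let th (j : nat) : R := expR (- (j%:R * s)).
Let h (j : nat) : R := if j == n then th N else th j.+1.
Let L (j : nat) : R := 8 * ld * expR (2 * (j%:R + 1) * s).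

Let N0 : 0 < N%:R :> R. Proof. by rewrite ltr0n. Qed.
Let ld0 : 0 < ld. Proof. exact: lt_le_trans ld1. Qed.
Let s0 : 0 < s.
Proof. by move: ld0; rewrite ldE pmulr_rgt0// mulr_gt0. Qed.
Let nE : n%:R = N%:R - 3 :> R.
Proof. by rewrite /N -!natr1; ring. Qed.
Let nN : (n <= N)%N. Proof. by rewrite /N -addn3 leq_addr. Qed.
Let d0 : 0 < d%:R :> R. Proof. by rewrite ltr0n (leq_trans _ d4). Qed.
Let dE : d%:R = expR (2 * N%:R * s). Proof. by rewrite -ldE ld_ln lnK// posrE. Qed.
Let tau0 : 0 <= tau. Proof. exact: le_trans (normr_ge0 _) (g_tau 0). Qed.
Let p0 : 0 <= p%:R :> R. Proof. exact: ler0n. Qed.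

Let th_gt0 j : 0 < th j. Proof. exact: expR_gt0. Qed.
Let th_le i j : (i <= j)%N -> th j <= th i.
Proof. by move=> ij; rewrite ler_expR lerN2 ler_wpM2r ?ler_nat// ltW. Qed.
Let th0 : th 0 = 1. Proof. by rewrite /th mul0r oppr0 expR0. Qed.
Let th_le1 j : th j <= 1. Proof. by rewrite -th0; exact: th_le. Qed.

Let hP j : (j <= n)%N -> [/\ 0 < h j, h j <= th j & 2 <= d%:R * h j].
Proof.
move=> jn; have hN : th N <= h j.
  by rewrite /h; case: eqP => [//|jn']; apply: th_le; rewrite ltnS (leq_trans jn)// -addn2 leq_addr.
split.
- by rewrite /h; case: ifP.
- by rewrite /h; case: eqP => [->|_]; apply: th_le.
- have dN : d%:R * th N = expR (N%:R * s).
    by rewrite dE -expRD; congr expR; ring.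
  apply: le_trans (ler_wpM2l (ltW d0) hN); rewrite dN.
  rewrite -ler_sqr ?nnegrE ?expR_ge0// -expRM_natl.
  have -> : 2%:R * (N%:R * s) = 2 * N%:R * s by ring.
  by rewrite -dE -natrX ler_nat.
Qed.

Let L_ge j : ld <= L j.
Proof.
rewrite /L -[leLHS]mulr1; apply: ler_pM => //; first exact: ltW.
  by rewrite ler_peMl ?ltW//; lra.
by rewrite -[leLHS](expR0 R) ler_expR !mulr_ge0 ?(ltW s0)// addr_ge0.
Qed.

Let L_le i j : (i <= j)%N -> L i <= L j.
Proof.
move=> ij; rewrite /L ler_wpM2l ?mulr_ge0 ?(ltW ld0)// ler_expR ler_wpM2r ?(ltW s0)//.
by rewrite ler_wpM2l// lerD2r ler_nat.
Qed.

Let card_class j : (j < n)%N ->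
  #|in_net (d := d) (th j) (h j)|%:R <= expR (L j) :> R.
Proof.
move=> jn; have [h0 _ _] := hP (ltnW jn).
have ed : expR (- ld) = d%:R^-1 by rewrite expRN ld_ln lnK// posrE.
have ed2 : expR (- ld) <= 2^-1.
  by rewrite ed lef_pV2 ?posrE// ler_nat (leq_trans _ d4).
apply: le_trans (@card_net R d (th j) (h j) ld h0 (ltW ld0) ed2) _.
rewrite ler_expR ed mulfK ?gt_eqF// /h ltn_eqF// /L.
have -> : 4 * ld / th j.+1 ^+ 2 = 4 * ld * expR (2 * (j%:R + 1) * s).
  rewrite /th -expRM_natl -expRN; congr (_ * expR _).
  by rewrite -natr1; ring.
have e1 : 1 <= expR (2 * (j%:R + 1) * s).
  by rewrite -[leLHS](expR0 R) ler_expR !mulr_ge0 ?(ltW s0)// addr_ge0.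
have : 1 * 1 <= ld * expR (2 * (j%:R + 1) * s) by rewrite ler_pM.
by lra.
Qed.

Let card_last : #|in_net (d := d) (th n) (h n)|%:R <= expR (6 * d%:R) :> R.
Proof.
have [h0 _ _] := hP (leqnn n).
have e2 : expR (-1) <= 2^-1 :> R.
  by rewrite expRN lef_pV2 ?posrE ?expR_gt0//; have := expR_ge1Dx (1 : R); lra.
apply: le_trans (@card_net R d (th n) (h n) 1 h0 ler01 e2) _.
rewrite ler_expR /h eqxx.
have -> : 4 * 1 / th N ^+ 2 = 4 * d%:R :> R.
  rewrite /th -expRM_natl -expRN mulr1 dE; congr (_ * expR _).
  by ring.
by have := ler_wpM2l (ltW d0) e2; lra.
Qed.

Let L_le_d j : (j < n)%N -> L j <= d%:R.
Proof.
move=> jn; have e : expR (2 * (j%:R + 1) * s) <= d%:R * expR (- (2 * s)).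
  rewrite dE -expRD ler_expR.
  have : j%:R + 1 <= N%:R - 3 :> R by rewrite natr1 -nE ler_nat.
  by move: s0; nra.
rewrite /L; apply: le_trans (ler_wpM2l _ e) _; first by rewrite mulr_ge0// ltW.
have e0 := expR_gt0 (- (2 * s)).
have : ld * expR (- (2 * s)) * 8 <= 1.
  apply: le_trans small_step.
  have : 0 <= p%:R * ld * expR (- (2 * s)) by rewrite !mulr_ge0 ?expR_ge0// ltW.
  by lra.
move=> /(ler_wpM2l (ltW d0)); lra.
Qed.

Let roundable_class j v : (j <= n)%N -> roundable (th j) (h j) (size_class th n j v : 'I_d -> R).
Proof.
move=> jn; split; first by move=> i; exact/size_class_le/ltW.
rewrite /h; have [->|jn'] := eqVneq j n.
  right; rewrite /th -expRM_natl dE -expRD -[leRHS](expR0 R) ler_expR.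
  by rewrite le_eqVlt; apply/orP; left; apply/eqP; ring.
by left => i; apply: size_class_gt; rewrite ltn_neqAle jn'.
Qed.

Let prod_th_le (Q : pred 'I_p) (J : 'I_p -> nat) k : Q k ->
  \prod_(l | Q l) th (J l) <= th (J k).
Proof.
move=> Qk; rewrite (bigD1 k)//= -[leRHS]mulr1 ler_wpM2l ?(ltW (th_gt0 _))//.
by apply: prodr_ile1 => l _; rewrite th_le1 ltW.
Qed.

(** If two modes are in the last class, products of coordinates are at most
    exp (- 2 n s), that is d^(-1) up to the small factor exp (6 s), and the
    Bernstein bound applies.  Otherwise the second flattest mode is in a class
    j2 < n; the nets in all modes but the flattest have at most exp (p L j2)
    elements, and L j2 times the square of th j2 is only exp (2 s) up to a
    logarithm. *)
Lemma outside_classes (J : {ffun 'I_p -> 'I_n.+1}) :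
  outside P (expR (- ld)) (fun w => forall a : 'I_p -> 'I_d -> R,
    (forall l, sqn (a l) <= 1) ->
    (forall l, roundable (th (J l)) (h (J l)) (a l)) ->
    `|mform (noise_tensor g X w) a| <= 2 ^+ p * ((flat_const R + 6 * p%:R + 2) * B)).
Proof.
have JP l : (J l <= n)%N by rewrite -ltnS.
have hJ l := hP (JP l).
have fc0 : 0 <= flat_const R by rewrite addr_ge0// mulr_ge0// expR_ge0.
have ldd : ld <= d%:R.
  have := expR_ge1Dx ld; rewrite {2}ld_ln lnK ?posrE//; lra.
have [[k1 [k2 [k12 [J1 J2]]]]|noJ] :=
  pselect (exists k1 k2, k1 != k2 /\ (J k1 = n :> nat /\ J k2 = n :> nat)).
  (* Of order d in the Chernoff exponent mu * t, against 6 p d for the nets. *)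
  pose mu := d%:R / B; pose t := (6 * p%:R + 2) * B.
  have mu0 : 0 < mu by rewrite divr_gt0.
  have t0 : 0 <= t by rewrite mulr_ge0 ?(ltW B0)// addr_ge0// mulr_ge0.
  have cardJ l : #|in_net (d := d) (th (J l)) (h (J l))|%:R <= expR (6 * d%:R) :> R.
    have [->|Jn] := eqVneq (nat_of_ord (J l)) n; first exact: card_last.
    have Jln : (J l < n)%N by rewrite ltn_neqAle Jn JP.
    apply: le_trans (card_class Jln) _; rewrite ler_expR.
    by apply: le_trans (L_le_d Jln) _; have := d0; lra.
  have thvt : \prod_l th (J l) <= expR (- (2 * n%:R * s)).
    rewrite (bigD1 k1)//= J1.
    have -> : expR (- (2 * n%:R * s)) = th n * th n.
      by rewrite /th -expRD; congr expR; ring.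
    rewrite ler_wpM2l ?(ltW (th_gt0 _))//.
    have := @prod_th_le (fun l => l != k1) (fun l => nat_of_ord (J l)) k2; rewrite J2; apply.
    by rewrite eq_sym.
  have Bvt : 4 * (mu * expR (- (2 * n%:R * s)) * tau) <= 1.
    have -> : mu * expR (- (2 * n%:R * s)) = expR (6 * s) / B.
      rewrite /mu mulrAC dE -expRD; congr (expR _ / _).
      by rewrite nE; ring.
    have -> : 4 * (expR (6 * s) / B * tau) = 4 * expR (6 * s) * tau / B by ring.
    rewrite ler_pdivrMr// mul1r; apply: le_trans small_tau.
    rewrite ler_wpM2r// ler_wpM2r ?expR_ge0//.
    by have := ld1; have := p0; nra.
  have := outside_net_all bg g_tau g_mean g_var XY hJ (ltnW p2) cardJ thvt mu0 t0 Bvt.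
  apply: outside_weaken.
    rewrite ler_expR.
    have -> : mu * t = (6 * p%:R + 2) * d%:R by rewrite /mu /t; field; rewrite gt_eqF.
    have -> : mu ^+ 2 = d%:R * (d%:R / B ^+ 2).
      by rewrite /mu; field; rewrite gt_eqF.
    have : d%:R * (d%:R / B ^+ 2) <= d%:R * 1.
      by rewrite ler_wpM2l// ?(ltW d0)// ler_pdivrMr ?mul1r// exprn_gt0.
    by lra.
  move=> w hw a a1 ca; apply: le_trans (hw a a1 ca) _.
  rewrite ler_wpM2l ?exprn_ge0// /t ler_wpM2r ?(ltW B0)//; lra.
have k0 : 'I_p by exact: (Ordinal (ltnW p2)).
pose k := [arg max_(l > k0) J l].
have kP l : (J l <= J k)%N by rewrite /k; case: arg_maxnP => // i _; exact.
have [l0 l0k] : exists l0, l0 != k.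
  exists (if k == Ordinal (ltnW p2) then Ordinal p2 else Ordinal (ltnW p2)).
  by case: (eqVneq k (Ordinal (ltnW p2))) => [->//|]; rewrite eq_sym.
have [l2 l2k l2P] : exists2 l2, l2 != k & forall l, l != k -> (J l <= J l2)%N.
  by case: (@arg_maxnP _ l0 (fun l => l != k) (fun l => nat_of_ord (J l)) l0k) => l2;
    exists l2.
set j2 := nat_of_ord (J l2) in l2P.
have j2n : (j2 < n)%N.
  rewrite ltn_neqAle JP andbT; apply/negP => /eqP j2E; apply: noJ.
  exists l2, k; split=> //; split=> //; apply/eqP; rewrite eqn_leq JP/=.
  by rewrite -{1}j2E; exact: kP.
(* The net costs p * L j2; one more L j2 is left for the probability. *)
pose mu := (p%:R + 1) * L j2 / B.
have L2 : 0 < L j2 by exact: lt_le_trans ld0 (L_ge _).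
have pp : 0 < p%:R + 1 :> R by rewrite ltr_wpDl.
have mu0 : 0 < mu by rewrite divr_gt0// mulr_gt0.
have cardJ l : l != k -> #|in_net (d := d) (th (J l)) (h (J l))|%:R <= expR (L j2) :> R.
  move=> lk; have Jl := l2P l lk.
  apply: le_trans (card_class (leq_ltn_trans Jl j2n)) _.
  by rewrite ler_expR L_le.
have thvt : \prod_(l | l != k) th (J l) <= th j2.
  by apply: (@prod_th_le (fun l => l != k) (fun l => nat_of_ord (J l)) l2).
have thk : th (J k) <= th j2 by apply: th_le; exact: kP.
have B1 : mu * th (J k) <= 1.
  apply: le_trans (ler_wpM2l (ltW mu0) thk) _.
  have -> : mu * th j2 = 8 * (p%:R + 1) * ld * expR ((j2%:R + 2) * s) / B.
    have -> : expR ((j2%:R + 2) * s) = expR (2 * (j2%:R + 1) * s) * th j2.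
      by rewrite /th -expRD; congr expR; ring.
    by rewrite /mu /L; ring.
  rewrite ler_pdivrMr// mul1r.
  have sB : expR (N%:R * s) <= B.
    rewrite -ler_sqr ?nnegrE ?expR_ge0 ?(ltW B0)//; apply: le_trans dB.
    by rewrite dE -expRM_natl ler_expR le_eqVlt; apply/orP; left; apply/eqP; ring.
  apply: le_trans sB; rewrite -[leRHS]mul1r.
  apply: (@le_trans _ _ (8 * (p%:R + 1) * ld * expR (- (2 * s)) * expR (N%:R * s))).
    rewrite -[leRHS]mulrA ler_wpM2l ?mulr_ge0 ?(ltW ld0) ?(ltW pp)//.
    rewrite -expRD ler_expR.
    have : j2%:R + 1 <= N%:R - 3 :> R by rewrite natr1 -nE ler_nat.
    by move: s0; nra.
  by rewrite ler_wpM2r ?expR_ge0.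
have Bvt : 8 * (mu * th (J k) * th j2 * tau) <= 1.
  apply: (@le_trans _ _ (8 * (mu * th j2 * th j2 * tau))).
    rewrite ler_wpM2l// ler_wpM2r// ler_wpM2r ?(ltW (th_gt0 _))//.
    by rewrite ler_wpM2l// ltW.
  have -> : 8 * (mu * th j2 * th j2 * tau) =
      64 * (p%:R + 1) * ld * expR (2 * s) * tau / B.
    have -> : expR (2 * s) = expR (2 * (j2%:R + 1) * s) * th j2 * th j2.
      by rewrite /th -!expRD; congr expR; ring.
    by rewrite /mu /L; ring.
  rewrite ler_pdivrMr// mul1r; apply: le_trans small_tau.
  rewrite ler_wpM2r// ler_wpM2l ?mulr_ge0 ?(ltW ld0) ?(ltW pp)// ler_expR.
  by move: s0; lra.
have := outside_net_flat bg g_tau g_mean g_var XY hJ cardJ (ltW L2) thvt mu0 B0 dB B1 Bvt.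
apply: outside_weaken.
  rewrite ler_expR.
  have -> : mu * B = (p%:R + 1) * L j2 by rewrite /mu; field; rewrite gt_eqF.
  by have := L_ge j2; lra.
move=> w hw a a1 ca; apply: le_trans (hw a a1 ca) _.
rewrite ler_wpM2l ?exprn_ge0// ler_wpM2r ?(ltW B0)//; have := p0; lra.
Qed.

(** There are at most n.+3 ^ p tuples of classes, a constant since the thresholds
    are spaced by a fixed power of d. *)
Lemma outside_light :
  outside P ((N ^ p)%:R * d%:R^-1) (fun w => forall a : 'I_p -> 'I_d -> R,
    (forall l, sqn (a l) <= 1) ->
    `|mform (noise_tensor g X w) a| <=
       (N ^ p)%:R * (2 ^+ p * ((flat_const R + 6 * p%:R + 2) * B))).
Proof.
have fc0 : 0 <= flat_const R by rewrite addr_ge0// mulr_ge0// expR_ge0.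
have npN : (n.+1 ^ p <= N ^ p)%N by rewrite leq_exp2r ?(ltnW p2)// /N -addn2 leq_addr.
have := outside_all outside_classes; apply: outside_weaken.
  rewrite sumr_const card_ffun !card_ord -[leLHS]mulr_natl expRN ld_ln lnK ?posrE//.
  by rewrite ler_wpM2r ?invr_ge0// ler_nat.
move=> w hw a a1.
have -> : a = fun l i => \sum_(j < n.+1) size_class th n j (a l) i.
  apply/funext => l; apply/funext => i; rewrite sum_size_class//.
    by move=> j; exact: th_le.
  by rewrite th0 entry_le1.
rewrite mform_sum_args (le_trans (ler_norm_sum _ _ _))//.
set K := (2 ^+ p * _).
have K0 : 0 <= K.
  rewrite /K mulr_ge0 ?exprn_ge0// mulr_ge0 ?(ltW B0)//; have := p0; lra.
apply: (@le_trans _ _ (\sum_(J : {ffun 'I_p -> 'I_n.+1}) K)).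
  apply: ler_sum => J _; apply: hw => l.
    by rewrite (le_trans (sqn_size_class _ _ _ _)).
  by apply: roundable_class; rewrite -ltnS.
by rewrite sumr_const card_ffun !card_ord -[leLHS]mulr_natl ler_wpM2r// ler_nat.
Qed.

End LightEntries.
(** * Large entries and means *)

Section DeterministicTensors.
Variables (R : realType) (p d : nat).
Implicit Types (a : 'I_p -> 'I_d -> R).

Lemma mform_const_le (c : R) a : (forall l, sqn (a l) <= 1) ->
  `|mform (fun=> c) a| <= `|c| * Num.sqrt d%:R ^+ p.
Proof.
move=> a1; have -> : mform (fun=> c) a = c * \prod_l \sum_j a l j.
  by rewrite /mform -mulr_sumr bigA_distr_bigA.
rewrite normrM ler_wpM2l// normr_prod.
have -> : Num.sqrt d%:R ^+ p = \prod_(l < p) Num.sqrt d%:R :> R.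
  by rewrite prodr_const card_ord.
apply: ler_prod => l _; rewrite normr_ge0/=.
have [d0|d0] := eqVneq d 0%N.
  rewrite big1 ?normr0 ?sqrtr_ge0// => j _.
  by have := leq_ltn_trans (leq0n j) (ltn_ord j); rewrite [in X in (X -> _)]d0.
have sd0 : 0 < Num.sqrt d%:R :> R by rewrite sqrtr_gt0 ltr0n lt0n.
have sd2 : Num.sqrt d%:R * Num.sqrt d%:R = d%:R :> R by rewrite -expr2 sqr_sqrtr.
have : 0 <= \sum_j (Num.sqrt d%:R * `|a l j| - 1) ^+ 2 :> R.
  by apply: sumr_ge0 => j _; exact: sqr_ge0.
have -> : \sum_j (Num.sqrt d%:R * `|a l j| - 1) ^+ 2 =
    d%:R * sqn (a l) - 2 * Num.sqrt d%:R * (\sum_j `|a l j|) + d%:R :> R.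
  transitivity (\sum_j (d%:R * a l j ^+ 2 - 2 * Num.sqrt d%:R * `|a l j| + 1)).
    apply: eq_bigr => j _; rewrite -{2}sd2 -(real_normK (num_real (a l j))); ring.
  by rewrite big_split sumrB /= -!mulr_sumr sumr_const card_ord.
move=> h; apply: le_trans (ler_norm_sum _ _ _) _.
set x := \sum_j _ in h *.
have : d%:R * sqn (a l) <= d%:R * 1 by rewrite ler_wpM2l.
rewrite mulr1 -{2}sd2 => h1.
rewrite -(ler_pM2l sd0); lra.
Qed.

(** If two modes see at most one nonzero entry in each slice, the form is a
    sum over a partial matching, whatever the order of the tensor. *)
Lemma mform_sparse_le (H : tensor R p d) (M : R) (k0 k1 : 'I_p) a : k0 != k1 -> 0 <= M ->
  (forall i, `|H i| <= M) ->
  (forall k, k \in [:: k0; k1] -> forall i i' : {ffun 'I_p -> 'I_d}, i != i' -> i k = i' k ->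
     H i = 0 \/ H i' = 0) ->
  (forall l, sqn (a l) <= 1) -> `|mform H a| <= M.
Proof.
move=> k01 M0 HM Hk a1.
have a_le l j : `|a l j| <= 1 by exact: entry_le1.
have slice k : k \in [:: k0; k1] -> \sum_(i : {ffun 'I_p -> 'I_d}) `|H i| * a k (i k) ^+ 2 <= M.
  move=> kk; rewrite (partition_big (fun i : {ffun 'I_p -> 'I_d} => i k) predT)//=.
  apply: (@le_trans _ _ (\sum_j M * a k j ^+ 2)); last first.
    by rewrite -mulr_sumr -[leRHS]mulr1 ler_wpM2l// a1.
  apply: ler_sum => j _.
  have -> : \sum_(i : {ffun 'I_p -> 'I_d} | i k == j) `|H i| * a k (i k) ^+ 2 =
      (\sum_(i : {ffun 'I_p -> 'I_d} | i k == j) `|H i|) * a k j ^+ 2.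
    by rewrite mulr_suml; apply: eq_bigr => i /eqP ->.
  rewrite ler_wpM2r ?sqr_ge0//.
  have [[i /andP[ij Hi]]|noi] :=
    pselect (exists i : {ffun 'I_p -> 'I_d}, (i k == j) && (H i != 0)); last first.
    rewrite big1// => i ij; apply/eqP; rewrite normr_eq0; apply/negPn/negP => Hi.
    by apply: noi; exists i; rewrite ij.
  rewrite (bigD1 i)//= big1 ?addr0// => i' /andP[/eqP ij' ii'].
  have := Hk k kk i i'; rewrite eq_sym ii' ij' (eqP ij) => /(_ erefl erefl)[|->].
    by move=> Hi0; rewrite Hi0 eqxx in Hi.
  by rewrite normr0.
have h0 := slice k0 (mem_head _ _).
have h1 : \sum_(i : {ffun 'I_p -> 'I_d}) `|H i| * a k1 (i k1) ^+ 2 <= M.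
  by apply: slice; rewrite !inE eqxx orbT.
rewrite /mform (le_trans (ler_norm_sum _ _ _))//.
apply: (@le_trans _ _ (\sum_(i : {ffun 'I_p -> 'I_d})
    (`|H i| * a k0 (i k0) ^+ 2 + `|H i| * a k1 (i k1) ^+ 2) / 2)).
  apply: ler_sum => i _; rewrite normrM -mulrDr -mulrA ler_wpM2l//.
  rewrite normr_prod (bigD1 k0)//= (bigD1 k1) 1?eq_sym//= mulrA.
  apply: (@le_trans _ _ (`|a k0 (i k0)| * `|a k1 (i k1)| * 1)).
    rewrite ler_wpM2l ?mulr_ge0//; apply: prodr_ile1 => l _.
    by rewrite normr_ge0 a_le.
  rewrite mulr1 -(real_normK (num_real (a k0 (i k0)))) -(real_normK (num_real (a k1 (i k1)))).
  have := sqr_ge0 (`|a k0 (i k0)| - `|a k1 (i k1)|); nra.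
by rewrite -mulr_suml big_split/=; lra.
Qed.

Lemma card_fiber k (j : 'I_d) :
  #|[pred i : {ffun 'I_p -> 'I_d} | i k == j]|%:R = d%:R ^+ p.-1 :> R.
Proof.
have e := sum_fiber_prod_sqr (fun (l : 'I_p) (m : 'I_d) => 1 : R) k j.
transitivity (\sum_(i : {ffun 'I_p -> 'I_d} | i k == j) (\prod_(l < p | l != k) (1 : R)) ^+ 2).
  rewrite (eq_bigr (fun=> 1)) ?sumr_const// => i _.
  by rewrite big1// expr1n.
rewrite e (eq_bigr (fun=> d%:R)) ?prodr_const ?cardC1 ?card_ord// => l _.
by rewrite /sqn (eq_bigr (fun=> 1)) ?sumr_const ?card_ord// => m _; rewrite expr1n.
Qed.

End DeterministicTensors.

Section LargeEntries.
Variables (R : realType) (disp : measure_display) (T : measurableType disp).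
Variables (P : probability T R).
Variables (disp0 : measure_display) (T0 : measurableType disp0).
Variables (P0 : probability T0 R) (Y : {RV P0 >-> R}).

Definition exceeds (t : R) : R -> R := \1_[set x : R | t < `|x|].

Lemma bmeas_exceeds t : bounded_meas (exceeds t).
Proof.
by apply/bmeas_indic/measurable_gt_fun; exact: normr_measurable.
Qed.

Lemma exceeds_ge0 t x : 0 <= exceeds t x.
Proof. by rewrite /exceeds indicE. Qed.

Lemma exceedsE t x : exceeds t x = if t < `|x| then 1 else 0.
Proof.
rewrite /exceeds indicE; case: ifPn => h.
  by rewrite mem_set.
by rewrite memNset// => /= th; rewrite th in h.
Qed.

Variables (I : finType) (X : I -> {RV P >-> R}).
Hypothesis XY : independent_copies X Y.

Lemma rexp_one i (f : R -> R) : bounded_meas f -> (forall x, 0 <= f x) ->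
  rexp P (fun w => f (X i w)) = rexp P0 (fun w => f (Y w)).
Proof.
move=> bf f0; pose h l : R -> R := if l == i then f else fun=> 1.
have hi : h i = f by rewrite /h eqxx.
have hl l : l != i -> h l = fun=> 1 by rewrite /h => /negbTE ->.
transitivity (rexp P (fun w => \prod_l h l (X l w))).
  congr rexp; apply/funext => w; rewrite (bigD1 i)//= hi big1 ?mulr1//.
  by move=> l li; rewrite hl.
rewrite (rexp_prod XY).
- rewrite (bigD1 i)//= hi big1 ?mulr1// => l li.
  by rewrite hl// rexp_cst.
- by move=> l; rewrite /h; case: ifP => // _; exact: bmeas_cst.
- by move=> l x; rewrite /h; case: ifP.
Qed.

Lemma rexp_two i i' (f : R -> R) : i != i' -> bounded_meas f -> (forall x, 0 <= f x) ->
  rexp P (fun w => f (X i w) * f (X i' w)) = rexp P0 (fun w => f (Y w)) ^+ 2.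
Proof.
move=> ii' bf f0; pose h l : R -> R := if (l == i) || (l == i') then f else fun=> 1.
have hi : h i = f by rewrite /h eqxx.
have hi' : h i' = f by rewrite /h eqxx orbT.
have hl l : l != i -> l != i' -> h l = fun=> 1.
  by rewrite /h => /negbTE -> /negbTE ->.
have i'i : i' != i by rewrite eq_sym.
transitivity (rexp P (fun w => \prod_l h l (X l w))).
  congr rexp; apply/funext => w; rewrite (bigD1 i)//= (bigD1 i')//= hi hi' big1 ?mulr1//.
  by move=> l /andP[li li']; rewrite hl.
rewrite (rexp_prod XY).
- rewrite (bigD1 i)//= (bigD1 i')//= hi hi' big1 ?mulr1 ?expr2// => l /andP[li li'].
  by rewrite hl// rexp_cst.
- by move=> l; rewrite /h; case: ifP => // _; exact: bmeas_cst.
- by move=> l x; rewrite /h; case: ifP.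
Qed.

(** The factor 2 is the price of applying Markov's inequality to an indicator at
    level 1/2. *)
Lemma outside_max (M : R) :
  outside P (2 * #|I|%:R * rexp P0 (fun w => exceeds M (Y w)))
    (fun w => forall i, `|X i w| <= M).
Proof.
have h i : outside P (2 * rexp P0 (fun w => exceeds M (Y w))) (fun w => `|X i w| <= M).
  have be : bounded_meas (fun w => exceeds M (X i w)).
    by have [me he] := bmeas_exceeds M; apply: bmeas_comp.
  have h2 : 0 < 2^-1 :> R by rewrite invr_gt0.
  have := outside_markov P be (fun w => exceeds_ge0 _ _) h2; apply: outside_weaken.
    by rewrite invrK mulrC (rexp_one i (bmeas_exceeds M) (exceeds_ge0 M)).
  by move=> w; rewrite exceedsE; case: ltP => // _; lra.
have := outside_all h; apply: outside_weaken => //.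
by rewrite sumr_const -[leLHS]mulr_natl mulrCA mulrA.
Qed.

Lemma outside_pair (t : R) i i' : i != i' ->
  outside P (2 * rexp P0 (fun w => exceeds t (Y w)) ^+ 2)
    (fun w => `|X i w| <= t \/ `|X i' w| <= t).
Proof.
move=> ii'; have be l : bounded_meas (fun w => exceeds t (X l w)).
  by have [me he] := bmeas_exceeds t; apply: bmeas_comp.
have h2 : 0 < 2^-1 :> R by rewrite invr_gt0.
have := outside_markov P (bmeasM (be i) (be i'))
  (fun w => mulr_ge0 (exceeds_ge0 _ _) (exceeds_ge0 _ _)) h2.
apply: outside_weaken.
  by rewrite invrK mulrC (rexp_two ii' (bmeas_exceeds t) (exceeds_ge0 t)).
move=> w; rewrite !exceedsE; case: ltP => [_|]; last by left.
case: ltP => [_|]; last by right.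
by move=> h; exfalso; lra.
Qed.

End LargeEntries.
Section SliceEvents.
Variables (R : realType) (disp : measure_display) (T : measurableType disp).
Variables (P : probability T R).
Variables (disp0 : measure_display) (T0 : measurableType disp0).
Variables (P0 : probability T0 R) (Y : {RV P0 >-> R}).
Variables (p d : nat) (X : {ffun 'I_p -> 'I_d} -> {RV P >-> R}).
Hypothesis XY : independent_copies X Y.

Lemma outside_slices k (t : R) :
  outside P (d%:R ^+ p * d%:R ^+ p.-1 * (2 * rexp P0 (fun w => exceeds t (Y w)) ^+ 2))
    (fun w => forall i i' : {ffun 'I_p -> 'I_d}, i != i' -> i k = i' k ->
       `|X i w| <= t \/ `|X i' w| <= t).
Proof.
set q := 2 * _ ^+ 2; have q0 : 0 <= q by rewrite mulr_ge0// sqr_ge0.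
have h (i : {ffun 'I_p -> 'I_d}) : outside P (d%:R ^+ p.-1 * q)
    (fun w => forall i', i' \in enum [pred i' : {ffun 'I_p -> 'I_d} | i' k == i k] ->
      i != i' -> `|X i w| <= t \/ `|X i' w| <= t).
  have hs i' : i' \in enum [pred i' : {ffun 'I_p -> 'I_d} | i' k == i k] ->
      outside P q (fun w => i != i' -> `|X i w| <= t \/ `|X i' w| <= t).
    move=> _; have [->|ii'] := eqVneq i i'; first by apply: outside_true.
    by have := outside_pair XY t ii'; apply: outside_weaken.
  have := outside_seq hs.
  apply: outside_weaken => //.
  by rewrite big_const_seq count_predT -cardE iter_addr_0 -[leLHS]mulr_natl card_fiber.
have := outside_all h; apply: outside_weaken.
  rewrite sumr_const card_ffun !card_ord -[leLHS]mulr_natl natrX.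
  by rewrite mulrA.
by move=> w hw i i' ii' kk; apply: hw => //; rewrite mem_enum inE kk.
Qed.

End SliceEvents.

Section SecondMoment.
Variables (R : realType) (disp : measure_display) (T : measurableType disp).
Variables (P : probability T R).
Variables (disp0 : measure_display) (T0 : measurableType disp0).
Variables (P0 : probability T0 R) (Y : {RV P0 >-> R}).
Variables (g : R -> R) (tau v : R).
Hypothesis bg : bounded_meas g.
Hypothesis g_tau : forall x, `|g x| <= tau.
Hypothesis g_mean : rexp P0 (fun w => g (Y w)) = 0.
Hypothesis g_var : rexp P0 (fun w => g (Y w) ^+ 2) <= v.
Variables (p d : nat) (X : {ffun 'I_p -> 'I_d} -> {RV P >-> R}).
Hypothesis XY : independent_copies X Y.

(** The second moment is read off the exponential moments at a small parameter s,
    which already contain the independence of the entries. *)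
Lemma rexp_mform_sqr_le a : 0 <= v -> (forall l, sqn (a l) <= 1) ->
  rexp P (fun w => mform (noise_tensor g X w) a ^+ 2) <= 32 * expR 1 * v.
Proof.
move=> v0 a1; pose s := (1 + 4 * tau + v)^-1.
have tau0 := tau_ge0 g_tau.
have den : 1 <= 1 + 4 * tau + v by lra.
have s0 : 0 < s by rewrite invr_gt0; lra.
have s1 : s <= 1 by rewrite invf_le1//; lra.
have st : 4 * (s * 1 * tau) <= 1.
  by rewrite mulr1 /s mulrA mulrC mulrA -ler_pdivlMr ?invr_gt0 ?invrK; lra.
have sv : s ^+ 2 * v <= 1.
  apply: (@le_trans _ _ (s * v)).
    by rewrite ler_wpM2r// expr2 -[leRHS]mul1r ler_wpM2r// ltW.
  by rewrite /s mulrC -ler_pdivlMr ?invr_gt0 ?invrK; lra.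
have a_le l j : `|a l j| <= 1 by exact: entry_le1.
have prod_le (b : 'I_p -> 'I_d -> R) (i : {ffun 'I_p -> 'I_d}) :
    (forall l j, `|b l j| <= 1) -> `|\prod_l b l (i l)| <= 1.
  by move=> b1; rewrite normr_prod prodr_ile1// => l _; rewrite normr_ge0 b1.
have mgf (c : R) : `|c| = s ->
    rexp P (fun w => expR (c * mform (noise_tensor g X w) a)) <= expR (v * s ^+ 2).
  move=> cs.
  have -> : (fun w => expR (c * mform (noise_tensor g X w) a)) =
     fun w => expR (\sum_(i : {ffun 'I_p -> 'I_d}) (c * \prod_l a l (i l)) * g (X i w)).
    apply/funext => w; rewrite /mform mulr_sumr; congr expR; apply: eq_bigr => i _.
    by rewrite mulrCA mulrC.
  apply: le_trans (mgf_linear_le bg g_tau g_mean g_var XY _) _.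
    move=> i; rewrite (le_trans _ st)// ler_pM2l// ler_wpM2r//.
    by rewrite normrM cs ler_wpM2l ?prod_le// ltW.
  rewrite ler_expR ler_wpM2l//.
  under eq_bigr do rewrite exprMn.
  rewrite -mulr_sumr sum_prod_sqr -(real_normK (num_real c)) cs.
  rewrite -[leRHS]mulr1 ler_wpM2l ?sqr_ge0//.
  by apply: prodr_ile1 => l _; rewrite sqn_ge0 a1.
pose Z w := mform (noise_tensor g X w) a.
have bZ : bounded_meas Z by exact: bmeas_mform.
have be c : bounded_meas (fun w => expR (c * Z w)) by apply/bmeas_exp/bmeasZ.
have sq x : x ^+ 2 <= 16 * (expR x + expR (- x) - 2) :> R.
  wlog x0 : x / 0 <= x => [hw|].
    have [x0|/ltW x0] := leP 0 x; first exact: hw.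
    by have := hw (- x); rewrite sqrrN opprK oppr_ge0 [expR (- x) + _]addrC; apply.
  have h0 : 0 <= x / 2 by rewrite divr_ge0.
  have := sqr_expR_le_cosh h0.
  have -> : 2 * (x / 2) = x by field.
  have : 1 <= expR (x / 2) by rewrite -[leLHS](expR0 R) ler_expR.
  have := sqr_ge0 (x / 2); set e1 := expR (x / 2); rewrite exprMn => h1 h2 h3.
  have : (x ^+ 2 * 2^-1 ^+ 2) * 1 <= (x ^+ 2 * 2^-1 ^+ 2) * e1 by rewrite ler_wpM2l.
  lra.
have main : s ^+ 2 * rexp P (fun w => Z w ^+ 2) <=
    16 * (expR (v * s ^+ 2) + expR (v * s ^+ 2) - 2).
  rewrite -rexpZ; last exact: bmeasX.
  apply: (@le_trans _ _ (rexp P (fun w =>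
     16 * ((expR (s * Z w) + expR (- s * Z w)) - 2)))).
    apply: rexp_le.
    - by apply: bmeasZ; exact: bmeasX.
    - by apply/bmeasZ/bmeasB; [apply: bmeasD; exact: be|exact: bmeas_cst].
    - by move=> w; rewrite -exprMn mulNr; exact: sq.
  rewrite rexpZ; last by apply/bmeasB; [apply: bmeasD; exact: be|exact: bmeas_cst].
  rewrite rexpB; [|by apply: bmeasD; exact: be|exact: bmeas_cst].
  rewrite (rexpD _ (be s) (be (- s))) rexp_cst.
  rewrite ler_wpM2l// lerD2r lerD// mgf//; first by rewrite gtr0_norm.
  by rewrite normrN gtr0_norm.
have e1 : expR (v * s ^+ 2) - 1 <= v * s ^+ 2 * expR 1.
  apply: le_trans (expR_sub1_le _) _; apply: ler_wpM2l.
    by rewrite mulr_ge0// sqr_ge0.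
  by rewrite ler_expR mulrC.
rewrite -/(Z) -(@ler_pM2l _ (s ^+ 2)) ?exprn_gt0//; apply: le_trans main _.
lra.
Qed.

(** Entries of small variance but large range: Markov's inequality is enough when
    the arguments in the other modes are fixed. *)
Lemma outside_second_moment (a : 'I_p -> 'I_d -> R) k : (0 < d)%N -> 0 <= v ->
  (forall l, sqn (a l) <= 1) ->
  outside P (32 * expR 1 * v) (fun w => forall b : 'I_d -> R, sqn b <= 1 ->
    `|mform (noise_tensor g X w) (upd a k b)| <= Num.sqrt d%:R).
Proof.
move=> d0 v0 a1; pose Z w j := mcontract (noise_tensor g X w) a k j.
have dpos : 0 < d%:R :> R by rewrite ltr0n.
have eZ w j : mform (noise_tensor g X w) (upd a k (basisf R j)) = Z w j.
  by rewrite mform_upd dotf_basisf.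
have bZ j : bounded_meas (fun w => Z w j) by exact: bmeas_mcontract.
have bS : bounded_meas (fun w => \sum_j Z w j ^+ 2).
  by apply: bmeas_sum => j; exact: bmeasX.
have := outside_markov P bS (fun w => sumr_ge0 _ (fun j _ => sqr_ge0 (Z w j))) dpos.
apply: outside_weaken.
  rewrite ler_pdivrMr// rexp_sum; last by move=> j; exact: bmeasX.
  apply: (@le_trans _ _ (\sum_(j < d) (32 * expR 1 * v))).
    apply: ler_sum => j _.
    have -> : (fun w => Z w j ^+ 2) =
        fun w => mform (noise_tensor g X w) (upd a k (basisf R j)) ^+ 2.
      by apply/funext => w; rewrite eZ.
    apply: rexp_mform_sqr_le => // l; rewrite /upd; case: eqP => // _.
    by rewrite sqn_basisf.
  by rewrite sumr_const card_ord -[leLHS]mulr_natr.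
move=> w Zw b b1; rewrite mform_upd -/(Z w).
have sd0 : 0 < Num.sqrt d%:R :> R by rewrite sqrtr_gt0.
have sd2 : Num.sqrt d%:R ^+ 2 = d%:R :> R by rewrite sqr_sqrtr// ltW.
have := sqn_ge0 (fun j => Num.sqrt d%:R * b j - Z w j).
have := sqn_ge0 (fun j => Num.sqrt d%:R * b j + Z w j).
rewrite sqnB sqnD dotfZl sqnZ sd2 => h1 h2.
have hZ : sqn (Z w) <= d%:R by exact: Zw.
have hb : d%:R * sqn b <= d%:R * 1 by rewrite ler_wpM2l// ltW.
rewrite ler_norml; apply/andP; split.
  by rewrite -(ler_pM2l sd0) mulrN -expr2 sd2; lra.
by rewrite -(ler_pM2l sd0) -expr2 sd2; lra.
Qed.

End SecondMoment.

Section Moments.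
Variables (R : realType) (disp0 : measure_display) (T0 : measurableType disp0).
Variables (P0 : probability T0 R) (Y : {RV P0 >-> R}).

Lemma rexp_le_moment (f phi : R -> R) (c K : R) :
  bounded_meas f -> (forall x, 0 <= f x) -> measurable_fun setT phi ->
  (forall x, 0 <= phi x) -> 0 <= c -> (forall x, f x <= c * phi x) ->
  (\int[P0]_w (phi (Y w))%:E <= K%:E)%E ->
  rexp P0 (fun w => f (Y w)) <= c * K.
Proof.
move=> bf f0 mphi phi0 c0 fphi hK.
have bfY : bounded_meas (fun w => f (Y w)) by have [? ?] := bf; exact: bmeas_comp.
have mpY : measurable_fun setT (fun w => phi (Y w)) by exact: measurableT_comp.
rewrite -lee_fin /rexp /Rintegral fineK; last first.
  by apply: integrable_fin_num => //; exact: bmeas_integrable.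
apply: (@le_trans _ _ (\int[P0]_w (c%:E * (phi (Y w))%:E))%E).
  apply: ge0_le_integral => //.
  - by move=> w _; rewrite lee_fin.
  - by apply/measurable_EFinP; exact: bfY.1.
  - apply/measurable_EFinP; apply: measurable_funM => //.
  - by move=> w _; rewrite -EFinM lee_fin.
rewrite ge0_integralZl//.
- by rewrite EFinM lee_wpmul2l// lee_fin.
- exact/measurable_EFinP.
- by move=> w _; rewrite lee_fin.
Qed.

Definition trunc (t x : R) : R := x * (1 - exceeds t x).

Lemma truncE t x : trunc t x = if `|x| <= t then x else 0.
Proof. by rewrite /trunc exceedsE; case: leP => _; rewrite ?subr0 ?subrr ?mulr1 ?mulr0. Qed.

Lemma trunc_le t x : 0 <= t -> `|trunc t x| <= t.
Proof. by move=> t0; rewrite truncE; case: ifP => //; rewrite normr0. Qed.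

Lemma bmeas_trunc t : 0 <= t -> bounded_meas (trunc t).
Proof.
move=> t0; split; last by exists t => x; exact: trunc_le.
apply: measurable_funM => //; apply: measurable_funB => //.
exact: (bmeas_exceeds t).1.
Qed.

Hypothesis Y0 : ('E_P0[Y] = 0)%E.
Hypothesis Y1 : ('V_P0[Y] = 1)%E.

Lemma second_moment : (\int[P0]_w ((Y w) ^+ 2)%:E = 1)%E.
Proof.
rewrite -Y1 /variance covariance.unlock Y0 /= unlock.
apply: eq_integral => w _; congr EFin; rewrite expr2.
by transitivity ((Y w - 0) * (Y w - 0)); [rewrite subr0|].
Qed.

Lemma integrable_sqr : P0.-integrable setT (fun w => ((Y w) ^+ 2)%:E).
Proof.
apply/integrableP; split.
  by apply/measurable_EFinP; apply: measurable_funX.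
under eq_integral do rewrite gee0_abs ?lee_fin ?sqr_ge0//.
by rewrite second_moment ltry.
Qed.

Lemma integrable_RV : P0.-integrable setT (EFin \o Y).
Proof.
apply: (@le_integrable _ _ _ _ _ _ _ (fun w => (1 + (Y w) ^+ 2)%:E)) => //.
- exact/measurable_EFinP.
- move=> w _ /=; rewrite lee_fin [leRHS]ger0_norm ?addr_ge0 ?sqr_ge0//.
  by rewrite -(real_normK (num_real (Y w))); have := sqr_ge0 (`|Y w| - 1); nra.
- rewrite (_ : (fun w => _) = (fun w => (1%:E + ((Y w) ^+ 2)%:E)%E)); last exact/funext.
  apply: integrableD => //; last exact: integrable_sqr.
  by apply: (bmeas_integrable P0 (bmeas_cst T0 1)).
Qed.

Lemma rexp_trunc_le (phi : R -> R) (t c K : R) : 0 <= t ->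
  measurable_fun setT phi -> (forall x, 0 <= phi x) -> 0 <= c ->
  (forall x, `|x| * exceeds t x <= c * phi x) ->
  (\int[P0]_w (phi (Y w))%:E <= K%:E)%E ->
  `|rexp P0 (fun w => trunc t (Y w))| <= c * K.
Proof.
move=> t0 mphi phi0 c0 tphi hK.
have bt := bmeas_trunc t0.
have btY : bounded_meas (fun w => trunc t (Y w)) by have [? ?] := bt; exact: bmeas_comp.
have it := bmeas_integrable P0 btY.
have iY := integrable_RV.
have E0 : \int[P0]_w Y w = 0.
  by rewrite /Rintegral; move: Y0; rewrite unlock => ->.
have -> : rexp P0 (fun w => trunc t (Y w)) = - \int[P0]_w (Y w - trunc t (Y w)).
  by rewrite RintegralB// E0 sub0r opprK.
rewrite normrN.
have id : P0.-integrable setT (EFin \o (fun w => Y w - trunc t (Y w))).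
  have := integrableB measurableT iY it; apply: eq_integrable => //.
apply: le_trans (le_normr_Rintegral _ id) _ => //.
rewrite -lee_fin /Rintegral fineK; last first.
  by apply: integrable_fin_num => //; have := integrable_abse id; apply: eq_integrable.
have mpY : measurable_fun setT (fun w => phi (Y w)) by exact: measurableT_comp.
apply: (@le_trans _ _ (\int[P0]_w (c%:E * (phi (Y w))%:E))%E).
  apply: ge0_le_integral => //.
  - by have /measurable_int := integrable_abse id.
  - by apply/measurable_EFinP; apply: measurable_funM.
  - move=> w _; rewrite -EFinM lee_fin; apply: le_trans (tphi _).
    have -> : Y w - trunc t (Y w) = Y w * exceeds t (Y w) by rewrite /trunc; ring.
    by rewrite normrM (ger0_norm (exceeds_ge0 _ _)).
rewrite ge0_integralZl//.
- by rewrite EFinM lee_wpmul2l// lee_fin.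
- exact/measurable_EFinP.
- by move=> w _; rewrite lee_fin.
Qed.

(** Dominated convergence: the second moment carried by large values vanishes. *)
Lemma tail_second_moment (e : R) : 0 < e -> exists2 t0 : R, 0 <= t0 &
  forall f : R -> R, bounded_meas f -> (forall x, 0 <= f x) ->
    (forall x, f x <= x ^+ 2 * exceeds t0 x) -> rexp P0 (fun w => f (Y w)) <= e.
Proof.
move=> e0.
pose h (n : nat) (w : T0) : \bar R := ((Y w) ^+ 2 * exceeds n%:R (Y w))%:E.
have mh n : measurable_fun setT (h n).
  apply/measurable_EFinP; apply: measurable_funM; first exact: measurable_funX.
  by have [m _] := bmeas_exceeds (n%:R : R); exact: measurableT_comp.
have cvgh : (\int[P0]_w h n w)%E @[n --> \oo] --> 0%E.
  have <- : (\int[P0]_w (cst 0%E w))%E = 0%E :> \bar R by exact: integral0.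
  apply: (@dominated_cvg _ _ _ P0 setT measurableT h (cst 0%E)
            (fun w => ((Y w) ^+ 2)%:E)) => //.
  - move=> w _; apply: cvg_near_cst; near=> n.
    rewrite /h exceedsE ltNge.
    suff -> : `|Y w| <= n%:R by rewrite mulr0.
    by near: n; exact: nbhs_infty_ger.
  - exact: integrable_sqr.
  - move=> n w _; rewrite /h gee0_abs; last first.
      by rewrite lee_fin; apply: mulr_ge0; [exact: sqr_ge0|exact: exceeds_ge0].
    rewrite lee_fin.
    by rewrite -[leRHS]mulr1 ler_wpM2l ?sqr_ge0// exceedsE; case: ifP.
have : \forall n \near \oo, (\int[P0]_w h n w < e%:E)%E.
  have := cvgh; move/fine_cvgP => [fn cv].
  apply: filterS2 fn (cvgr_lt _ cv _ e0) => n f1 f2.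
  by rewrite -(fineK f1) lte_fin.
move=> [n _ /(_ n (leqnn n)) /= hn]; exists n%:R => // f bf f0 fh.
have bfY : bounded_meas (fun w => f (Y w)) by have [? ?] := bf; exact: bmeas_comp.
rewrite -lee_fin /rexp /Rintegral fineK; last first.
  by apply: integrable_fin_num => //; exact: bmeas_integrable.
apply: le_trans (ltW hn); apply: ge0_le_integral => //.
- by move=> w _; rewrite lee_fin.
- by apply/measurable_EFinP; exact: bfY.1.
- by move=> w _; rewrite lee_fin.
Unshelve. all: by end_near. Qed.

End Moments.
(** * The two noise bounds *)

Section Centering.
Variables (R : realType) (disp0 : measure_display) (T0 : measurableType disp0).
Variables (P0 : probability T0 R) (Y : {RV P0 >-> R}).

Definition centered (f : R -> R) (x : R) : R := f x - rexp P0 (fun w => f (Y w)).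

Lemma centeredP (f : R -> R) (t : R) : bounded_meas f -> (forall x, `|f x| <= t) ->
  [/\ bounded_meas (centered f), forall x, `|centered f x| <= 2 * t,
      rexp P0 (fun w => centered f (Y w)) = 0 &
      rexp P0 (fun w => centered f (Y w) ^+ 2) <= rexp P0 (fun w => f (Y w) ^+ 2)].
Proof.
move=> bf ft; set m := rexp P0 (fun w => f (Y w)).
have bfY : bounded_meas (fun w => f (Y w)) by have [? ?] := bf; exact: bmeas_comp.
have mt : `|m| <= t.
  have bc c : bounded_meas (fun=> c : R) := bmeas_cst T0 c.
  have h1 : rexp P0 (fun=> - t) <= m.
    by apply: rexp_le => // w; have := ft (Y w); rewrite ler_norml => /andP[].
  have h2 : m <= rexp P0 (fun=> t).
    by apply: rexp_le => // w; have := ft (Y w); rewrite ler_norml => /andP[].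
  by rewrite ler_norml -[X in X <= m](rexp_cst P0) h1 -[X in m <= X](rexp_cst P0).
split.
- by apply: bmeasB => //; exact: bmeas_cst.
- move=> x; rewrite /centered -/m (le_trans (ler_normB _ _))//.
  by have := ft x; lra.
- by rewrite /centered rexpB ?rexp_cst ?subrr//; exact: bmeas_cst.
- rewrite /centered -/m.
  have -> : (fun w => (f (Y w) - m) ^+ 2) =
      fun w => (f (Y w) ^+ 2 + (- (2 * m)) * f (Y w)) + m ^+ 2.
    by apply/funext => w; ring.
  rewrite rexpD; [|by apply: bmeasD; [exact: bmeasX|exact: bmeasZ]|exact: bmeas_cst].
  rewrite rexpD; [|exact: bmeasX|exact: bmeasZ].
  rewrite rexpZ// rexp_cst -/m; have := sqr_ge0 m; nra.
Qed.

End Centering.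

Section NoiseBounds.
Variables (R : realType) (disp : measure_display) (T : measurableType disp).
Variables (P : probability T R).
Variables (disp0 : measure_display) (T0 : measurableType disp0).
Variables (P0 : probability T0 R) (Y : {RV P0 >-> R}).
Hypothesis Y0 : ('E_P0[Y] = 0)%E.
Hypothesis Y1 : ('V_P0[Y] = 1)%E.
Variables (p d : nat) (X : {ffun 'I_p -> 'I_d} -> {RV P >-> R}).
Hypothesis XY : independent_copies X Y.

Let noise w : tensor R p d := fun i => X i w.
Let tail_prob (t : R) := rexp P0 (fun w => exceeds t (Y w)).
Let trunc_mean (t : R) := rexp P0 (fun w => trunc t (Y w)).

Lemma rexp_trunc_sqr_le1 t : 0 <= t -> rexp P0 (fun w => trunc t (Y w) ^+ 2) <= 1.
Proof.
move=> t0; rewrite -[leRHS](mul1r 1).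
apply: (@rexp_le_moment _ _ _ P0 Y (fun x => trunc t x ^+ 2) (fun x => x ^+ 2)) => //.
- by apply: bmeasX; exact: bmeas_trunc.
- by move=> x; exact: sqr_ge0.
- by move=> x; exact: sqr_ge0.
- by move=> x; rewrite mul1r truncE; case: ifP => // _; rewrite expr0n sqr_ge0.
- by rewrite (second_moment Y0 Y1).
Qed.

(** The noise is the sum of the truncated and centred entries, of the constant
    tensor of their means, and of the large entries, which form a partial
    matching in the first two modes off an event of small probability. *)
Lemma outside_norm (n : nat) (B s ld tau : R) :
  ld = ln d%:R -> ld = 2 * n.+3%:R * s -> (2 <= p)%N -> (4 <= d)%N -> 1 <= ld ->
  0 < B -> d%:R <= B ^+ 2 -> 0 <= tau ->
  8 * (p%:R + 1) * ld * expR (- (2 * s)) <= 1 ->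
  64 * (p%:R + 1) * ld * expR (6 * s) * (2 * tau) <= B ->
  outside P ((n.+3 ^ p)%:R * d%:R^-1 +
             2 * (d%:R ^+ p * d%:R ^+ p.-1 * (2 * tail_prob tau ^+ 2)) +
             2 * d%:R ^+ p * tail_prob B)
    (fun w => forall a : 'I_p -> 'I_d -> R, (forall l, sqn (a l) <= 1) ->
      `|mform (noise w) a| <=
       (n.+3 ^ p)%:R * (2 ^+ p * ((flat_const R + 6 * p%:R + 2) * B)) +
       `|trunc_mean tau| * Num.sqrt d%:R ^+ p + B).
Proof.
move=> ld_ln ldE p2 d4 ld1 B0 dB tau0 step stau.
have [bg g_tau g_mean g_var] := centeredP Y (bmeas_trunc tau0) (fun x => trunc_le x tau0).
have {}g_var := le_trans g_var (rexp_trunc_sqr_le1 tau0).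
have light := outside_light bg g_tau g_mean g_var XY ld_ln ldE p2 d4 ld1 B0 dB step stau.
pose k0 : 'I_p := Ordinal (ltnW p2); pose k1 : 'I_p := Ordinal p2.
have slices := outside_and (outside_slices XY k0 tau) (outside_slices XY k1 tau).
have := outside_and (outside_and light slices) (outside_max XY B).
apply: outside_weaken.
  by rewrite card_ffun !card_ord [(d ^ p)%:R]natrX /tail_prob; lra.
move=> w [[hl [h0 h1]] hB] a a1.
pose H : tensor R p d := fun i => X i w - trunc tau (X i w).
have HE i : H i = if `|X i w| <= tau then 0 else X i w.
  by rewrite /H truncE; case: ifP => _; rewrite ?subrr ?subr0.
have -> : noise w = fun i => noise_tensor (centered Y (trunc tau)) X w i +
     (trunc_mean tau + H i).
  by apply/funext => i; rewrite /noise /noise_tensor /centered /H /trunc_mean; ring.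
rewrite mformDl (mformDl (fun=> trunc_mean tau) H).
apply: le_trans (ler_normD _ _) _; rewrite -[leRHS]addrA.
apply: lerD; first exact: hl.
apply: le_trans (ler_normD _ _) _; apply: lerD; first exact: mform_const_le.
apply: (@mform_sparse_le _ _ _ _ _ k0 k1) => //.
- exact: ltW.
- by move=> i; rewrite HE; case: ifP => _; rewrite ?normr0 ?(ltW B0) ?hB.
move=> k kk i i' ii' ik; rewrite !HE.
have : `|X i w| <= tau \/ `|X i' w| <= tau.
  by move: kk ik; rewrite !inE => /orP[]/eqP-> ik; [apply: h0|apply: h1].
by case=> ->; [left|right].
Qed.

(** The arguments in the other modes are fixed, so no net is needed: entries up to
    t have a small enough range for [outside_flat] with no flatness assumption,
    and the others have variance at most v. *)
Lemma outside_planted (u : 'I_p -> 'I_d -> R) k (t B v : R) :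
  (0 < d)%N -> 1 <= t -> t <= B ->
  (forall f : R -> R, bounded_meas f -> (forall x, 0 <= f x) ->
    (forall x, f x <= x ^+ 2 * exceeds t x) -> rexp P0 (fun w => f (Y w)) <= v) ->
  (forall l, sqn (u l) <= 1) ->
  outside P (expR (- (Num.sqrt d%:R / (16 * t))) + 32 * expR 1 * v +
             2 * d%:R ^+ p * tail_prob B)
    (fun w => forall b : 'I_d -> R, sqn b <= 1 ->
      `|mform (noise w) (upd u k b)| <=
       (flat_const R + 1) * Num.sqrt d%:R + `|trunc_mean B| * Num.sqrt d%:R ^+ p).
Proof.
move=> d0 t1 tB hv u1.
have t0 : 0 <= t by lra.
have B0 : 0 <= B by lra.
have dpos : 0 < d%:R :> R by rewrite ltr0n.
have sd0 : 0 < Num.sqrt d%:R :> R by rewrite sqrtr_gt0.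
have [bg g_tau g_mean g_var] := centeredP Y (bmeas_trunc t0) (fun x => trunc_le x t0).
have {}g_var := le_trans g_var (rexp_trunc_sqr_le1 t0).
pose f x := trunc B x - trunc t x.
have bf : bounded_meas f by apply: bmeasB; exact: bmeas_trunc.
have fE x : f x = if (t < `|x|) && (`|x| <= B) then x else 0.
  rewrite /f !truncE; have [xt|xt] := leP `|x| t; first by rewrite (le_trans xt tB) subrr.
  by rewrite subr0.
have fB x : `|f x| <= B by rewrite fE; case: ifP => [/andP[]|]; rewrite ?normr0.
have fv : rexp P0 (fun w => f (Y w) ^+ 2) <= v.
  apply: (hv (fun x => f x ^+ 2)); [exact: bmeasX|by move=> x; exact: sqr_ge0|].
  move=> x; rewrite fE exceedsE; case: (t < `|x|) => /=.
    by rewrite mulr1; case: ifP => // _; rewrite expr0n sqr_ge0.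
  by rewrite expr0n mulr0.
have v0 : 0 <= v by apply: le_trans fv; apply: rexp_ge0 => w; exact: sqr_ge0.
have [bh h_B h_mean h_var] := centeredP Y bf fB.
have {}h_var := le_trans h_var fv.
have t0' : 0 < t := lt_le_trans ltr01 t1.
have mu0 : 0 < (16 * t)^-1 by rewrite invr_gt0 mulr_gt0.
have mut : 16 * ((16 * t)^-1 * t) = 1 by field; rewrite gt_eqF.
have u_le l j : `|u l j| <= 1 by exact: entry_le1.
have flat : outside P (expR (- ((16 * t)^-1 * Num.sqrt d%:R)))
    (fun w => forall b : 'I_d -> R, sqn b <= 1 -> (forall j, `|b j| <= 1) ->
    `|mform (noise_tensor (centered Y (trunc t)) X w) (upd u k b)| <=
       flat_const R * Num.sqrt d%:R).
  apply: (outside_flat bg g_tau g_mean g_var XY (vt := 1)) => //.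
  - by move=> i; rewrite normr_prod prodr_ile1// => l _; rewrite normr_ge0 u_le.
  - by rewrite sqr_sqrtr// ltW.
  - by rewrite mulr1 invf_le1 ?mulr_gt0// (le_trans t1)// ler_peMl ?(ltW t0')// ler1n.
  - by rewrite !mulr1 -[leRHS]mut le_eqVlt; apply/orP; left; apply/eqP; ring.
have second := outside_second_moment bh h_B h_mean h_var XY k d0 v0 u1.
have := outside_and (outside_and flat second) (outside_max XY B).
apply: outside_weaken.
  rewrite card_ffun !card_ord natrX /tail_prob [_^-1 * _]mulrC; lra.
move=> w [[hf hs] hB] b b1.
have b_le j : `|b j| <= 1 by exact: entry_le1.
have -> : noise w = fun i => noise_tensor (centered Y (trunc t)) X w i +
    (noise_tensor (centered Y f) X w i + trunc_mean B).
  apply/funext => i; rewrite /noise /noise_tensor /centered.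
  have -> : rexp P0 (fun w0 => f (Y w0)) = trunc_mean B - trunc_mean t.
    have bY s0 : 0 <= s0 -> bounded_meas (fun w0 => trunc s0 (Y w0)).
      by move=> s00; have [? ?] := bmeas_trunc s00; exact: bmeas_comp.
    by rewrite /f rexpB//; exact: bY.
  by rewrite -/(trunc_mean t) /f [trunc B _]truncE hB; ring.
rewrite mformDl (mformDl _ (fun=> trunc_mean B)).
apply: le_trans (ler_normD _ _) _.
rewrite mulrDl mul1r -[leRHS]addrA; apply: lerD; first exact: hf.
apply: le_trans (ler_normD _ _) _; apply: lerD; first exact: hs.
apply: mform_const_le => l.
by rewrite /upd; case: eqP.
Qed.

End NoiseBounds.

(** * Asymptotics *)

(** The infimum of the admissible failure probabilities at d tends to zero, and it
    is nearly attained by some event. *)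
Lemma whp_of_outside (R : realType) (disp : nat -> measure_display)
    (T : forall d, measurableType (disp d)) (P : forall d, probability (T d) R)
    (A : forall d, set (T d)) :
  (forall e : R, 0 < e -> \forall d \near \oo, outside (P d) e (A d)) ->
  with_high_probability P A.
Proof.
move=> h.
pose S d : set R := [set e | 0 <= e /\ outside (P d) e (A d)].
have S1 d : S d 1.
  split=> //; exists set0; split=> //.
  by rewrite setC0 probability_setT.
have Sinf d : has_inf (S d).
  by split; [exists 1; exact: S1|exists 0 => e []].
have hG d : exists G : set (T d), [/\ measurable G, G `<=` A d &
    (P d (~` G) <= (inf (S d) + d.+1%:R^-1)%:E)%E].
  have d0 : 0 < d.+1%:R^-1 :> R by rewrite invr_gt0 ltr0n.
  have [e [e0 [G [mG Ge GA]]] le] := inf_adherent d0 (Sinf d).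
  by exists G; split=> //; rewrite (le_trans Ge)// lee_fin ltW.
pose G d := projT1 (cid (hG d)).
have GP d := projT2 (cid (hG d)); rewrite -/(G _) in GP.
exists G; split=> [d|d|]; try by have [] := GP d.
apply/fine_cvgP; split.
  by apply: nearW => d; have [mG _ _] := GP d; exact: fin_num_measure.
apply/cvgrPdist_le => e e0.
have [e2 e3] : 0 < e / 3 /\ 0 < e / 3 by split; rewrite divr_gt0.
near=> d.
have [mG _ PG] := GP d.
have le1 : inf (S d) <= e / 3.
  apply: ge_inf; first by exists 0 => x [].
  by split; [exact: ltW|near: d; exact: h].
have le2 : d.+1%:R^-1 <= e / 3.
  rewrite invf_ple ?posrE ?ltr0n//; apply: (@le_trans _ _ d%:R); last by rewrite ler_nat.
  by near: d; exact: nbhs_infty_ger.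
rewrite probability_setC// -(fineK (fin_num_measure (P d) _ mG)) -EFinB lee_fin in PG.
have le3 : fine (P d (G d)) <= 1.
  by rewrite -lee_fin fineK ?fin_num_measure//; exact: probability_le1.
have le4 : 1 - fine (P d (G d)) <= e.
  by apply: le_trans PG _; apply: le_trans (lerD le1 le2) _; lra.
by rewrite /= ger0_norm ?subr_ge0.
Unshelve. all: by end_near. Qed.
Section Thresholds.
Variable R : realType.
Implicit Types (C c e x y : R).

Lemma mul_expRN_le1 C c x : 0 < c -> 0 < x -> 2 * C / c ^+ 2 <= x ->
  C * x * expR (- (c * x)) <= 1.
Proof.
move=> c0 x0 h; rewrite expRN ler_pdivrMr ?expR_gt0// mul1r.
have cx0 : 0 <= c * x by rewrite mulr_ge0// ltW.
apply: le_trans (expR_ge1Dxn 1 cx0).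
rewrite ler_pdivrMr ?exprn_gt0// in h.
have := ler_wpM2r (ltW x0) h; rewrite exprMn.
have -> : 2`!%:R = 2 :> R by [].
by set u := c ^+ 2; lra.
Qed.

Lemma mul_expRN_le C c e x : 0 < c -> 0 < e -> C / (c * e) <= x ->
  C * expR (- (c * x)) <= e.
Proof.
move=> c0 e0; rewrite ler_pdivrMr ?mulr_gt0// => h.
rewrite expRN ler_pdivrMr ?expR_gt0//.
have xE : x * (c * e) = e * (c * x) by ring.
rewrite xE in h; apply: le_trans h _.
by rewrite ler_wpM2l ?ltW//; have := expR_ge1Dx (c * x); lra.
Qed.

Lemma exceeds_expR_le (alpha y x : R) : 0 <= alpha ->
  exceeds (expR y) x <= expR (- (alpha * y)) * `|x| `^ alpha.
Proof.
move=> a0; rewrite exceedsE; case: ltP => [h|_]; last first.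
  by rewrite mulr_ge0 ?expR_ge0 ?powR_ge0.
have x0 : 0 < `|x| by exact: lt_trans (expR_gt0 _) h.
rewrite /powR gt_eqF// -expRD -[leLHS](expR0 R) ler_expR.
have : y <= ln `|x| by rewrite -(expRK y) ler_ln ?posrE ?expR_gt0// ltW.
by nra.
Qed.

Lemma mul_exceeds_expR_le (alpha y x : R) : 1 <= alpha ->
  `|x| * exceeds (expR y) x <= expR ((1 - alpha) * y) * `|x| `^ alpha.
Proof.
move=> a1; rewrite exceedsE; case: ltP => [h|_]; last first.
  by rewrite mulr0 mulr_ge0 ?expR_ge0 ?powR_ge0.
have x0 : 0 < `|x| by exact: lt_trans (expR_gt0 _) h.
rewrite mulr1 /powR gt_eqF// -expRD -[leLHS](lnK (x := `|x|)) ?posrE// ler_expR.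
have : y <= ln `|x| by rewrite -(expRK y) ler_ln ?posrE ?expR_gt0// ltW.
by nra.
Qed.

Lemma near_ln_ge (M : R) : \forall d \near \oo, M <= ln d%:R.
Proof.
near=> d.
have h : expR M <= d%:R by near: d; exact: nbhs_infty_ger.
by rewrite -(expRK M) ler_ln ?posrE ?expR_gt0// (lt_le_trans (expR_gt0 M)).
Unshelve. all: by end_near. Qed.

Lemma near_lnln_ge (M : R) : \forall d \near \oo, M <= ln (ln d%:R) / 4.
Proof.
near=> d.
have h : expR (4 * M) <= ln d%:R by near: d; exact: near_ln_ge.
have : 4 * M <= ln (ln d%:R).
  by rewrite -(expRK (4 * M)) ler_ln ?posrE ?expR_gt0// (lt_le_trans (expR_gt0 (4 * M))).
by lra.
Unshelve. all: by end_near. Qed.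

(** In each of the three ranges of alpha the exponent of d is at least 1/2 and at
    least p / alpha, and the exponent of ln d is at least 1/2. *)
Lemma lambda_crit_ge (p d : nat) (alpha : R) : (2 <= p)%N -> 2 <= alpha ->
  1 <= ln d%:R :> R ->
  expR (Num.max (1 / 2) (p%:R / alpha) * ln d%:R + ln (ln d%:R) / 2) <=
  lambda_crit p d alpha.
Proof.
move=> p2 a2 l1; set l := ln d%:R in l1 *.
have a0 : 0 < alpha by lra.
have pR : 2 <= p%:R :> R by rewrite (ler_nat _ 2 p).
have l0 : 0 < l by lra.
have d0 : 0 < d%:R :> R by rewrite ltNge; apply/negP => /ln0 d0; rewrite /l d0 in l0; lra.
have powd x : d%:R `^ x = expR (x * l) :> R by rewrite /powR gt_eqF.
have powl x : l `^ x = expR (x * ln l) by rewrite /powR gt_eqF.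
have lnl : 0 <= ln l by rewrite ln_ge0.
rewrite /lambda_crit -/l !powd !powl -!expRD.
have pa : p%:R / alpha * alpha = p%:R by rewrite divfK// gt_eqF.
have qa : (p%:R - 1) / alpha * alpha = p%:R - 1 by rewrite divfK// gt_eqF.
have e : p%:R / alpha = (p%:R - 1) / alpha + 1 / alpha by rewrite -mulrDl subrK.
have ia : 1 / alpha * alpha = 1 by rewrite divfK// gt_eqF.
case: ifP => [h|/negbT]; [|rewrite -leNgt => h; case: ifP => [h4|/negbT]].
- rewrite ler_expR lerD//; last by lra.
  rewrite ler_pM2r// ge_max lexx/=; nra.
- rewrite ler_expR lerD//; last by lra.
  rewrite ler_pM2r// ge_max e; apply/andP; split; nra.
- rewrite -ltNge => h4; rewrite ler_expR lerD//; last by lra.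
  rewrite ler_pM2r// ge_max e; apply/andP; split; nra.
Qed.

End Thresholds.
Section SpikedBounds.
Variables (R : realType) (p : nat) (alpha K : R).
Variables (disp0 : measure_display) (T0 : measurableType disp0).
Variables (P0 : probability T0 R) (Y : {RV P0 >-> R}).
Hypothesis p2 : (2 <= p)%N.
Hypothesis a2 : 2 <= alpha.
Hypothesis K1 : 1 <= K.
Hypothesis Y0 : ('E_P0[Y] = 0)%E.
Hypothesis Y1 : ('V_P0[Y] = 1)%E.
Hypothesis YK : (\int[P0]_w (`|Y w| `^ alpha)%:E <= K%:E)%E.

Let r : R := Num.max (1 / 2) (p%:R / alpha).

Let pR : 2 <= p%:R :> R. Proof. by rewrite (ler_nat _ 2 p). Qed.
Let a0 : 0 < alpha. Proof. exact: lt_le_trans a2. Qed.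
Let K0 : 0 <= K. Proof. exact: le_trans ler01 K1. Qed.
Let r12 : 1 / 2 <= r. Proof. by rewrite le_max lexx. Qed.
Let ar : p%:R <= alpha * r.
Proof. by rewrite mulrC -ler_pdivrMr// le_max lexx orbT. Qed.

(* With this exponent the probability that some slice contains two entries larger
   than d^(r - dl) is of order d^(-1/2). *)
Let dl : R := 1 / (4 * alpha).
Let dl0 : 0 < dl. Proof. by rewrite divr_gt0// mulr_gt0. Qed.
Let adl : alpha * dl = 1 / 4. Proof. by rewrite /dl; field; rewrite gt_eqF. Qed.

Let slice_exponent l : 0 <= l ->
  p%:R * l + (p%:R - 1) * l + 2 * (- (alpha * ((r - dl) * l))) <= - (1 / 2 * l).
Proof.
move=> l0; have -> : alpha * ((r - dl) * l) = (alpha * r - 1 / 4) * l by rewrite -adl; ring.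
by have := ler_wpM2r l0 ar; lra.
Qed.

Let max_exponent l b : 0 <= l -> 0 <= b ->
  p%:R * l + - (alpha * (r * l + b)) <= - (1 * b).
Proof. by move=> l0 b0; have := ler_wpM2r l0 ar; have := ler_wpM2r b0 a2; lra. Qed.

Let trunc_mean_exponent l b : 0 <= l -> 0 <= b ->
  (1 - alpha) * ((r - dl) * l) + p%:R * (l / 2) <= r * l + b.
Proof.
move=> l0 b0.
have -> : (1 - alpha) * ((r - dl) * l) = (r - dl - alpha * r + alpha * dl) * l by ring.
rewrite adl; have := ler_wpM2r l0 ar; have := ler_wpM2r l0 pR.
by have := mulr_ge0 (ltW dl0) l0; lra.
Qed.

Let max_mean_exponent l b : 0 <= l -> 0 <= b ->
  (1 - alpha) * (r * l + b) + p%:R * (l / 2) <= 0.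
Proof.
move=> l0 b0; have h1 : 1 * b <= alpha * b by rewrite ler_wpM2r// (le_trans _ a2)// ler1n.
have h2 : p%:R / 2 <= (alpha - 1) * r.
  have := ar; have : 2 * r <= alpha * r by rewrite ler_wpM2r// (le_trans _ r12).
  lra.
by have := ler_wpM2r l0 h2; lra.
Qed.

Let quarter_exponent (e l : R) : 0 < e -> 64 / e <= l ->
  1 / (1 * e) <= expR (l / 4) / 16.
Proof.
move=> e0; have -> : 64 / e = 64 * (1 / (1 * e)) by field; rewrite gt_eqF.
by have := expR_ge1Dx (l / 4); lra.
Qed.

Let share (e : R) : 0 < e -> let e1 := e / (8 * p%:R) in
  e1 + e1 + e1 + p%:R * (e1 + e1 + e1) <= e.
Proof.
move=> e0; cbv zeta; set e1 := e / _; have p0 : 0 < p%:R :> R by exact: lt_le_trans pR.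
have e10 : 0 <= e1 by rewrite divr_ge0 ?mulr_ge0 ?ltW.
have e1E : e1 * 8 * p%:R = e by rewrite /e1; field; rewrite gt_eqF.
by have := ler_wpM2l e10 pR; lra.
Qed.

Let mpow : measurable_fun setT (fun x : R => `|x| `^ alpha).
Proof.
by apply: (measurableT_comp (measurable_powR alpha)); exact: normr_measurable.
Qed.

Lemma tail_prob_le y :
  rexp P0 (fun w => exceeds (expR y) (Y w)) <= expR (- (alpha * y)) * K.
Proof.
apply: (rexp_le_moment (bmeas_exceeds _) (exceeds_ge0 _) mpow
  (fun x => powR_ge0 _ _) (expR_ge0 _) _ YK).
by move=> x; apply: exceeds_expR_le; exact: ltW.
Qed.

Lemma trunc_mean_le y :
  `|rexp P0 (fun w => trunc (expR y) (Y w))| <= expR ((1 - alpha) * y) * K.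
Proof.
apply: (rexp_trunc_le Y0 Y1 (expR_ge0 _) mpow
  (fun x => powR_ge0 _ _) (expR_ge0 _) _ YK).
move=> x; apply: mul_exceeds_expR_le; by apply: le_trans a2; rewrite ler1n.
Qed.

Definition planted_const : R := flat_const R + 2.

(** The norm of the noise is of order B = d^r (ln d)^(1/4), which is (ln d)^(1/4)
    times smaller than the right-hand side of the first bound; this absorbs all
    constants depending on p, alpha and the moments of the entries. *)
Lemma outside_spiked (e : R) : 0 < e -> exists M : R,
  forall (disp : measure_display) (T : measurableType disp) (P : probability T R)
    (d : nat) (X : {ffun 'I_p -> 'I_d} -> {RV P >-> R}) (u : 'I_p -> 'I_d -> R),
  independent_copies X Y -> (forall l, sqn (u l) <= 1) -> (4 <= d)%N ->
  M <= ln d%:R -> M <= ln (ln d%:R) / 4 ->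
  outside P e (fun w =>
    (forall a : 'I_p -> 'I_d -> R, (forall l, sqn (a l) <= 1) ->
       4 * p%:R * `|mform (fun i => X i w) a| <=
       expR (r * ln d%:R + ln (ln d%:R) / 2)) /\
    (forall k (b : 'I_d -> R), sqn b <= 1 ->
       `|mform (fun i => X i w) (upd u k b)| <= planted_const * Num.sqrt d%:R)).
Proof.
move=> e0.
move: (a2) (K1) (pR) (K0) (a0) (r12) => h2 hK1 hpR hK0 ha0 hr12.
pose e1 := e / (8 * p%:R).
have p0 : 0 < p%:R :> R by lra.
have e10 : 0 < e1 by rewrite divr_gt0// mulr_gt0.
(* So many size classes that their ratio costs at most d^(dl/2). *)
pose n := Num.truncn (6 / dl); pose N : R := n.+3%:R.
have N0 : 0 < N by rewrite ltr0n.
have Ndl : 6 <= N * dl.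
  rewrite -ler_pdivrMr//; apply/ltW/(lt_le_trans (truncnS_gt _)).
  by rewrite ler_nat /n !ltnS leqW.
have v00 : 0 < e1 / (32 * expR 1) by rewrite divr_gt0// mulr_gt0// expR_gt0.
have [t0 t00 tail] := tail_second_moment Y0 Y1 v00.
pose A := (n.+3 ^ p)%:R * (2 ^+ p * (flat_const R + 6 * p%:R + 2)) + K + 1.
(* The thresholds that ln d and ln (ln d) / 4 have to exceed. *)
pose M := \big[Num.max/0]_(x <- [:: 1; 2 * (8 * (p%:R + 1)) / N^-1 ^+ 2;
  2 * (128 * (p%:R + 1)) / (dl / 2) ^+ 2; 4 * p%:R * A; 2 * K; 4 * t0;
  (n.+3 ^ p)%:R / (1 * e1); 4 * K ^+ 2 / (1 / 2 * e1); 2 * K / (1 * e1);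
  64 / e1]) x.
have MP x : x \in [:: 1; 2 * (8 * (p%:R + 1)) / N^-1 ^+ 2;
  2 * (128 * (p%:R + 1)) / (dl / 2) ^+ 2; 4 * p%:R * A; 2 * K; 4 * t0;
  (n.+3 ^ p)%:R / (1 * e1); 4 * K ^+ 2 / (1 / 2 * e1); 2 * K / (1 * e1);
  64 / e1] -> x <= M.
  by move=> xs; apply: le_bigmax_seq.
exists M => disp T P d X u XY u1 d4; set l := ln d%:R; set b := ln l / 4 => Ml Mb.
have {}Ml x xs := le_trans (MP x xs) Ml; have {}Mb x xs := le_trans (MP x xs) Mb.
clear MP; clearbody M.
have l1 : 1 <= l by apply: Ml; rewrite !inE eqxx.
have l0 : 0 < l by lra.
have b0 : 0 <= b by rewrite divr_ge0// ln_ge0.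
have d0 : 0 < d%:R :> R by rewrite ltr0n (leq_trans _ d4).
have dE : d%:R = expR l by rewrite lnK// posrE.
pose s := l / (2 * N).
have lE : l = 2 * n.+3%:R * s by rewrite /s -/N; field; rewrite gt_eqF.
pose B := expR (r * l + b); pose tau := expR ((r - dl) * l); pose t := expR (l / 4).
have B0 : 0 < B by exact: expR_gt0.
have dB : d%:R <= B ^+ 2.
  rewrite /B -expRM_natl dE ler_expR; have : 1 / 2 * l <= r * l by rewrite ler_pM2r.
  by lra.
have step : 8 * (p%:R + 1) * l * expR (- (2 * s)) <= 1.
  have -> : 2 * s = N^-1 * l by rewrite /s; field; rewrite gt_eqF.
  apply: mul_expRN_le1; rewrite ?invr_gt0//.
  by apply: Ml; rewrite !inE eqxx !orbT.
have stau : 64 * (p%:R + 1) * l * expR (6 * s) * (2 * tau) <= B.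
  have h : 128 * (p%:R + 1) * l * expR (- (dl / 2 * l)) <= 1.
    apply: mul_expRN_le1 => //; first by rewrite divr_gt0.
    by apply: Ml; rewrite !inE eqxx !orbT.
  have h1 : expR (6 * s) * tau <= expR (- (dl / 2 * l)) * expR (r * l).
    rewrite /tau -!expRD ler_expR.
    have : 6 * s <= dl / 2 * l.
      have -> : 6 * s = 3 * l / N by rewrite /s; field; rewrite gt_eqF.
      by rewrite ler_pdivrMr//; have := ler_wpM2r (ltW l0) Ndl; lra.
    lra.
  have -> : 64 * (p%:R + 1) * l * expR (6 * s) * (2 * tau) =
            128 * (p%:R + 1) * l * (expR (6 * s) * tau) by ring.
  apply: (@le_trans _ _ (128 * (p%:R + 1) * l * (expR (- (dl / 2 * l)) * expR (r * l)))).
    by rewrite ler_wpM2l// !mulr_ge0 ?(ltW l0)// addr_ge0.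
  rewrite mulrA; apply: (@le_trans _ _ (1 * expR (r * l))).
    by rewrite ler_wpM2r ?expR_ge0.
  by rewrite mul1r ler_expR lerDl.
have sqd : Num.sqrt d%:R = expR (l / 2).
  rewrite dE -[LHS](ger0_norm (sqrtr_ge0 _)); apply/eqP.
  rewrite -(@eqrXn2 _ 2)// ?expR_ge0// real_normK ?num_real// sqr_sqrtr ?expR_ge0//.
  by rewrite -expRM_natl; apply/eqP; congr expR; lra.
have norm := outside_norm Y0 Y1 XY erefl lE p2 d4 l1 B0 dB (expR_ge0 _) step stau.
rewrite -/tau in norm.
have t1 : 1 <= t.
  by rewrite /t -[leLHS](expR0 R) ler_expR divr_ge0// ltW.
have tB : t <= B.
  by rewrite ler_expR; have : 1 / 2 * l <= r * l; [rewrite ler_pM2r|lra].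
have t0t : t0 <= t.
  have := Ml (4 * t0); rewrite !inE eqxx !orbT => /(_ isT) h.
  by have := expR_ge1Dx (l / 4); rewrite -/t; lra.
have hv (f : R -> R) : bounded_meas f -> (forall x, 0 <= f x) ->
    (forall x, f x <= x ^+ 2 * exceeds t x) ->
    rexp P0 (fun w => f (Y w)) <= e1 / (32 * expR 1).
  move=> bf f0 ft; apply: tail => // x; apply: le_trans (ft x) _.
  rewrite ler_wpM2l ?sqr_ge0// !exceedsE; case: ltP => h; last by case: ifP.
  by rewrite (le_lt_trans t0t h).
have planted k := outside_planted Y0 Y1 XY k (leq_trans (isT : (0 < 4)%N) d4) t1 tB hv u1.
have := outside_and norm (outside_all planted); apply: outside_weaken.
  have dp m : d%:R ^+ m = expR (m%:R * l) :> R by rewrite dE expRM_natl.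
  have tauP := tail_prob_le ((r - dl) * l); rewrite -/tau in tauP.
  have BP := tail_prob_le (r * l + b); rewrite -/B in BP.
  have E1 : (n.+3 ^ p)%:R * d%:R^-1 <= e1.
    rewrite dE -expRN -[l]mul1r; apply: mul_expRN_le => //.
    by apply: Ml; rewrite !inE eqxx !orbT.
  have E2 : 2 * (d%:R ^+ p * d%:R ^+ p.-1 *
      (2 * rexp P0 (fun w => exceeds tau (Y w)) ^+ 2)) <= e1.
    rewrite !dp -expRD.
    apply: (@le_trans _ _ (2 * (expR (p%:R * l + p.-1%:R * l) *
       (2 * (expR (- (alpha * ((r - dl) * l))) * K) ^+ 2)))).
      do 3 rewrite ler_wpM2l ?expR_ge0//.
      rewrite lerXn2r ?nnegrE ?mulr_ge0 ?expR_ge0//.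
      by apply: rexp_ge0 => w; exact: exceeds_ge0.
    have -> : 2 * (expR (p%:R * l + p.-1%:R * l) *
       (2 * (expR (- (alpha * ((r - dl) * l))) * K) ^+ 2)) =
       4 * K ^+ 2 * (expR (p%:R * l + p.-1%:R * l) * expR (- (alpha * ((r - dl) * l))) ^+ 2).
      by ring.
    apply: (@le_trans _ _ (4 * K ^+ 2 * expR (- (1 / 2 * l)))).
      rewrite ler_wpM2l ?mulr_ge0 ?sqr_ge0// -expRM_natl -expRD ler_expR.
      have -> : p.-1%:R = p%:R - 1 :> R.
        by rewrite -subn1 natrB// ltnW.
      exact: slice_exponent (ltW l0).
    apply: mul_expRN_le; [by rewrite divr_gt0|exact: e10|].
    by apply: Ml; rewrite !inE eqxx !orbT.
  have E3 : 2 * d%:R ^+ p * rexp P0 (fun w => exceeds B (Y w)) <= e1.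
    apply: (@le_trans _ _ (2 * d%:R ^+ p * (expR (- (alpha * (r * l + b))) * K))).
      by rewrite ler_wpM2l// mulr_ge0// exprn_ge0.
    have -> : 2 * d%:R ^+ p * (expR (- (alpha * (r * l + b))) * K) =
       2 * K * (expR (p%:R * l) * expR (- (alpha * (r * l + b)))) by rewrite dp; ring.
    apply: (@le_trans _ _ (2 * K * expR (- (1 * b)))).
      rewrite ler_wpM2l ?mulr_ge0// -expRD ler_expR.
      exact: max_exponent (ltW l0) b0.
    apply: mul_expRN_le => //.
    by apply: Mb; rewrite !inE eqxx !orbT.
  have E4 : expR (- (Num.sqrt d%:R / (16 * t))) <= e1.
    have -> : Num.sqrt d%:R / (16 * t) = 1 * (t / 16).
      have tt : t * t = Num.sqrt d%:R by rewrite sqd /t -expRD; congr expR; field.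
      by rewrite -tt; field; rewrite gt_eqF// expR_gt0.
    rewrite -[leLHS]mul1r; apply: mul_expRN_le => //.
    apply: quarter_exponent => //.
    by apply: Ml; rewrite !inE eqxx !orbT.
  have E5 : 32 * expR 1 * (e1 / (32 * expR 1)) <= e1.
    by rewrite mulrC divfK// gt_eqF// mulr_gt0// expR_gt0.
  rewrite sumr_const card_ord -[_ *+ p]mulr_natl.
  apply: (@le_trans _ _ (e1 + e1 + e1 + p%:R * (e1 + e1 + e1))).
    by rewrite !lerD// ler_wpM2l ?(ltW p0)// !lerD.
  exact: share.
move=> w [hn hp]; split.
- move=> a a1; apply: le_trans (ler_wpM2l _ (hn a a1)) _; first by rewrite mulr_ge0.
  have m1 : `|rexp P0 (fun w => trunc tau (Y w))| * Num.sqrt d%:R ^+ p <= K * B.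
    rewrite sqd -expRM_natl.
    apply: le_trans (ler_wpM2r (expR_ge0 _) (trunc_mean_le ((r - dl) * l))) _.
    rewrite mulrAC mulrC ler_wpM2l// /B -expRD ler_expR.
    exact: trunc_mean_exponent (ltW l0) b0.
  have -> : r * l + ln l / 2 = b + (r * l + b) by rewrite /b; lra.
  rewrite expRD -/B.
  apply: (@le_trans _ _ (4 * p%:R * (A * B))).
    rewrite ler_wpM2l ?mulr_ge0// /A; move: m1.
    have -> : (n.+3 ^ p)%:R * (2 ^+ p * ((flat_const R + 6 * p%:R + 2) * B)) =
      (n.+3 ^ p)%:R * (2 ^+ p * (flat_const R + 6 * p%:R + 2)) * B by ring.
    lra.
  rewrite mulrA ler_wpM2r ?(ltW B0)//.
  have := Mb (4 * p%:R * A); rewrite !inE eqxx !orbT => /(_ isT) h.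
  by have := expR_ge1Dx b; lra.
move=> k c c1; apply: le_trans (hp k c c1) _.
have m1 : `|rexp P0 (fun w => trunc B (Y w))| * Num.sqrt d%:R ^+ p <= Num.sqrt d%:R.
  rewrite {1}sqd -expRM_natl.
  apply: le_trans (ler_wpM2r (expR_ge0 _) (trunc_mean_le (r * l + b))) _.
  apply: (@le_trans _ _ K).
    rewrite mulrAC -[leRHS]mul1r ler_wpM2r// -expRD -[leRHS](expR0 R) ler_expR.
    exact: max_mean_exponent (ltW l0) b0.
  have := Ml (2 * K); rewrite !inE eqxx !orbT => /(_ isT) h.
  by rewrite sqd; have := expR_ge1Dx (l / 2); lra.
by rewrite /planted_const; move: m1; rewrite !mulrDl; lra.
Qed.

End SpikedBounds.
(** * The rate of convergence of the tensor SVD *)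

Lemma sqn_unit_sphere (R : realType) (d : nat) (a : 'rV[R]_d) :
  unit_sphere R d a <-> sqn (fun j => a 0 j) = 1.
Proof.
have e : dotv a a = sqn (fun j => a 0 j) by apply: eq_bigr => j _; rewrite expr2.
rewrite /unit_sphere /= /enorm e; split => [a1|->]; last by rewrite sqrtr1.
by rewrite -(sqr_sqrtr (sqn_ge0 _)) a1 expr1n.
Qed.

Lemma sin_angle_unit (R : realType) (d : nat) (a b : 'rV[R]_d) :
  unit_sphere R d a -> unit_sphere R d b ->
  sin (angle a b) = Num.sqrt (1 - dotf (fun j => a 0 j) (fun j => b 0 j) ^+ 2).
Proof.
move=> a1 b1.
have le1 : `|dotv a b| <= 1.
  exact: (dotf_le1 ((sqn_unit_sphere a).1 a1) ((sqn_unit_sphere b).1 b1)).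
rewrite /angle a1 b1 mulr1 divr1 sin_acos; first by rewrite real_normK ?num_real.
by rewrite le1 (le_trans _ (normr_ge0 _)) ?lerN10.
Qed.

Theorem theorem2p3 (R : realType) :
  exists C : R, 0 < C /\
  forall p : nat, (2 <= p)%N ->
  exists Cp : R, 0 < Cp /\
  forall (alpha : R), 2 <= alpha ->
  forall (disp0 : measure_display) (T0 : measurableType disp0)
    (P0 : probability T0 R) (E : {RV P0 >-> R}),
    ('E_P0[E] = 0)%E ->
    ('V_P0[E] = 1)%E ->
    ('E_P0[fun w => (`|E w| `^ alpha)%R] < +oo)%E ->
  forall (disp : nat -> measure_display)
    (T : forall d, measurableType (disp d))
    (P : forall d, probability (T d) R)
    (noise : forall d, {ffun 'I_p -> 'I_d} -> {RV (P d) >-> R})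
    (lambda : nat -> R)
    (u : forall d, 'I_p -> 'rV[R]_d)
    (uhat : forall d, T d -> 'I_p -> 'rV[R]_d),
    (forall d, independent_copies (noise d) E) ->
    (forall d, 0 <= lambda d) ->
    (forall d k, (0 < d)%N -> unit_sphere R d (u d k)) ->
    (forall d w, (0 < d)%N ->
      is_tensor_svd (fun i => lambda d * rank_one (u d) i + noise d i w)
                    (uhat d w)) ->
    (\forall d \near \oo, C * lambda_crit p d alpha <= lambda d) ->
    with_high_probability P (fun d => [set w |
      \big[Num.max/0]_(k < p) sin (angle (uhat d w k) (u d k))
        <= Cp * (Num.sqrt d%:R / lambda d)]).
Proof.
exists 1; split=> // p p2; exists (3 * planted_const R).
have pc0 : 0 < planted_const R.
  by rewrite /planted_const /flat_const !addr_gt0// mulr_gt0// expR_gt0.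
split; first by rewrite mulr_gt0.
move=> alpha a2 disp0 T0 P0 E E0 E1 Ea disp T P noise lambda u uhat ind lam0 u1 svd crit.
pose K := 1 + fine (\int[P0]_w (`|E w| `^ alpha)%:E)%E.
have I0 : (0 <= \int[P0]_w (`|E w| `^ alpha)%:E)%E.
  by apply: integral_ge0 => w _; rewrite lee_fin powR_ge0.
have K1 : 1 <= K by rewrite lerDl fine_ge0.
have EK : (\int[P0]_w (`|E w| `^ alpha)%:E <= K%:E)%E.
  rewrite unlock in Ea.
  by rewrite /K EFinD fineK ?ge0_fin_numE// leeDr// lee_fin.
apply: whp_of_outside => e e0.
have [M HM] := outside_spiked p2 a2 K1 E0 E1 EK e0.
near=> d.
have d4 : (4 <= d)%N by near: d; exact: nbhs_infty_ge.
have d0 : (0 < d)%N by exact: leq_trans d4.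
have Ml : M <= ln d%:R by near: d; exact: near_ln_ge.
have Mll : M <= ln (ln d%:R) / 4 by near: d; exact: near_lnln_ge.
have l1 : 1 <= ln d%:R :> R by near: d; exact: near_ln_ge.
have lc : 1 * lambda_crit p d alpha <= lambda d by near: d; exact: crit.
pose uf (k : 'I_p) (j : 'I_d) := u d k 0 j.
have uf1 k : sqn (uf k) = 1 by apply/sqn_unit_sphere; exact: u1.
have uf1' k : sqn (uf k) <= 1 by rewrite uf1.
have := HM _ _ (P d) d (noise d) uf (ind d) uf1' d4 Ml Mll.
apply: outside_weaken => // w [hn hp].
have [ah1 ahmax] := svd d w d0.
pose a (k : 'I_p) (j : 'I_d) := uhat d w k 0 j.
set L := expR _ in hn.
have L0 : 0 < L by exact: expR_gt0.
have p0 : 0 < p%:R :> R by rewrite ltr0n ltnW.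
have Ll : L <= lambda d.
  by apply: le_trans lc; rewrite mul1r; exact: lambda_crit_ge.
have lam_gt0 : 0 < lambda d by exact: lt_le_trans Ll.
have N0 : 0 <= L / (4 * p%:R) by rewrite divr_ge0 ?mulr_ge0 ?ltW.
have N1 : 4 * p%:R * (L / (4 * p%:R)) <= lambda d.
  by rewrite mulrC divfK// gt_eqF// mulr_gt0.
have hN b : (forall k, sqn (b k) <= 1) ->
    `|mform (fun i => noise d i w) b| <= L / (4 * p%:R).
  by move=> b1; rewrite ler_pdivlMr ?mulr_gt0// mulrC; exact: hn.
have maxa (b : 'I_p -> 'I_d -> R) : (forall k, sqn (b k) = 1) ->
    mform (fun i => lambda d * (\prod_k uf k (i k)) + noise d i w) b <=
    mform (fun i => lambda d * (\prod_k uf k (i k)) + noise d i w) a.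
  move=> b1; have := ahmax (fun k => \row_j b k j).
  have bE k : (fun j => (\row_j' b k j') 0 j) = b k.
    by apply/funext => j; rewrite mxE.
  have -> : tensor_inner (fun i => lambda d * rank_one (u d) i + noise d i w)
       (rank_one (fun k => \row_j b k j)) =
     mform (fun i => lambda d * (\prod_k uf k (i k)) + noise d i w) b.
    apply: eq_bigr => i _; congr (_ * _); apply: eq_bigr => k _.
    by rewrite mxE.
  by apply=> k; apply/sqn_unit_sphere; rewrite bE.
have bound := svd_perturbation p2 lam_gt0 N0 N1 uf1
  (fun k => (sqn_unit_sphere _).1 (ah1 k)) maxa hN hp.
apply: bigmax_le => [|k _].
  by rewrite mulr_ge0 ?divr_ge0 ?sqrtr_ge0 ?mulr_ge0 ?(ltW pc0) ?(ltW lam_gt0).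
rewrite sin_angle_unit//; last exact: u1.
apply: le_trans (bound k) _.
by rewrite le_eqVlt; apply/orP; left; apply/eqP; rewrite !mulrA.
Unshelve. all: by end_near. Qed.
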